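(* Let $\alpha>0$ and for holomorphic $g(z)=\sum_{k\ge0}\hat g(k)z^k$ on the unit disk let $\sigma_n^\alpha(g):=\sum_{k=0}^n\binom{n}{k}\big/\binom{n+\alpha}{k}\,\hat g(k)z^k$. Then: (1) $\|\sigma_n^\alpha(g)-g\|_{A^1}\to0$ for all $g\in A^1$; (2) $\sigma_n^\alpha(h)\to h$ weak* in $\mathcal B$ for all $h\in\mathcal B$; (3) $\|\sigma_n^\alpha(f)-f\|_{\mathcal B}\to0$ for all $f\in\mathcal B_0$.
   Context: Binomial coefficients with non-integer arguments are defined via the Gamma function. $A^1$ is the Bergman space of holomorphic $f$ on the unit disk $\mathbb D$ with $\|f\|_{A^1}=\frac1\pi\int_{\mathbb D}|f|\,dA<\infty$. $\mathcal B$ is the Bloch space with norm $|f(0)|+\sup_{\mathbb D}(1-|z|^2)|f'(z)|$ and $\mathcal B_0$ the closed subspace where $(1-|z|^2)|f'(z)|\to0$ as $|z|\to1$. $\mathcal B$ is identified (up to isomorphism) with $(A^1)^*$ via $\langle g,h\rangle=\lim_{r\to1^-}\frac1\pi\int_{|z|<r}g(z)h(\overline z)\,dA(z)$; weak* refers to this duality. *)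

(* Defs.v *)
Set Warnings "-all".
From HB Require Import structures.
From mathcomp Require Import all_boot all_order all_algebra.
From mathcomp Require Import all_classical all_reals all_analysis.
From mathcomp Require Import complex.
Import Order.TTheory GRing.Theory Num.Theory.
Import numFieldNormedType.Exports.

Set Implicit Arguments.
Unset Strict Implicit.
Unset Printing Implicit Defensive.

Local Open Scope classical_set_scope.
Local Open Scope ring_scope.

(* Complex numbers: R[i] (mathcomp-real-closed); we use the alias R[i]^o,
   which carries the normed-module (hence topological) structure of
   mathcomp-analysis over the field R[i] itself, so that limits and the
   complex derivative make sense. *)
Notation Cx R := ((R[i])^o).
Notation normc := ComplexField.Normc.normc.

Section Defs.
Context (R : realType).

Definition cpt (p : R * R) : Cx R := Complex p.1 p.2.

Definition area := ((@lebesgue_measure R) \x (@lebesgue_measure R))%E.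

Definition disk (r : R) : set (R * R) := [set p | p.1 ^+ 2 + p.2 ^+ 2 < r ^+ 2].

(* A holomorphic function on the unit disk is represented by its sequence of
   Taylor coefficients  a = (ghat(k))_k ; "holomorphic on D" means that the
   power series converges at every point of D. *)
Definition holo (a : nat -> Cx R) : Prop :=
  forall z : Cx R, normc z < 1 -> cvgn (series (fun k => a k * z ^+ k)).

Definition hol (a : nat -> Cx R) (z : Cx R) : Cx R :=
  limn (series (fun k => a k * z ^+ k)).

Definition hol' (a : nat -> Cx R) (z : Cx R) : Cx R :=
  @derive1 (R[i]) (Cx R) (hol a) z.

Definition A1norm (a : nat -> Cx R) : \bar R :=
  ((pi^-1)%:E * \int[area]_(p in disk 1) (normc (hol a (cpt p)))%:E)%E.

Definition inA1 (a : nat -> Cx R) : Prop := holo a /\ (A1norm a < +oo)%E.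

Definition bloch_semi (a : nat -> Cx R) : \bar R :=
  ereal_sup [set ((1 - normc z ^+ 2) * normc (hol' a z))%:E
            | z in [set z : Cx R | normc z < 1]].

Definition Bnorm (a : nat -> Cx R) : \bar R :=
  ((normc (hol a 0))%:E + bloch_semi a)%E.

Definition inB (a : nat -> Cx R) : Prop := holo a /\ (bloch_semi a < +oo)%E.

Definition inB0 (a : nat -> Cx R) : Prop :=
  inB a /\
  forall eps : R, 0 < eps -> exists r : R, r < 1 /\
    forall z : Cx R, r < normc z -> normc z < 1 ->
      (1 - normc z ^+ 2) * normc (hol' a z) < eps.

(* generalized binomial coefficient binom(x, k) for a natural k
   (= Gamma(x+1) / (Gamma(k+1) Gamma(x-k+1)) when defined) *)
Definition gbinom (x : R) (k : nat) : R :=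
  (\prod_(i < k) (x - i%:R)) / (k`!)%:R.

Definition sigma (alpha : R) (n : nat) (a : nat -> Cx R) : nat -> Cx R :=
  fun k => if (k <= n)%N
           then (real_complex R ('C(n, k)%:R / gbinom (n%:R + alpha) k)) * a k
           else 0.

Definition pair_r (a b : nat -> Cx R) (r : R) : Cx R :=
  let F := fun p => hol a (cpt p) * hol b (conjc (cpt p)) in
  Complex (pi^-1 * Rintegral area (disk r) (fun p => @complex.Re R (F p)))
          (pi^-1 * Rintegral area (disk r) (fun p => @complex.Im R (F p))).

Definition pairable (a b : nat -> Cx R) : Prop :=
  cvg (pair_r a b r @[r --> (1 : R)^'-]).
Definition pairing (a b : nat -> Cx R) : Cx R :=
  lim (pair_r a b r @[r --> (1 : R)^'-]).

End Defs.

(* Main.v *)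
Require Import Defs.
Set Warnings "-all".
From HB Require Import structures.
From mathcomp Require Import all_boot all_order all_algebra.
From mathcomp Require Import all_classical all_reals all_analysis.
From mathcomp Require Import complex.
From mathcomp Require Import measurable_realfun cyclic separable cyclotomic.
From mathcomp Require Import ring lra zify.
Import Order.TTheory GRing.Theory Num.Theory.
Import numFieldNormedType.Exports.
Local Open Scope classical_set_scope.
Local Open Scope ring_scope.

(* The multiplier of sigma_n^alpha is the Cesaro kernel A_(n-k)^alpha / A_n^alpha.
   It is a finite average of rotations f(z) |-> f(u z), |u| = 1, with weights of
   total mass bounded independently of n.  For alpha <= 1, put mu_j = A_(j-1)^alpha:
   this sequence is concave with mu_0 = 0, and it is a nonnegative combination of the
   tents j |-> (J - |j - J|)_+.  A tent is a modulated Fejer kernel of mass J, and the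
   total mass is controlled by sum_i mu_(n/2^i) = O(mu_n).  For larger alpha,
   A^alpha is a partial sum of A^(alpha-1), which preserves the constant.

   Averages of rotations do not increase integrals over annuli or suprema over
   circles, so (1) and (3) follow by splitting the disk into |z| < s, where
   sigma_n converges uniformly, and a thin annulus.  For (2), orthogonality of
   monomials and the moments of |z|^2 give, with c the area of the disk and
   g~(z) = (g(z) - g(0)) / z,
     pi <g, h> = c g(0) h(0) + int (1 - |z|^2) g~(z) h'(conj z) dA(z),
   where dominated convergence applies to h replaced by sigma_n h. *)

(** * Linear changes of variables in the plane *)

(** For [alpha < 1] the Cesaro kernel is not positive in general, so its mass cannot be read off at
    frequency 0. Tents avoid estimating it: the tent with peak J has second difference -2 at J and
    +1 at 2 J, so matching the second difference of [mu] forces a halving recursion on the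
    coefficients, and concavity of [mu] makes them nonnegative. Measures on the circle are replaced
    by finite weights on roots of unity, which may depend on how many coefficients have to be
    matched; the remaining error is a tail of a power series, uniformly small on smaller disks. For
    (2) the obstacle is that h may be unbounded, so g(z) h(conj z) need not be integrable and the
    limit over radii is conditional. The formula trades it for an absolutely convergent integral:
    the weight 1 - |z|^2 absorbs h', and g~ is integrable along with g. Polar coordinates never
    appear. The area measure enters through its invariance under rotations, its scaling under
    dilations and the finite area of the disk. *)

Section PlaneIntegrals.
Set Implicit Arguments.
Unset Strict Implicit.
Import ComplexField.Normc.
Local Open Scope complex_scope.
Local Open Scope ring_scope.
Context {R : realType}.
Notation leb := (@lebesgue_measure R).
Notation RR := (measurableTypeR R).
Implicit Types (f : RR * RR -> \bar R).

(** The image of Lebesgue measure under x |-> s x + a, scaled by s, gives every half-open interval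
    its length, so it is Lebesgue measure by uniqueness. *)
Lemma integral_lebesgue_affine (s a : R) (f : R -> \bar R) : 0 < s ->
  @measurable_fun _ _ RR _ setT f -> (forall x, (0 <= f x)%E) ->
  (\int[leb]_x f x = s%:E * \int[leb]_x f (s * x + a)%R)%E.
Proof.
move=> s0 mf f0.
pose phi (x : RR) : RR := s * x + a.
have mphi : measurable_fun setT phi.
  have : @measurable_fun _ _ RR R setT phi by apply: measurable_funD => //; apply: measurable_funM.
  exact.
have sn0 : s != 0 by rewrite gt_eqF.
pose nu0 : measure RR R := mscale (NngNum (ltW s0)) (pushforward leb phi).
pose nu := nu0 mphi.
have E : forall A : set RR, @measurable _ RR A -> leb A = nu A.
  move=> A mA; apply: lebesgue_measure_unique => // X [[u v] /= uv <-{X}].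
  rewrite /nu /nu0 /mscale /= /pushforward.
  have -> : phi @^-1` `]u, v] = `](u - a) / s, (v - a) / s]%classic.
    apply/seteqP; split => x /=; rewrite !in_itv /= /phi.
      by move=> /andP[h1 h2]; rewrite ltr_pdivrMr// ler_pdivlMr// mulrC ltrBlDr lerBrDr h1 h2.
    by rewrite ltr_pdivrMr// ler_pdivlMr// [x * s]mulrC ltrBlDr lerBrDr.
  rewrite !lebesgue_measure_itv /= !lte_fin ltr_pM2r ?invr_gt0// ltrD2r.
  case: ifP => _; last by rewrite mule0.
  rewrite -!EFinB -EFinM; congr EFin.
  by rewrite -mulrBl opprB addrA subrK mulrC divfK.
rewrite [LHS](_ : _ = \int[nu]_x f x)%E; last first.
  by apply: eq_measure_integral => A mA _; exact: E.
rewrite ge0_integral_mscale//=.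
by congr (_ * _)%E; rewrite ge0_integral_pushforward.
Qed.

Definition shear1 (a : R) (p : R * R) : R * R := (p.1 + a * p.2, p.2).
Definition shear2 (a : R) (p : R * R) : R * R := (p.1, p.2 + a * p.1).
Definition dil (s : R) (p : R * R) : R * R := (s * p.1, s * p.2).
Definition rot (c s : R) (p : R * R) : R * R := (c * p.1 - s * p.2, s * p.1 + c * p.2).

Lemma measurable_lin (a b c d : R) : @measurable_fun _ _ (RR * RR)%type (RR * RR)%type setT
  (fun p : R * R => (a * p.1 + b * p.2, c * p.1 + d * p.2)).
Proof.
have H u v : @measurable_fun _ _ (RR * RR)%type R setT (fun p : R * R => u * p.1 + v * p.2).
  by apply: measurable_funD; apply: measurable_funM.
exact: (@measurable_fun_pair _ _ _ _ RR RR _ _ (H a b) (H c d)).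
Qed.

Lemma measurable_shear1 a : @measurable_fun _ _ (RR * RR)%type (RR * RR)%type setT (shear1 a).
Proof.
by rewrite (_ : shear1 a = fun p => (1 * p.1 + a * p.2, 0 * p.1 + 1 * p.2));
  [exact: measurable_lin | apply/funext => p; rewrite /shear1; congr (_, _); ring].
Qed.

Lemma measurable_shear2 a : @measurable_fun _ _ (RR * RR)%type (RR * RR)%type setT (shear2 a).
Proof.
by rewrite (_ : shear2 a = fun p => (1 * p.1 + 0 * p.2, a * p.1 + 1 * p.2));
  [exact: measurable_lin | apply/funext => p; rewrite /shear2; congr (_, _); ring].
Qed.

Lemma measurable_dil a : @measurable_fun _ _ (RR * RR)%type (RR * RR)%type setT (dil a).
Proof.
by rewrite (_ : dil a = fun p => (a * p.1 + 0 * p.2, 0 * p.1 + a * p.2));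
  [exact: measurable_lin | apply/funext => p; rewrite /dil; congr (_, _); ring].
Qed.

Lemma measurable_rot c s : @measurable_fun _ _ (RR * RR)%type (RR * RR)%type setT (rot c s).
Proof.
by rewrite (_ : rot c s = fun p => (c * p.1 + (- s) * p.2, s * p.1 + c * p.2));
  [exact: measurable_lin | apply/funext => p; rewrite /rot; congr (_, _); ring].
Qed.

(** By Tonelli, integrate first in the sheared coordinate: for fixed y the shear is a translation by
    a y. *)
Lemma integral_area_shear1 (a : R) f : @measurable_fun _ _ (RR * RR)%type _ setT f ->
  (forall p, (0 <= f p)%E) ->
  (\int[@area R]_p f (shear1 a p) = \int[@area R]_p f p)%E.
Proof.
move=> mf f0.
have mg := measurableT_comp mf (measurable_shear1 a).
transitivity (\int[leb]_y fubini_G leb (f \o shear1 a) y)%E; first exact: (@fubini_tonelli2 _ _ RR RR R leb leb _ mg (fun p => f0 _)).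
transitivity (\int[leb]_y fubini_G leb f y)%E; last by symmetry; exact: (@fubini_tonelli2 _ _ RR RR R leb leb _ mf f0).
apply: eq_integral => y _; rewrite /fubini_G /=.
have /= := @integral_lebesgue_affine 1 (a * y) (fun x : RR => f (x, y)) ltr01 _ _.
rewrite mul1e => -> //; last exact: measurable_fun_pair1.
by apply: eq_integral => x _; rewrite mul1r.
Qed.

Lemma integral_area_shear2 (a : R) f : @measurable_fun _ _ (RR * RR)%type _ setT f ->
  (forall p, (0 <= f p)%E) ->
  (\int[@area R]_p f (shear2 a p) = \int[@area R]_p f p)%E.
Proof.
move=> mf f0.
have mg := measurableT_comp mf (measurable_shear2 a).
transitivity (\int[leb]_x fubini_F leb (f \o shear2 a) x)%E; first exact: (@fubini_tonelli1 _ _ RR RR R leb leb _ mg (fun p => f0 _)).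
transitivity (\int[leb]_x fubini_F leb f x)%E; last by symmetry; exact: (@fubini_tonelli1 _ _ RR RR R leb leb _ mf f0).
apply: eq_integral => x _; rewrite /fubini_F /=.
have /= := @integral_lebesgue_affine 1 (a * x) (fun y : RR => f (x, y)) ltr01 _ _.
rewrite mul1e => -> //; last exact: measurable_fun_pair2.
by apply: eq_integral => y _; rewrite mul1r.
Qed.

Lemma integral_area_scale (s : R) f : 0 < s -> @measurable_fun _ _ (RR * RR)%type _ setT f ->
  (forall p, (0 <= f p)%E) ->
  ((s ^+ 2)%:E * \int[@area R]_p f (dil s p) = \int[@area R]_p f p)%E.
Proof.
move=> s0 mf f0.
have mg := measurableT_comp mf (measurable_dil s).
have -> : (\int[@area R]_p f (dil s p) = \int[leb]_x fubini_F leb (f \o dil s) x)%E.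
  exact: (@fubini_tonelli1 _ _ RR RR R leb leb _ mg (fun p => f0 _)).
have -> : (\int[@area R]_p f p = \int[leb]_x fubini_F leb f x)%E.
  exact: (@fubini_tonelli1 _ _ RR RR R leb leb _ mf f0).
have mF := @measurable_fun_fubini_tonelli_F _ _ RR RR R leb _ mf f0.
rewrite [RHS](integral_lebesgue_affine 0 s0)//; last by move=> x; apply: integral_ge0.
rewrite expr2 EFinM -muleA; congr (_ * _)%E.
have mG := @measurable_fun_fubini_tonelli_F _ _ RR RR R leb _ mg (fun p => f0 _).
rewrite -ge0_integralZl//; last 2 first.
- by move=> x _; apply: integral_ge0 => y _; exact: f0.
- by rewrite lee_fin ltW.
apply: eq_integral => x _; rewrite /fubini_F /= addr0.
rewrite [RHS](integral_lebesgue_affine 0 s0)//; last exact: (measurable_fun_pair2 _ mf).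
by congr (_ * _)%E; apply: eq_integral => y _; rewrite addr0.
Qed.

(* A rotation by an angle t <> pi is the product of the three shears with
   slopes - tan (t / 2), sin t, - tan (t / 2); rotation by pi is the square
   of the rotation by pi / 2. *)
Lemma integral_area_rot_ge0 c s f : c ^+ 2 + s ^+ 2 = 1 ->
  @measurable_fun _ _ (RR * RR)%type _ setT f -> (forall p, (0 <= f p)%E) ->
  (\int[@area R]_p f (rot c s p) = \int[@area R]_p f p)%E.
Proof.
have E c1 s1 g : c1 ^+ 2 + s1 ^+ 2 = 1 -> c1 != - 1 ->
    @measurable_fun _ _ (RR * RR)%type _ setT g -> (forall p, (0 <= g p)%E) ->
    (\int[@area R]_p g (rot c1 s1 p) = \int[@area R]_p g p)%E.
  move=> cs c1N mg g0; have c0 : 1 + c1 != 0 by rewrite addrC addr_eq0.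
  pose a := - s1 / (1 + c1).
  rewrite -(integral_area_shear1 a mg g0).
  have m1 := measurableT_comp mg (measurable_shear1 a).
  rewrite -(integral_area_shear2 s1 m1 (fun=> g0 _)).
  have m2 := measurableT_comp m1 (measurable_shear2 s1).
  rewrite -(integral_area_shear1 a m2 (fun=> g0 _)).
  apply: eq_integral => -[x y] _ /=; congr g; rewrite /rot /shear1 /shear2 /=.
  have e1 : 1 + s1 * a = c1.
    rewrite /a; apply: (mulIf c0); rewrite mulrDl -!mulrA mulVf// mulr1 mul1r mulrN -expr2.
    by rewrite -[s1 ^+ 2](addKr (c1 ^+ 2)) cs; ring.
  have e2 : a * (1 + c1) = - s1 by rewrite /a divfK.
  have e2' : a + c1 * a = - s1 by rewrite -e2; ring.
  congr (_, _); last by rewrite -[in LHS]e1; ring.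
  transitivity ((1 + s1 * a) * x + (a + (1 + s1 * a) * a) * y); last by ring.
  by rewrite e1 e2'; ring.
move=> cs mf f0; have [cN1|cN1] := eqVneq c (-1); last exact: E.
have s0 : s = 0.
  by apply/eqP; rewrite -sqrf_eq0 -(addKr (c ^+ 2) (s ^+ 2)) cs cN1; apply/eqP; ring.
have E0 : (0 : R) ^+ 2 + 1 ^+ 2 = 1 by ring.
have N0 : (0 : R) != -1 by rewrite eq_sym oppr_eq0 oner_eq0.
rewrite -(E _ _ f E0 N0 mf f0).
rewrite -(E _ _ _ E0 N0 (measurableT_comp mf (measurable_rot 0 1)) (fun=> f0 _)).
apply: eq_integral => -[x y] _ /=; congr f; rewrite /rot /= cN1 s0.
by congr (_, _); ring.
Qed.

Lemma integral_area_rot c s f : c ^+ 2 + s ^+ 2 = 1 ->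
  @measurable_fun _ _ (RR * RR)%type _ setT f ->
  (\int[@area R]_p f (rot c s p) = \int[@area R]_p f p)%E.
Proof.
move=> cs mf; rewrite integralE [in RHS]integralE.
have h1 := integral_area_rot_ge0 cs (measurable_funepos mf) (fun=> funepos_ge0 _ _).
have h2 := integral_area_rot_ge0 cs (measurable_funeneg mf) (fun=> funeneg_ge0 _ _).
by rewrite -h1 -h2; congr (_ - _)%E; apply: eq_integral => p _; rewrite ?funeposE ?funenegE.
Qed.
End PlaneIntegrals.

(** * Power series on the unit disk *)

Section PowerSeries.
Set Implicit Arguments.
Unset Strict Implicit.
Import ComplexField.Normc.
Local Open Scope complex_scope.
Local Open Scope ring_scope.
Context {R : realType}.
Notation C := (Cx R).
Implicit Types (a b : nat -> C) (z w u : C).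
Lemma normc_ge0 z : 0 <= normc z.
Proof. by case: z => x y; rewrite sqrtr_ge0. Qed.
Lemma normc_norm z : `|z| = (normc z)%:C :> R[i].
Proof. by case: z. Qed.

Lemma normc_real (x : R) : normc (x%:C) = `|x|.
Proof. by rewrite /= expr0n /= addr0 sqrtr_sqr. Qed.
Lemma normcX z n : normc (z ^+ n) = normc z ^+ n.
Proof. by elim: n => [|n IH]; rewrite ?expr0 ?normc1// !exprS normcM IH. Qed.

Lemma normc_sum (I : Type) (s : seq I) (P : pred I) (F : I -> C) :
  normc (\sum_(i <- s | P i) F i) <= \sum_(i <- s | P i) normc (F i).
Proof.
elim/big_rec2: _ => [|i x y _ IH]; first by rewrite normc0.
by rewrite (le_trans (le_normcD _ _))// lerD2l.
Qed.
Lemma normc_distC z w : normc (z - w) = normc (w - z).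
Proof. by rewrite -normcN opprB. Qed.

Lemma normc_Re z : `|complex.Re z| <= normc z.
Proof. case: z => x y /=; by rewrite -sqrtr_sqr ler_wsqrtr// lerDl sqr_ge0. Qed.
Lemma normc_Im z : `|complex.Im z| <= normc z.
Proof. case: z => x y /=; by rewrite -sqrtr_sqr ler_wsqrtr// lerDr sqr_ge0. Qed.
Lemma normc_le_ReIm z : normc z <= `|complex.Re z| + `|complex.Im z|.
Proof.
case: z => x y /=; rewrite -[leRHS]ger0_norm ?addr_ge0// -sqrtr_sqr ler_wsqrtr//.
by rewrite sqrrD !real_normK ?num_real// lerD2r lerDl mulrn_wge0// mulr_ge0.
Qed.
Lemma normcJ z : normc (conjc z) = normc z.
Proof. by case: z => x y /=; rewrite sqrrN. Qed.

Lemma cvgcP {T} (F : set_system T) {FF : Filter F} (f : T -> C) (l : C) :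
  f x @[x --> F] --> l <->
  forall e : R, 0 < e -> \forall x \near F, normc (f x - l) < e.
Proof.
split => [/cvgrPdist_lt h e e0|h].
  have /h : 0 < (e%:C : R[i]) by rewrite ltcR.
  by apply: filterS => x; rewrite normc_norm ltcR normc_distC.
(* A positive element of [R[i]] has zero imaginary part, so the given epsilon is real. *)
apply/cvgrPdist_lt => -[e e'] /= /[!ltcE] /= /andP[/eqP -> e0].
by apply: filterS (h _ e0) => x hx; rewrite normc_norm -[X in _ < X]/(e%:C) ltcR normc_distC.
Qed.

Definition psum a (n : nat) z : C := \sum_(k < n) a k * z ^+ k.

Lemma psumE a n z : psum a n z = \sum_(0 <= k < n) a k * z ^+ k.
Proof. by rewrite big_mkord. Qed.

Lemma seriesE a z n : series (fun k => a k * z ^+ k) n = psum a n z.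
Proof. by rewrite /series /= big_mkord. Qed.

(* Coefficients of a power series with radius of convergence at least 1. *)
Definition rad1 a := forall r : R, 0 <= r < 1 -> exists M : R,
  forall k, normc (a k) * r ^+ k <= M.

(** The bound at a radius s strictly between r and 1 gains a factor r / s per coefficient. This
    geometric decay is what makes the later tail estimates uniform on closed disks. *)
Lemma rad1_geo a r : rad1 a -> 0 <= r < 1 -> exists M q : R, [/\ 0 <= M, 0 <= q < 1 &
  forall k, normc (a k) * r ^+ k <= M * q ^+ k].
Proof.
move=> ra /andP[r0 r1].
pose s := (r + 1) / 2; have s0 : 0 < s by rewrite /s; lra.
have rs : r < s by rewrite /s; lra.
have [|M hM] := ra s; first by rewrite ltW //= /s; lra.
exists M, (r / s); split.
- by rewrite (le_trans _ (hM 0%N))// expr0 mulr1 normc_ge0.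
- by rewrite divr_ge0 ?(ltW s0)//= ltr_pdivrMr// mul1r.
move=> k; rewrite expr_div_n mulrA ler_pdivlMr ?exprn_gt0//.
rewrite -mulrA [_ ^+ k * _]mulrC mulrA.
by rewrite ler_wpM2r// exprn_ge0.
Qed.

(** At the real point r the terms of the convergent series tend to 0. Those past some N are below 1
    in modulus, and the first N are bounded by their sum. *)
Lemma holo_rad1 a : holo a -> rad1 a.
Proof.
move=> ha r /andP[r0 r1].
have /ha : normc (r%:C) < 1 by rewrite normc_real ger0_norm.
move=> /cvg_series_cvg_0 /cvgcP /(_ 1 ltr01)[N _ hN].
exists (\sum_(k < N) normc (a k) * r ^+ k + 1) => k.
have S0 (P : pred 'I_N) : 0 <= \sum_(k < N | P k) normc (a k) * r ^+ k.
  by apply: sumr_ge0 => i _; rewrite mulr_ge0 ?exprn_ge0 ?normc_ge0.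
have [kN|Nk] := ltnP k N.
  by rewrite (bigD1 (Ordinal kN)) //= -addrA lerDl addr_ge0.
have := hN k Nk; rewrite subr0 normcM normcX normc_real ger0_norm// => h.
by rewrite (le_trans (ltW h))// lerDr S0.
Qed.

Lemma sum_geo_le (q : R) m n : 0 <= q < 1 -> (m <= n)%N ->
  \sum_(m <= k < n) q ^+ k <= q ^+ m / (1 - q).
Proof.
move=> /andP[q0 q1] mn; have q1' : 0 < 1 - q by rewrite subr_gt0.
rewrite ler_pdivlMr// mulr_suml.
rewrite (eq_bigr (fun k => - (q ^+ k.+1 - q ^+ k))); last by move=> k _; rewrite exprS; ring.
by rewrite sumrN telescope_sumr// opprB gerBl exprn_ge0.
Qed.

Lemma normc_psumB a (M q r : R) m n z : 0 <= M -> 0 <= q < 1 ->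
  (forall k, normc (a k) * r ^+ k <= M * q ^+ k) -> normc z <= r -> (m <= n)%N ->
  normc (psum a n z - psum a m z) <= M * (q ^+ m / (1 - q)).
Proof.
move=> M0 q01 h zr mn; rewrite !psumE.
rewrite (big_cat_nat (leq0n m) mn)/= [X in normc (X - _)]addrC addrK.
rewrite (le_trans (normc_sum _ _ _))//.
apply: (@le_trans _ _ (\sum_(m <= k < n) M * q ^+ k)).
  apply: ler_sum => k _; apply: le_trans (h k); rewrite normcM normcX ler_wpM2l ?normc_ge0//.
  by rewrite lerXn2r ?nnegrE ?(le_trans _ zr) ?normc_ge0.
by rewrite -mulr_sumr ler_wpM2l// sum_geo_le.
Qed.

Lemma geo_to0 (M q e : R) : 0 <= M -> 0 <= q < 1 -> 0 < e ->
  exists N, forall n, (N <= n)%N -> M * (q ^+ n / (1 - q)) < e.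
Proof.
move=> M0 /andP[q0 q1] e0; have q1' : 0 < 1 - q by rewrite subr_gt0.
have /cvgrPdist_lt : q ^+ n @[n --> \oo] --> 0 by apply: cvg_expr; rewrite ger0_norm.
have M1 : 0 < M + 1 by lra.
have e1 : 0 < e * (1 - q) / (M + 1) by rewrite divr_gt0 ?mulr_gt0.
move=> /(_ _ e1)[N _ hN]; exists N => n Nn.
have := hN n Nn; rewrite sub0r normrN ger0_norm ?exprn_ge0//.
rewrite ltr_pdivlMr// mulrA ltr_pdivrMr// => h.
apply: le_lt_trans h; rewrite mulrC ler_wpM2l ?exprn_ge0// lerDl //.
Qed.

Lemma cvgc_ReIm {T} (F : set_system T) {FF : Filter F} (f : T -> C) (l : C) :
  complex.Re (f x) @[x --> F] --> complex.Re l ->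
  complex.Im (f x) @[x --> F] --> complex.Im l -> f x @[x --> F] --> l.
Proof.
move=> /cvgrPdist_lt h1 /cvgrPdist_lt h2; apply/cvgcP => e e0.
have e2 : 0 < e / 2 by rewrite divr_gt0.
near=> x; rewrite (le_lt_trans (normc_le_ReIm _))// [ltRHS]splitr ltrD//.
  rewrite raddfB distrC; near: x; exact: h1.
rewrite raddfB distrC; near: x; exact: h2.
Unshelve. all: by end_near. Qed.

Lemma rad1_holo a : rad1 a -> holo a.
Proof.
move=> ra z z1.
have [|M [q [M0 q01 h]]] := rad1_geo (r := normc z) ra; first by rewrite normc_ge0.
(* Comparison with a geometric series is made on real series, hence for an additive f to be taken as
   [Re] and as [Im]. *)
have K (f : {additive C -> R}) : (forall x, `|f x| <= normc x) ->
    cvgn (series (fun k => f (a k * z ^+ k))).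
  move=> f1; apply: normed_cvg.
  apply: (@series_le_cvg _ _ (fun k => M * q ^+ k)) => [n|n|n|].
  - exact: normr_ge0.
  - by case/andP: q01 => q0 _; rewrite mulr_ge0// exprn_ge0.
  - by rewrite (le_trans (f1 _))// normcM normcX.
  - apply: (@is_cvg_geometric_series _ M q).
    by case/andP: q01 => q0 q1; rewrite ger0_norm.
have [h1 h2] := (K (@complex.Re R) (@normc_Re), K (@complex.Im R) (@normc_Im)).
apply/cvg_ex; exists (Complex (limn (series (fun k => complex.Re (a k * z ^+ k))))
                              (limn (series (fun k => complex.Im (a k * z ^+ k))))).
have E (f : {additive C -> R}) : (fun n => f (series (fun k => a k * z ^+ k) n)) =
    series (fun k => f (a k * z ^+ k)).
  by apply/funext => n; rewrite /series/= raddf_sum.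
apply: cvgc_ReIm; first by rewrite (E (@complex.Re R)).
by rewrite (E (@complex.Im R)).
Qed.

Lemma hol_cvg a z : rad1 a -> normc z < 1 -> psum a n z @[n --> \oo] --> hol a z.
Proof.
move=> ra z1; have := rad1_holo ra z1; rewrite /hol.
suff -> : psum a ^~ z = series (fun k => a k * z ^+ k) by [].
by apply/funext=> n; rewrite seriesE.
Qed.

Lemma hol_unique a z l : psum a n z @[n --> \oo] --> l -> hol a z = l.
Proof.
rewrite (_ : psum a ^~ z = series (fun k => a k * z ^+ k)); last first.
  by apply/funext=> n; rewrite seriesE.
by move=> h; apply: cvg_lim h; exact: norm_hausdorff.
Qed.

Lemma cvgc_le {T} (F : set_system T) {FF : ProperFilter F} (f : T -> C) (l c : C) (e : R) :
  f x @[x --> F] --> l -> (\forall x \near F, normc (f x - c) <= e) -> normc (l - c) <= e.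
Proof.
move=> /cvgcP h1 h2; apply/ler_addgt0Pl => d d0.
have [x [hx1 hx2]] := filter_ex (filterI (h1 _ d0) h2).
rewrite (_ : l - c = (l - f x) + (f x - c)); last by rewrite addrA subrK.
by rewrite (le_trans (le_normcD _ _))// lerD// normc_distC ltW.
Qed.

Lemma hol_psum a r e : rad1 a -> 0 <= r < 1 -> 0 < e -> exists N,
  forall n z, (N <= n)%N -> normc z <= r -> normc (hol a z - psum a n z) < e.
Proof.
move=> ra r01 e0; have [M [q [M0 q01 h]]] := rad1_geo ra r01.
have [N hN] := geo_to0 M0 q01 e0; exists N => n z Nn zr.
apply: le_lt_trans (hN n Nn); apply: (@cvgc_le _ \oo _ (fun m => psum a m z)).
  by apply: hol_cvg => //; case/andP: r01 => _; exact: le_lt_trans.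
by exists n => // m /= nm; exact: normc_psumB h zr nm.
Qed.

Lemma rad1D a b : rad1 a -> rad1 b -> rad1 (fun k => a k + b k).
Proof.
move=> ra rb r r01; have [M hM] := ra r r01; have [K hK] := rb r r01.
exists (M + K) => k; apply: le_trans (lerD (hM k) (hK k)).
have /andP[r0 _] := r01; rewrite -[leRHS]mulrDl; apply: ler_wpM2r; first by apply: exprn_ge0.
exact: le_normcD.
Qed.

Lemma rad1_mul a (l : nat -> C) (K : R) : rad1 a -> (forall k, normc (l k) <= K) ->
  rad1 (fun k => l k * a k).
Proof.
move=> ra lK r r01; have [M hM] := ra r r01; exists (K * M) => k.
have K0 : 0 <= K by rewrite (le_trans _ (lK 0%N))// normc_ge0.
rewrite normcM -mulrA ler_pM// ?normc_ge0// mulr_ge0 ?normc_ge0// exprn_ge0//.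
by case/andP: r01.
Qed.

Lemma rad1N a : rad1 a -> rad1 (fun k => - a k).
Proof. by move=> ra r /ra[M hM]; exists M => k; rewrite normcN. Qed.

Lemma rad1B a b : rad1 a -> rad1 b -> rad1 (fun k => a k - b k).
Proof. by move=> ra rb; exact: rad1D ra (rad1N rb). Qed.

Lemma rad1S a : rad1 a -> rad1 (fun k => a k.+1).
Proof.
move=> ra r /andP[r0 r1]; pose s := (r + 1) / 2.
have s0 : 0 < s by rewrite /s; lra.
have [|M hM] := ra s; first by rewrite ltW //= /s; lra.
exists (M / s) => k; rewrite ler_pdivlMr//; apply: le_trans (hM k.+1).
rewrite exprSr [leRHS]mulrA; apply: ler_wpM2r; first exact: ltW.
apply: ler_wpM2l; first exact: normc_ge0.
by apply: lerXn2r; rewrite ?nnegrE ?(ltW s0)// /s; lra.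
Qed.

(* [k q^k <= 1 / (1 - q)], from [k q^k <= 1 + q + ... + q^(k-1)]. *)
Lemma natX_le (q : R) k : 0 <= q < 1 -> k%:R * q ^+ k <= (1 - q)^-1.
Proof.
move=> q01; have /andP[q0 q1] := q01.
have := @sum_geo_le q 0 k q01 (leq0n _); rewrite expr0 div1r; apply: le_trans.
rewrite big_mkord mulr_natl -[k in _ *+ k]card_ord -sumr_const ler_sum// => i _.
by rewrite ler_wiXn2l// ?(ltW q1)// ltnW.
Qed.

Lemma rad1_nat a : rad1 a -> rad1 (fun k => k%:R * a k).
Proof.
move=> ra r r01; have [M [q [M0 q01 h]]] := rad1_geo ra r01.
exists (M * (1 - q)^-1) => k; rewrite normcM -mulrA.
have -> : normc (k%:R : C) = k%:R.
  by rewrite -(rmorph_nat (real_complex R)) normc_real normr_nat.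
apply: (@le_trans _ _ (k%:R * (M * q ^+ k))); first by rewrite ler_wpM2l.
by rewrite mulrCA ler_wpM2l// natX_le.
Qed.

(** A product of coefficients at radius r splits into two factors at radius sqrt r, which is still
    below 1. *)
Lemma rad1M a b : rad1 a -> rad1 b -> rad1 (fun k => a k * b k).
Proof.
move=> ra rb r /andP[r0 r1].
have s01 : 0 <= Num.sqrt r < 1 by rewrite sqrtr_ge0 -sqrtr1 ltr_sqrt.
have [M hM] := ra _ s01; have [K hK] := rb _ s01; exists (M * K) => k.
rewrite -[r]sqr_sqrtr// -exprM mul2n -addnn exprD normcM mulrACA.
by rewrite ler_pM ?mulr_ge0 ?normc_ge0 ?exprn_ge0//; case/andP: s01.
Qed.
End PowerSeries.

(** * Termwise differentiation of power series *)

Section PowerSeriesDerivative.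
Set Implicit Arguments.
Unset Strict Implicit.
Import ComplexField.Normc.
Local Open Scope complex_scope.
Local Open Scope ring_scope.
Context {R : realType}.
Notation C := (Cx R).
Notation RR := (measurableTypeR R).
Implicit Types (a b : nat -> C) (z w u : C).

Definition dv a : nat -> C := fun k => k.+1%:R * a k.+1.

Lemma rad1_dv a : rad1 a -> rad1 (dv a).
Proof. by move=> ra; have := rad1S (rad1_nat ra). Qed.

Lemma normc_nat (n : nat) : normc (n%:R : C) = n%:R.
Proof. by rewrite -(rmorph_nat (real_complex R)) normc_real normr_nat. Qed.

Lemma eq_lerR (x y : R) : x = y -> x <= y.
Proof. by move->. Qed.

Lemma psum_dv a n z : psum (dv a) n z = \sum_(k < n.+1) a k * (k%:R * z ^+ k.-1).
Proof.
rewrite big_ord_recl /= mul0r mulr0 add0r; apply: eq_bigr => k _ /=.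
by rewrite /dv mulrCA mulrA.
Qed.

(** Multiplication by r turns the natural factor r^(k-1) into r^k, which spares special cases for k
    = 0 and r = 0. *)
Lemma exprB_bound (z w : C) (r : R) k : normc z <= r -> normc w <= r ->
  normc (w ^+ k - z ^+ k) * r <= k%:R * r ^+ k * normc (w - z).
Proof.
move=> zr wr; have r0 : 0 <= r by rewrite (le_trans _ zr) ?normc_ge0.
elim: k => [|k IH]; first by rewrite !expr0 subrr normc0 !mul0r.
have -> : w ^+ k.+1 - z ^+ k.+1 = w * (w ^+ k - z ^+ k) + (w - z) * z ^+ k.
  by rewrite !exprS; ring.
apply: (@le_trans _ _ ((r * normc (w ^+ k - z ^+ k) + normc (w - z) * r ^+ k) * r)).
  apply: ler_wpM2r => //; apply: le_trans (le_normcD _ _) _; rewrite !normcM normcX.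
  apply: lerD; first by rewrite ler_wpM2r ?normc_ge0.
  by rewrite ler_wpM2l ?normc_ge0// lerXn2r ?nnegrE ?normc_ge0.
rewrite mulrDl -mulrA (le_trans (lerD (ler_wpM2l r0 IH) (lexx _)))//.
by rewrite exprS -natr1; apply: eq_lerR; ring.
Qed.

(** The remainder for k + 1 is (w - z)(w^k - z^k) plus z times the remainder for k, so the bounds
    add up to k^2 + k <= (k + 1)^2. *)
Lemma exprB2_bound (z w : C) (r : R) k : normc z <= r -> normc w <= r ->
  normc (w ^+ k - z ^+ k - (w - z) * (k%:R * z ^+ k.-1)) * r ^+ 2 <=
    k%:R ^+ 2 * r ^+ k * normc (w - z) ^+ 2.
Proof.
move=> zr wr; have r0 : 0 <= r by rewrite (le_trans _ zr) ?normc_ge0.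
elim: k => [|k IH]; first by rewrite !expr0 subrr mul0r mulr0 subr0 normc0 expr0n /= !mul0r.
have -> : w ^+ k.+1 - z ^+ k.+1 - (w - z) * (k.+1%:R * z ^+ k.+1.-1) =
    (w - z) * (w ^+ k - z ^+ k) + z * (w ^+ k - z ^+ k - (w - z) * (k%:R * z ^+ k.-1)).
  rewrite -natr1 /=; case: k {IH} => [|k] /=; first by rewrite !expr0 expr1; ring.
  by rewrite !exprS -natr1; ring.
set D := normc (w - z); have D0 : 0 <= D by exact: normc_ge0.
apply: (@le_trans _ _ ((D * normc (w ^+ k - z ^+ k) +
    r * normc (w ^+ k - z ^+ k - (w - z) * (k%:R * z ^+ k.-1))) * r ^+ 2)).
  apply: ler_wpM2r; first by rewrite exprn_ge0.
  apply: le_trans (le_normcD _ _) _; rewrite !normcM lerD2l.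
  by rewrite ler_wpM2r ?normc_ge0.
apply: (@le_trans _ _ (D * r * (k%:R * r ^+ k * D) + r * (k%:R ^+ 2 * r ^+ k * D ^+ 2))).
  rewrite mulrDl -[in X in _ + X]mulrA; apply: lerD; last by rewrite ler_wpM2l.
  rewrite (_ : _ * r ^+ 2 = D * r * (normc (w ^+ k - z ^+ k) * r)); last by ring.
  by apply: ler_wpM2l; [rewrite mulr_ge0|exact: exprB_bound].
have -> : D * r * (k%:R * r ^+ k * D) + r * (k%:R ^+ 2 * r ^+ k * D ^+ 2) =
    (k%:R ^+ 2 + k%:R) * (r ^+ k.+1 * D ^+ 2) by rewrite [r ^+ k.+1]exprS; ring.
rewrite -[leRHS]mulrA; apply: ler_wpM2r; first by rewrite mulr_ge0 ?exprn_ge0.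
by rewrite -natr1; have := ler0n R k; nra.
Qed.

Lemma psum_bound a r : rad1 a -> 0 <= r < 1 -> exists K, forall n,
  \sum_(k < n) normc (a k) * r ^+ k <= K.
Proof.
move=> ra r01; have [M [q [M0 q01 h]]] := rad1_geo ra r01.
exists (M * (q ^+ 0 / (1 - q))) => n.
apply: (@le_trans _ _ (\sum_(k < n) M * q ^+ k)); first by apply: ler_sum => k _.
by rewrite -mulr_sumr ler_wpM2l// -(big_mkord xpredT (fun k => q ^+ k)) sum_geo_le.
Qed.

(** The remainders of the monomials are summed; K bounds the sums of k^2 |a_k| r^k. It does not
    depend on the truncation and so survives the limit. *)
Lemma hol_taylor a r : rad1 a -> 0 < r < 1 -> exists K, forall z w,
  normc z <= r -> normc w <= r ->
  normc (hol a w - hol a z - (w - z) * hol (dv a) z) * r ^+ 2 <= K * normc (w - z) ^+ 2.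
Proof.
move=> ra /andP[r0' r1]; have r0 := ltW r0'; have r01 : 0 <= r < 1 by rewrite r0.
have [K hK] := psum_bound (rad1_nat (rad1_nat ra)) r01.
exists K => z w zr wr.
(* Differentiation loses one coefficient, so [n.+1] terms of [a] correspond to [n] terms of
   [dv a]. *)
have H n : normc (psum a n.+1 w - psum a n.+1 z - (w - z) * psum (dv a) n z) * r ^+ 2 <=
    K * normc (w - z) ^+ 2.
  rewrite psum_dv /psum -sumrB mulr_sumr -sumrB.
  apply: (@le_trans _ _ (\sum_(k < n.+1) normc (a k) * (k%:R ^+ 2 * r ^+ k * normc (w - z) ^+ 2))).
    apply: le_trans (ler_wpM2r (exprn_ge0 _ r0) (normc_sum _ _ _)) _.
    rewrite mulr_suml; apply: ler_sum => k _.
    rewrite -mulrBr [(w - z) * _]mulrCA -mulrBr normcM -[leLHS]mulrA.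
    by apply: ler_wpM2l; [exact: normc_ge0|exact: exprB2_bound].
  apply: le_trans (ler_wpM2r (exprn_ge0 2 (normc_ge0 _)) (hK n.+1)).
  rewrite mulr_suml; apply: ler_sum => k _; rewrite !normcM normc_nat.
  by apply: eq_lerR; ring.
rewrite -ler_pdivlMr ?exprn_gt0// -[X in normc X]subr0.
have [z1 w1] := (le_lt_trans zr r1, le_lt_trans wr r1).
apply: (@cvgc_le _ _ \oo _ (fun n => psum a n.+1 w - psum a n.+1 z - (w - z) * psum (dv a) n z)).
  apply: cvgB; last by apply: cvgMr; exact: hol_cvg (rad1_dv ra) z1.
  by apply: cvgB; [have := hol_cvg ra w1|have := hol_cvg ra z1]; rewrite -cvg_shiftS.
by apply: nearW => n; rewrite subr0 ler_pdivlMr ?exprn_gt0.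
Qed.

Lemma hol'E a z : rad1 a -> normc z < 1 -> hol' a z = hol (dv a) z.
Proof.
move=> ra z1; rewrite /hol' /derive1.
pose r := (normc z + 1) / 2.
have z0 := normc_ge0 z.
have r01 : 0 < r < 1 by rewrite /r; lra.
have zr : normc z < r by rewrite /r; lra.
have [K hK] := hol_taylor ra r01.
apply: cvg_lim; first exact: norm_hausdorff.
apply/cvgcP => e e0.
have /andP[r0 r1] := r01; have r20 : 0 < r ^+ 2 by rewrite exprn_gt0.
(* The first entry keeps h + z in the disk of radius r; the second makes the quadratic remainder K
   |h|^2 smaller than e r^2 |h|. *)
pose d := Num.min (r - normc z) (e * r ^+ 2 / (`|K| + 1)).
have K1 : 0 < `|K| + 1 by rewrite ltr_wpDl.
have d0 : 0 < d by rewrite lt_min subr_gt0 zr divr_gt0// mulr_gt0.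
have : \forall h \near (0 : C), normc h < d.
  have /cvgcP /(_ d d0) : h @[h --> (0 : C)] --> (0 : C) by exact: cvg_id.
  by apply: filterS => h; rewrite subr0.
apply: filterS => h hd h0.
have hz : normc (h + z) <= r.
  move: hd; rewrite lt_min => /andP[hd _]; rewrite (le_trans (le_normcD _ _))//; lra.
have := hK z (h + z) (ltW zr) hz; rewrite addrK => {}hK.
have nh : 0 < normc h.
  by rewrite lt0r normc_ge0 andbT; apply: contra_neq h0 => /eq0_normc.
rewrite -(ltr_pM2r nh) -normcM mulrC mulrBr.
have -> : h * (h^-1 *: (hol a (h + z) - hol a z)) = hol a (h + z) - hol a z.
  by rewrite /GRing.scale /= mulrA divff// mul1r.
rewrite -(ltr_pM2r r20); apply: le_lt_trans hK _.
have -> : K * normc h ^+ 2 = (K * normc h) * normc h by ring.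
have -> : e * normc h * r ^+ 2 = (e * r ^+ 2) * normc h by ring.
rewrite ltr_pM2r//.
move: hd; rewrite lt_min => /andP[_]; rewrite ltr_pdivlMr// => hd.
by apply: le_lt_trans hd; rewrite mulrC ler_wpM2l ?normc_ge0// ler_wpDr// ler_norm.
Qed.

Lemma hol0 a : hol a 0 = a 0%N.
Proof.
apply: hol_unique; apply: cvg_near_cst.
exists 1%N => // n /= n1; rewrite /psum -(prednK n1) big_ord_recl /= expr0 mulr1.
by rewrite big1 ?addr0// => i _; rewrite exprS mul0r mulr0.
Qed.

Lemma holB a b z : rad1 a -> rad1 b -> normc z < 1 ->
  hol (fun k => a k - b k) z = hol a z - hol b z.
Proof.
move=> ra rb z1; apply: hol_unique.
rewrite (_ : psum _ ^~ z = fun n => psum a n z - psum b n z).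
  by apply: cvgB; exact: hol_cvg.
by apply/funext => n; rewrite /psum -sumrB; apply: eq_bigr => k _; rewrite mulrBl.
Qed.

Lemma holXM a z : rad1 a -> normc z < 1 ->
  hol a z = a 0%N + z * hol (fun k => a k.+1) z.
Proof.
move=> ra z1; apply: hol_unique; rewrite -(cvg_shiftS (psum a ^~ z)).
rewrite (_ : (fun n => _) = fun n => a 0%N + z * psum (fun k => a k.+1) n z).
  by apply: cvgD; [exact: cvg_cst|apply: cvgMr; exact: hol_cvg (rad1S ra) z1].
apply/funext => n; rewrite /psum big_ord_recl /= expr0 mulr1 mulr_sumr; congr (_ + _).
by apply: eq_bigr => k _; rewrite exprS mulrCA.
Qed.
End PowerSeriesDerivative.

(** * Multipliers that average rotations *)

Section BoundedMultipliers.
Set Implicit Arguments.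
Unset Strict Implicit.
Import ComplexField.Normc.
Local Open Scope complex_scope.
Local Open Scope ring_scope.
Context {R : realType}.
Notation C := (Cx R).
Implicit Types (z w u : C).

(** Up to frequency N, l is the moment sequence of a finitely supported complex measure on the unit
    circle of total mass at most K. The measure may depend on N, the mass bound may not. *)
Definition bmul (l : nat -> C) (K : R) := forall N : nat, exists s : seq (C * C),
  [/\ forall p, p \in s -> normc p.2 = 1,
      \sum_(p <- s) normc p.1 <= K &
      forall k, (k < N)%N -> l k = \sum_(p <- s) p.1 * p.2 ^+ k].

Lemma bmul_eq (l l' : nat -> C) K : bmul l K -> l =1 l' -> bmul l' K.
Proof. by move=> h /funext <-. Qed.

Lemma bmul_le (l : nat -> C) K K' : bmul l K -> K <= K' -> bmul l K'.
Proof.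
by move=> h KK' N; have [s [h1 h2 h3]] := h N; exists s; split => //; exact: le_trans KK'.
Qed.

Lemma bmul0 : bmul (fun=> 0) 0.
Proof. by move=> N; exists [::]; split => // [|k _]; rewrite big_nil. Qed.

Lemma bmulD (l l' : nat -> C) K K' : bmul l K -> bmul l' K' -> bmul (fun k => l k + l' k) (K + K').
Proof.
move=> h h' N; have [s [h1 h2 h3]] := h N; have [s' [h1' h2' h3']] := h' N.
exists (s ++ s'); split=> [p||k kN].
- by rewrite mem_cat => /orP[/h1|/h1'].
- by rewrite big_cat lerD.
- by rewrite big_cat /= h3// h3'.
Qed.

Lemma bmulZ (l : nat -> C) K c : bmul l K -> bmul (fun k => c * l k) (normc c * K).
Proof.
move=> h N; have [s [h1 h2 h3]] := h N.
exists [seq (c * p.1, p.2) | p <- s]; split=> [p /mapP[q qs ->]||k kN] /=.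
- exact: h1.
- rewrite big_map /=; under eq_bigr do rewrite normcM.
  by rewrite -mulr_sumr ler_wpM2l// normc_ge0.
- by rewrite big_map h3// mulr_sumr; apply: eq_bigr => p _; rewrite mulrA.
Qed.

Lemma bmul_sum (n : nat) (L : nat -> nat -> C) (K : nat -> R) :
  (forall i, (i < n)%N -> bmul (L i) (K i)) ->
  bmul (fun k => \sum_(i < n) L i k) (\sum_(i < n) K i).
Proof.
elim: n => [|n IH] h.
  by rewrite big_ord0; apply: bmul_eq bmul0 _ => k; rewrite big_ord0.
rewrite big_ord_recr; apply: bmul_eq; first apply: bmulD (h n _) => //.
  by apply: IH => i ni; apply: h; exact: ltnW.
by move=> k /=; rewrite big_ord_recr.
Qed.

Lemma bmul_norm (l : nat -> C) K k : bmul l K -> normc (l k) <= K.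
Proof.
move=> /(_ k.+1)[s [h1 h2 h3]]; rewrite h3// (le_trans (normc_sum _ _ _))//.
rewrite (le_trans _ h2)// big_seq [leRHS]big_seq; apply: ler_sum => p ps.
by rewrite normcM normcX h1// expr1n mulr1.
Qed.

(** X^n - 1 splits over the algebraically closed field [R[i]] and is separable since n is nonzero
    there; n distinct n-th roots of unity include a primitive one. *)
Lemma prim_root_exists (n : nat) : (0 < n)%N -> {z : R[i] | n.-primitive_root z}.
Proof.
pose p : {poly R[i]} := 'X^n - 1; have [r Dp] := closed_field_poly_normal p.
move=> n_gt0; apply/sigW; rewrite (monicP _) ?monicXnsubC // scale1r in Dp.
have rn1 : all n.-unity_root r by apply/allP=> z; rewrite -root_prod_XsubC -Dp.
have sz_r : (n < (size r).+1)%N.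
  by rewrite -(size_prod_XsubC r id) -Dp size_XnsubC.
have [|z] := hasP (has_prim_root n_gt0 rn1 _ sz_r); last by exists z.
by rewrite -separable_prod_XsubC -Dp separable_Xn_sub_1 // pnatr_eq0 -lt0n.
Qed.

Lemma normc_unity (M : nat) z : (0 < M)%N -> z ^+ M = 1 -> normc z = 1.
Proof.
move=> M0 zM; apply/eqP; rewrite -(@pexpr_eq1 _ (normc z) M)// ?normc_ge0//.
by rewrite -normcX zM normc1.
Qed.

(** Orthogonality of characters: off the diagonal the sum is geometric with ratio v = w^(a-b), where
    v <> 1 but v^M = 1. *)
Lemma prim_root_sum (M a b : nat) (w : R[i]) : M.-primitive_root w -> (a < M)%N -> (b < M)%N ->
  \sum_(l < M) (w ^+ l) ^+ a * (w ^+ l) ^- b = (if a == b then M%:R else 0) :> R[i].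
Proof.
move=> pw aM bM; have M0 : (0 < M)%N by exact: leq_ltn_trans aM.
have w0 : w != 0 by rewrite (prim_root_eq0 pw) -lt0n.
pose v := w ^+ a / w ^+ b.
rewrite (eq_bigr (fun l : 'I_M => v ^+ l)); last first.
  by move=> l _; rewrite /v expr_div_n -!exprM ![(l * _)%N]mulnC.
have [ab|ab] := eqVneq a b.
  by rewrite /v ab; under eq_bigr do rewrite divff ?expf_neq0// expr1n;
    rewrite sumr_const card_ord.
have v1 : v - 1 != 0.
  rewrite subr_eq0; apply: contra ab => /eqP /(congr1 (fun t => t * w ^+ b)).
  rewrite /v divfK ?expf_neq0// mul1r => /eqP.
  by rewrite (eq_prim_root_expr pw) !modn_small.
apply: (mulfI v1); rewrite mulr0 -subrX1 /v expr_div_n -!exprM ![(_ * M)%N]mulnC !exprM.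
by rewrite (prim_expr_order pw) !expr1n divff ?oner_neq0// subrr.
Qed.

(** The tent is a convolution of two intervals: it is the coefficient of u^j in u (1 + ... +
    u^(J-1))^2. *)
Lemma minn_count (J j : nat) :
  (minn j (J.*2 - j) = \sum_(i < J) \sum_(i' < J) (i + i' + 1 == j))%N.
Proof.
have H (i : nat) : (i < J)%N -> (\sum_(i' < J) (i + i' + 1 == j) = (i < j <= i + J))%N.
  move=> iJ; case: (boolP (i < j <= i + J)%N) => [/andP[ij jiJ]|h].
    have k : (j - i - 1 < J)%N by lia.
    rewrite (bigD1 (Ordinal k)) //= big1 => [|i' /eqP ne]; first by rewrite addn0; apply/eqP; rewrite eqb1; apply/eqP; lia.
    by apply/eqP; rewrite eqb0; apply/eqP => e; apply: ne; apply: val_inj => /=; lia.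
  by rewrite big1// => i' _; apply/eqP; rewrite eqb0; apply/eqP => e; move: h (ltn_ord i'); lia.
under eq_bigr => i _ do rewrite H//.
have G n : (\sum_(i < n) (i < j <= i + J) = minn j n - (j - J))%N.
  by elim: n => [|n IH]; rewrite ?big_ord0 ?big_ord_recr /= ?IH; lia.
by rewrite G; lia.
Qed.

(* The Fejer kernel: (1 / M) |1 + u + ... + u^(J-1)|^2, modulated to be
   centered at the frequency n - J, is a convex weight on the M-th roots of
   unity up to the factor J. *)
Lemma bmul_tent (J n : nat) :
  bmul (fun k => (minn (n - k) (J.*2 - (n - k)))%:R) J%:R.
Proof.
(* The frequencies i + i' + 1 + k with i, i' < J and k < N, and the target n, all lie below M, so
   orthogonality on the M-th roots involves no wrap-around. *)
move=> N; pose M := (J + J + N + n).+1.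
have [w pw] := prim_root_exists (ltn0Sn (J + J + N + n)).
have w0 : w != 0 by rewrite (prim_root_eq0 pw).
have wM (l : nat) : (w ^+ l) ^+ M = 1 by rewrite -exprM mulnC exprM (prim_expr_order pw) expr1n.
have nw (l : nat) : normc (w ^+ l) = 1 by exact: normc_unity (wM l).
pose S (l : nat) : R[i] := \sum_(i < J) (w ^+ l) ^+ i.
(* [S ^+ 2] instead of |S|^2 only shifts the Fejer kernel in frequency: on the unit circle [W] has
   modulus |S|^2 / M. *)
pose W (l : nat) : R[i] := M%:R^-1 * ((w ^+ l) * (w ^+ l) ^- n * S l ^+ 2).
exists [seq (W l, w ^+ l) | l <- iota 0 M]; split=> [p /mapP[l _ ->]||k kN]; first exact: nw.
- rewrite big_map -[iota 0 M]/(index_iota 0 M) big_mkord.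
  have E (l : nat) : ((normc (W l))%:C = M%:R^-1 * \sum_(i < J) \sum_(i' < J) (w ^+ l) ^+ i * (w ^+ l) ^- i')%C.
    have -> : normc (W l) = M%:R^-1 * normc (S l) ^+ 2.
      rewrite /W; have := nw l; move: (w ^+ l) (S l) => x y nx.
      by rewrite !normcM !normcV !normcX nx expr1n invr1 !mul1r normc_nat.
    rewrite rmorphM /= fmorphV /= rmorph_nat; congr (_ * _).
    rewrite rmorphXn /= -normc_norm sqr_normc /S mulr_suml; apply: eq_bigr => i _.
    rewrite rmorph_sum mulr_sumr; apply: eq_bigr => i' _; congr (_ * _).
    have nz : w ^+ l != 0 by rewrite expf_neq0.
    rewrite rmorphXn -exprVn; congr (_ ^+ _); apply: (mulfI nz).
    by rewrite divff// -sqr_normc normc_norm nw expr1n.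
  have O (i i' : 'I_J) : \sum_(l < M) (w ^+ l) ^+ i * (w ^+ l) ^- i' =
      (if i == i' :> nat then M%:R else 0) :> R[i].
    by apply: (prim_root_sum pw); have := ltn_ord i; have := ltn_ord i'; rewrite /M; lia.
  apply: eq_lerR; apply: complexI; rewrite rmorph_sum /= (eq_bigr _ (fun (l : 'I_M) _ => E l)).
  rewrite -mulr_sumr exchange_big /=.
  under eq_bigr => i _.
    rewrite exchange_big /=; under eq_bigr => i' _ do rewrite O.
    rewrite (bigD1 i)//= eqxx big1; last first.
      by move=> i' /eqP ne; case: eqP => // e; case: ne; apply: val_inj.
    rewrite addr0; over.
  rewrite sumr_const card_ord rmorph_nat mulrnAr mulVf// pnatr_eq0//.
rewrite big_map -[iota 0 M]/(index_iota 0 M) big_mkord.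
rewrite (eq_bigr (fun l : 'I_M => M%:R^-1 * \sum_(i < J) \sum_(i' < J)
    ((w ^+ l) ^+ (i + i' + 1 + k) * (w ^+ l) ^- n))); last first.
  move=> l _; rewrite /W -!mulrA; congr (_ * _).
  rewrite expr2 /S; set x := w ^+ l.
  transitivity ((x * x ^- n * x ^+ k) * ((\sum_(i < J) x ^+ i) * (\sum_(i < J) x ^+ i))); first by ring.
  rewrite mulr_suml mulr_sumr; apply: eq_bigr => i _; rewrite !mulr_sumr; apply: eq_bigr => i' _.
  by rewrite !exprD expr1; ring.
have O (i i' : 'I_J) : \sum_(l < M) (w ^+ l) ^+ (i + i' + 1 + k) * (w ^+ l) ^- n =
    (if (i + i' + 1 + k == n)%N then M%:R else 0) :> R[i].
  by apply: (prim_root_sum pw); have := ltn_ord i; have := ltn_ord i'; rewrite /M; lia.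
rewrite -mulr_sumr exchange_big /=.
under eq_bigr => i _.
  rewrite exchange_big /=; under eq_bigr => i' _ do rewrite O.
  over.
rewrite minn_count natr_sum mulr_sumr; apply: eq_bigr => i _.
rewrite natr_sum mulr_sumr; apply: eq_bigr => i' _.
have -> : (i + i' + 1 == n - k)%N = (i + i' + 1 + k == n)%N by apply/eqP/eqP; lia.
by case: eqP => _; rewrite ?mulr0// mulVf ?pnatr_eq0.
Qed.

End BoundedMultipliers.

(** * Tent decomposition of the Cesaro numbers *)

Section CesaroMultipliers.
Set Implicit Arguments.
Unset Strict Implicit.
Import ComplexField.Normc.
Local Open Scope complex_scope.
Local Open Scope ring_scope.
Context {R : realType}.
Notation C := (Cx R).

(** The Cesaro number A_i^(alpha-1) in product form. Its order is one below that of [mu], whose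
    increments it gives. *)
Definition dl (alpha : R) (i : nat) : R := \prod_(l < i) ((l%:R + alpha) / l.+1%:R).
Definition mu (alpha : R) (n : nat) : R := \sum_(i < n) dl alpha i.

Lemma dl0 alpha : dl alpha 0 = 1.
Proof. by rewrite /dl big_ord0. Qed.
Lemma dlS alpha i : dl alpha i.+1 = dl alpha i * ((i%:R + alpha) / i.+1%:R).
Proof. by rewrite /dl big_ord_recr. Qed.
Lemma muS alpha n : mu alpha n.+1 = mu alpha n + dl alpha n.
Proof. by rewrite /mu big_ord_recr. Qed.
Lemma mu0 alpha : mu alpha 0 = 0.
Proof. by rewrite /mu big_ord0. Qed.

Lemma dl_gt0 alpha i : 0 < alpha -> 0 < dl alpha i.
Proof.
move=> a0; apply: prodr_gt0 => l _.
by rewrite divr_gt0// ltr_wpDl.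
Qed.
Lemma mu_ge0 alpha n : 0 < alpha -> 0 <= mu alpha n.
Proof. by move=> a0; apply: sumr_ge0 => i _; rewrite ltW ?dl_gt0. Qed.
Lemma mu_gt0 alpha n : 0 < alpha -> 0 < mu alpha n.+1.
Proof. by move=> a0; rewrite muS ltr_wpDl ?mu_ge0 ?dl_gt0. Qed.

Lemma dl_mu alpha n : n%:R * dl alpha n = alpha * mu alpha n.
Proof.
elim: n => [|n IH]; first by rewrite mu0 mulr0 mul0r.
by rewrite dlS muS mulrDr -IH; field.
Qed.

Lemma mu_dl alpha n : mu alpha n.+1 = dl (alpha + 1) n.
Proof.
elim: n => [|n IH]; first by rewrite muS mu0 !dl0 add0r.
rewrite muS [dl (alpha + 1) _]dlS -IH; apply: (mulfI (_ : n.+1%:R != 0)); first by rewrite pnatr_eq0.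
rewrite mulrDr dl_mu mulrCA [n.+1%:R * (_ / _)]mulrC divfK ?pnatr_eq0//.
by rewrite -natr1; ring.
Qed.

(** Concavity of [mu], for which [alpha <= 1] is required. *)
Lemma dl_decr alpha i : 0 < alpha <= 1 -> dl alpha i.+1 <= dl alpha i.
Proof.
move=> /andP[a0 a1]; rewrite dlS; apply: ler_piMr; first by rewrite ltW// dl_gt0.
by rewrite ler_pdivrMr// mul1r -natr1 lerD2l.
Qed.

Lemma dl_mono alpha i j : 0 < alpha <= 1 -> (i <= j)%N -> dl alpha j <= dl alpha i.
Proof.
move=> a01 /subnKC <-; elim: (j - i)%N => [|k IH]; first by rewrite addn0.
by rewrite addnS (le_trans (dl_decr _ a01)).
Qed.

(* Fuelled form of the recursion
   c J = (dl (J - 1) - dl J + [J even] c (J / 2)) / 2. *)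
Fixpoint cfuel (alpha : R) (f J : nat) : R :=
  if f is f'.+1 then
    if J is J'.+1 then
      (dl alpha J' - dl alpha J + (if odd J then 0 else cfuel alpha f' J./2)) / 2
    else 0
  else 0.

Lemma cfuel_eq alpha f g J : (J <= f)%N -> (J <= g)%N -> cfuel alpha f J = cfuel alpha g J.
Proof.
elim: f g J => [|f IH] [|g] [|J] //= Jf Jg.
by case: ifP => // _; rewrite (IH g)//=; lia.
Qed.

(** The coefficient of the tent with peak J in the decomposition of [mu]. *)
Definition cc (alpha : R) J := cfuel alpha J J.

Lemma ccS alpha J : 2 * cc alpha J.+1 =
  dl alpha J - dl alpha J.+1 + (if odd J.+1 then 0 else cc alpha J.+1./2).
Proof.
rewrite {1}/cc /= mulrC divfK ?pnatr_eq0//; congr (_ + _); case: ifP => // _.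
by apply: cfuel_eq => //=; lia.
Qed.

Lemma cc0 alpha : cc alpha 0 = 0. Proof. by []. Qed.

Lemma cc_ge0 alpha J : 0 < alpha <= 1 -> 0 <= cc alpha J.
Proof.
move=> a01; elim/ltn_ind: J => -[|J] IH //.
have := ccS alpha J; have := dl_decr J a01.
case: ifP => _; first by lra.
by have := IH J.+1./2 (ltac:(lia)); lra.
Qed.

Lemma sum_even (F : nat -> R) n : F 0%N = 0 ->
  \sum_(J < n.+1) (if odd J then 0 else F J./2) = \sum_(I < n./2.+1) F I.
Proof.
move=> F0; elim: n => [|n IH]; first by rewrite !big_ord_recr !big_ord0.
rewrite big_ord_recr IH /=; case: (boolP (odd n)) => on /=.
  have -> : uphalf n = n./2.+1 by lia.
  by rewrite [in RHS]big_ord_recr.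
by rewrite addr0; have -> : uphalf n = n./2 by lia.
Qed.

Lemma cc_sum alpha n : 2 * \sum_(J < n.+1) cc alpha J =
  1 - dl alpha n + \sum_(I < n./2.+1) cc alpha I.
Proof.
rewrite -(sum_even _ (cc0 alpha)) mulr_sumr !big_ord_recl /= cc0 mulr0 !add0r.
rewrite (eq_bigr (fun i : 'I_n => (dl alpha i - dl alpha i.+1) +
  (if odd (lift ord0 i) then 0 else cc alpha (lift ord0 i)./2))); last first.
  by move=> i _; rewrite -ccS.
rewrite big_split /=; congr (_ + _).
rewrite -(big_mkord xpredT (fun i => dl alpha i - dl alpha i.+1)) -[1](dl0 alpha).
rewrite -[RHS]opprB -telescope_sumr// -sumrN.
by apply: eq_bigr => i _; rewrite opprB.
Qed.

(** With S(n) the sum, 2 S(n) = 1 - dl n + S(n/2) <= 1 + 1 by strong induction. The deficit 1 - S(n)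
    becomes the coefficient of the last tent in [mu_tents], hence its sign matters. *)
Lemma cc_sum_le1 alpha n : 0 < alpha <= 1 -> \sum_(J < n.+1) cc alpha J <= 1.
Proof.
move=> a01; elim/ltn_ind: n => -[|n] IH; first by rewrite big_ord_recr big_ord0 /= cc0 addr0.
have := cc_sum alpha n.+1; have := IH n.+1./2 (ltac:(lia)).
have := @dl_gt0 alpha n.+1 (ltac:(lra)).
by lra.
Qed.

(** The recursion is summed against J. An even J = 2 I contributes 2 I [cc I], so the halved sum
    returns with coefficient 1; summation by parts turns the differences of [dl] into mu n - n dl
    n. *)
Lemma cc_moment alpha n : \sum_(J < n.+1) J%:R * cc alpha J =
  (mu alpha n - n%:R * dl alpha n) / 2 + \sum_(I < n./2.+1) I%:R * cc alpha I.
Proof.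
have H : \sum_(J < n.+1) J%:R * (2 * cc alpha J) =
  mu alpha n - n%:R * dl alpha n + \sum_(I < n./2.+1) 2 * (I%:R * cc alpha I).
  rewrite -(sum_even (F := fun I => 2 * (I%:R * cc alpha I))) ?mul0r ?mulr0//.
  rewrite !big_ord_recl /= mul0r mul0r mulr0 !add0r.
  rewrite (eq_bigr (fun i : 'I_n => i.+1%:R * (dl alpha i - dl alpha i.+1) +
    (if odd (lift ord0 i) then 0 else 2 * ((lift ord0 i)./2%:R * cc alpha (lift ord0 i)./2)))); last first.
    move=> i _; rewrite /= /bump leq0n add1n ccS mulrDr; congr (_ + _).
    rewrite -[~~ odd i]/(odd i.+1); case: ifP => [_|oi]; first by rewrite mulr0.
    rewrite mulrA -natrM; congr (_%:R * _); have := odd_double_half i.+1.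
    by rewrite oi add0n -mul2n.
  rewrite big_split /=; congr (_ + _).
  elim: n => [|n IH]; first by rewrite big_ord0 mu0 mul0r subrr.
  by rewrite big_ord_recr /= IH muS -natr1; ring.
rewrite -mulr_sumr in H.
have -> : \sum_(J < n.+1) J%:R * cc alpha J = (\sum_(J < n.+1) J%:R * (2 * cc alpha J)) / 2.
  by rewrite mulr_suml; apply: eq_bigr => J _; field.
by rewrite H; field.
Qed.

(** Halving the index lowers [mu] by a fixed proportion: mu m - mu (m/2) >= (m - m/2) dl m >= alpha
    mu m / 2, because [dl] decreases and m dl m = alpha mu m. This drop, divided by alpha, pays for
    the new term of [cc_moment]. *)
Lemma cc_moment_le alpha n : 0 < alpha <= 1 ->
  \sum_(J < n.+1) J%:R * cc alpha J <= mu alpha n / alpha.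
Proof.
move=> a01; have /andP[a0 a1] := a01; elim/ltn_ind: n => -[|n] IH.
  by rewrite big_ord_recr big_ord0 /= mul0r addr0 divr_ge0 ?mu_ge0// ltW.
rewrite cc_moment; set m := n.+1; have mlt : (m./2 < m)%N by rewrite /m; lia.
apply: le_trans (lerD (lexx _) (IH _ mlt)) _.
have d0 := @dl_gt0 alpha m a0.
have h1 : 0 <= m%:R * dl alpha m by rewrite mulr_ge0// ltW.
have h2 : mu alpha m - mu alpha m./2 >= (m - m./2)%:R * dl alpha m.
  have mm : (m./2 <= m)%N by exact: ltnW.
  rewrite /mu -!(big_mkord xpredT (dl alpha)) (big_cat_nat (leq0n _) mm) /=.
  rewrite addrAC subrr add0r mulr_natl -sumr_const_nat.
  apply: ler_sum_nat => i /andP[_ im].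
  by apply: dl_mono => //; lia.
have h3 : (m - m./2)%:R * dl alpha m >= alpha * mu alpha m / 2.
  rewrite -dl_mu mulrAC ler_pM2r// ler_pdivrMr// -natrM ler_nat; lia.
have h4 := @mu_ge0 alpha m a0.
rewrite -(ler_pM2r a0) mulrDl !divfK ?gt_eqF//; nra.
Qed.

Definition phi (J j : nat) : nat := minn j (J.*2 - j).

(** Both sides vanish at 0, equal 1 at 1 and have the same second differences on the range. The tent
    with peak n + 1 is linear there and serves to correct the slope. *)
Lemma mu_tents alpha n j : (j <= n.+1)%N ->
  mu alpha j = \sum_(J < n.+1) cc alpha J * (phi J j)%:R +
    (1 - \sum_(J < n.+1) cc alpha J) * (phi n.+1 j)%:R.
Proof.
have E i : (i <= n.+1)%N -> phi n.+1 i = i by rewrite /phi; lia.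
pose F i := \sum_(J < n.+1) cc alpha J * (phi J i)%:R.
(* A second order recurrence, so the induction carries two consecutive values. *)
have P i : (i <= n)%N ->
    mu alpha i = F i + (1 - \sum_(J < n.+1) cc alpha J) * i%:R /\
    mu alpha i.+1 = F i.+1 + (1 - \sum_(J < n.+1) cc alpha J) * i.+1%:R.
  elim: i => [|i IH] ni.
    have -> : F 0%N = 0 by rewrite /F big1// => J _; rewrite /phi min0n mulr0.
    have -> : F 1%N = \sum_(J < n.+1) cc alpha J.
      apply: eq_bigr => -[[|J] ?] _ /=; first by rewrite cc0 mul0r.
      by rewrite (_ : phi _ _ = 1%N) ?mulr1// /phi; lia.
    by rewrite muS mu0 dl0; split; ring.
  have [h1 h2] := IH (ltnW ni); split => //.
  have K : F i.+2 = 2 * F i.+1 - F i - (dl alpha i - dl alpha i.+1).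
    have -> : dl alpha i - dl alpha i.+1 =
        2 * cc alpha i.+1 - (if odd i.+1 then 0 else cc alpha i.+1./2).
      by rewrite ccS; ring.
    (* Minus the second difference at i + 1 of the tent with peak J: a kink 2 at the peak and -1 at
       the right foot. *)
    pose D (J : nat) : R := (if J == i.+1 then 2 else 0) - (if J.*2 == i.+1 then 1 else 0).
    have -> : 2 * cc alpha i.+1 - (if odd i.+1 then 0 else cc alpha i.+1./2) =
        \sum_(J < n.+1) cc alpha J * D J.
      rewrite /D; under eq_bigr do rewrite mulrBr.
      rewrite sumrB; congr (_ - _).
        have k : (i.+1 < n.+1)%N by [].
        rewrite (bigD1 (Ordinal k)) //= eqxx big1 ?addr0; first by rewrite mulrC.
        move=> J /eqP ne; case: eqP => [e|_]; last by rewrite mulr0.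
        by case: ne; apply: val_inj.
      case: ifP => oi.
        rewrite big1// => J _; case: eqP => [e|_]; last by rewrite mulr0.
        by move: oi; rewrite -e odd_double.
      have k : (i.+1./2 < n.+1)%N by lia.
      rewrite (bigD1 (Ordinal k)) //= big1 ?addr0.
        by rewrite (_ : (_ == _) = true) ?mulr1//; apply/eqP; lia.
      move=> J /eqP ne; case: eqP => [e|_]; last by rewrite mulr0.
      by case: ne; apply: val_inj => /=; lia.
    rewrite /F mulr_sumr -!sumrB; apply: eq_bigr => J _.
    suff : (phi J i.+2)%:R = 2 * (phi J i.+1)%:R - (phi J i)%:R - D J by move=> ->; ring.
    have : (phi J i.+2 + phi J i + (if (J : nat) == i.+1 then 2 else 0) =
       phi J i.+1 + phi J i.+1 + (if (J : nat).*2 == i.+1 then 1 else 0))%N.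
      by rewrite /phi; case: eqP; case: eqP; lia.
    move=> /(congr1 (fun t : nat => t%:R : R)); rewrite !natrD /D.
    by case: eqP => _; case: eqP => _ /= h; lra.
  rewrite muS K [mu alpha i.+1]h2.
  have : dl alpha i = mu alpha i.+1 - mu alpha i by rewrite muS; ring.
  by rewrite h1 h2 => e; rewrite -[i.+2%:R]natr1 -[i.+1%:R]natr1 in e *; lra.
case: j => [|j] jn; rewrite E//.
  by have [-> _] := P 0%N (leq0n _).
by have [_ ->] := P j jn.
Qed.

Lemma bmul_real_sum (n : nat) (L : nat -> nat -> R) (K : nat -> R) :
  (forall i, (i < n)%N -> bmul (fun k => (L i k)%:C) (K i)) ->
  bmul (fun k => (\sum_(i < n) L i k)%:C) (\sum_(i < n) K i).
Proof.
by move=> h; apply: bmul_eq (bmul_sum h) _ => k; rewrite rmorph_sum.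
Qed.

Lemma bmul_phi (c : R) J n : 0 <= c -> bmul (fun k => (c * (phi J (n - k))%:R)%:C) (c * J%:R).
Proof.
move=> c0; have := bmulZ c%:C (@bmul_tent R J n); rewrite normc_real ger0_norm// => h.
by apply: bmul_eq h _ => k; rewrite rmorphM rmorph_nat.
Qed.

Lemma bmul_mu1 alpha n : 0 < alpha <= 1 ->
  bmul (fun k => (mu alpha (n - k))%:C) ((alpha^-1 + 1) * mu alpha n).
Proof.
move=> a01; have /andP[a0 a1] := a01; case: n => [|n].
  by rewrite mu0 mulr0; apply: bmul_eq bmul0 _ => k.
have e0 : 0 <= 1 - \sum_(J < n.+1) cc alpha J by rewrite subr_ge0 cc_sum_le1.
apply: (@bmul_le _ _ (\sum_(J < n.+1) cc alpha J * J%:R +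
    (1 - \sum_(J < n.+1) cc alpha J) * n.+1%:R)).
  apply: (@bmul_eq _ (fun k => (\sum_(J < n.+1) cc alpha J * (phi J (n.+1 - k))%:R)%:C +
      ((1 - \sum_(J < n.+1) cc alpha J) * (phi n.+1 (n.+1 - k))%:R)%:C)).
    apply: bmulD; last exact: bmul_phi.
    apply: (@bmul_real_sum _ (fun J k => cc alpha J * (phi J (n.+1 - k))%:R)
                           (fun J => cc alpha J * J%:R)) => J _.
    by apply: bmul_phi; exact: cc_ge0.
  by move=> k; rewrite -rmorphD -mu_tents// leq_subr.
have h1 := cc_moment_le n a01.
have -> : \sum_(J < n.+1) cc alpha J * J%:R = \sum_(J < n.+1) J%:R * cc alpha J.
  by apply: eq_bigr => J _; rewrite mulrC.
rewrite [leRHS]mulrDl mul1r; apply: lerD.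
  rewrite (le_trans h1)// mulrC ler_wpM2l ?invr_ge0 ?(ltW a0)// muS lerDl ltW ?dl_gt0//.
(* At j = n + 1 the last tent takes a value equal to its mass and the other tents are nonnegative,
   so [mu] bounds that mass. This is the summand 1 of the constant; alpha^-1 comes from the first
   moment. *)
rewrite [leRHS](mu_tents _ (leqnn _)) (_ : phi n.+1 n.+1 = n.+1); last by rewrite /phi; lia.
by rewrite lerDr; apply: sumr_ge0 => J _; rewrite mulr_ge0// cc_ge0.
Qed.

Lemma bmul_mu alpha : 0 < alpha ->
  exists2 K : R, 0 <= K & forall n, bmul (fun k => (mu alpha (n - k))%:C) (K * mu alpha n).
Proof.
have H (N : nat) : forall alpha, 0 < alpha <= N.+1%:R ->
  exists2 K : R, 0 <= K & forall n, bmul (fun k => (mu alpha (n - k))%:C) (K * mu alpha n).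
  elim: N => [|N IH] {}alpha a01.
    exists (alpha^-1 + 1); last by move=> n; exact: bmul_mu1.
    by case/andP: a01 => a0 _; rewrite addr_ge0// invr_ge0 ltW.
  have [aN|aN] := lerP alpha N.+1%:R; first by apply: IH; case/andP: a01 => ->.
  have b0 : 0 < alpha - 1 by rewrite subr_gt0 (le_lt_trans _ aN)// ler1n.
  have [|K K0 hK] := IH (alpha - 1).
    by rewrite b0 /= lerBlDr natr1; case/andP: a01.
  exists K => // n.
  (* Summation raises the order by one and advances the index by one. *)
  have E m : mu alpha m = \sum_(i < m) mu (alpha - 1) i.+1.
    by apply: eq_bigr => i _; rewrite mu_dl subrK.
  have E1 : K * mu alpha n = \sum_(i < n.+1) K * mu (alpha - 1) i.
    by rewrite E -mulr_sumr [in RHS]big_ord_recl /= mu0 add0r.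
  rewrite E1; apply: (@bmul_eq _ (fun k => (\sum_(i < n.+1) mu (alpha - 1) (i - k))%:C)).
    exact: (@bmul_real_sum _ (fun i k => mu (alpha - 1) (i - k)) (fun i => K * mu (alpha - 1) i)).
  (* The terms with i <= k vanish, since truncated subtraction leaves [mu] at 0; hence the sum up to
     n collapses to the value at n - k. *)
  move=> k; congr (_%:C); elim: n {E1} => [|n IHn]; first by rewrite big_ord_recr big_ord0 /= sub0n !mu0 addr0.
  rewrite big_ord_recr /= IHn; have [kn|nk] := leqP k n.
    by rewrite subSn// !E big_ord_recr.
  have -> : (n - k = 0)%N by lia.
  have -> : (n.+1 - k = 0)%N by lia.
  by rewrite !mu0 addr0.
move=> a0; apply: (H (Num.bound alpha)); rewrite a0 /=.
by rewrite (le_trans (ltW (archi_boundP (ltW a0))))// ler_nat.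
Qed.

End CesaroMultipliers.

(** * The multiplier of the Cesaro means *)

Section SigmaMultipliers.
Set Implicit Arguments.
Unset Strict Implicit.
Import ComplexField.Normc.
Local Open Scope complex_scope.
Local Open Scope ring_scope.
Context {R : realType}.
Notation C := (Cx R).
Implicit Types a b : nat -> C.

(** A_(n-k)^alpha / A_n^alpha. For k > n truncated subtraction makes it 0, which is the cutoff in
    [sigma]. *)
Definition ces (alpha : R) (n k : nat) : R := mu alpha (n.+1 - k) / mu alpha n.+1.

Lemma gbinomS (x : R) k : k.+1%:R * gbinom x k.+1 = gbinom x k * (x - k%:R).
Proof.
have E (P y c f : R) : c != 0 -> f != 0 -> c * (P * y / (c * f)) = P / f * y.
  by move=> c0 f0; field; rewrite c0 f0.
by rewrite /gbinom big_ord_recr /= factS natrM E// pnatr_eq0 -lt0n fact_gt0.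
Qed.

(** From k to k + 1, binom(n, k) gains (n - k)/(k + 1) and the generalized coefficient gains (n +
    alpha - k)/(k + 1); lowering the index of [dl] from n - k by one supplies exactly the
    quotient. *)
Lemma gbinom_dl (alpha : R) n k : (k <= n)%N ->
  'C(n, k)%:R * dl (alpha + 1) n = gbinom (n%:R + alpha) k * dl (alpha + 1) (n - k).
Proof.
elim: k => [|k IH] kn.
  by rewrite bin0 subn0 /gbinom big_ord0 fact0 divr1.
have k0 : k.+1%:R != 0 :> R by rewrite pnatr_eq0.
have h1 : k.+1%:R * 'C(n, k.+1)%:R = (n - k)%:R * 'C(n, k)%:R :> R.
  by rewrite -!natrM mul_bin_left.
have h2 := gbinomS (n%:R + alpha) k.
have h3 : dl (alpha + 1) (n - k) * (n - k)%:R =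
    dl (alpha + 1) (n - k.+1) * (n%:R + alpha - k%:R).
  have -> : (n - k = (n - k.+1).+1)%N by lia.
  rewrite dlS -mulrA divfK ?pnatr_eq0//; congr (_ * _).
  have -> : n%:R = (n - k.+1)%:R + k%:R + 1 :> R by rewrite -natrD natr1; congr _%:R; lia.
  ring.
apply: (mulfI k0); rewrite [LHS]mulrA h1 [RHS]mulrA h2 -[LHS]mulrA (IH (ltnW kn)).
transitivity (gbinom (n%:R + alpha) k * (dl (alpha + 1) (n - k) * (n - k)%:R)); first by ring.
by rewrite h3; ring.
Qed.

Lemma gbinom_gt0 (alpha : R) n k : 0 < alpha -> (k <= n)%N -> 0 < gbinom (n%:R + alpha) k.
Proof.
move=> a0 kn; rewrite divr_gt0 ?ltr0n ?fact_gt0//; apply: prodr_gt0 => i _.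
rewrite addrAC ltr_wpDl// subr_ge0 ler_nat.
by rewrite (leq_trans _ kn)// ltnW.
Qed.

Lemma sigmaE (alpha : R) n a : 0 < alpha ->
  sigma alpha n a = fun k => (ces alpha n k)%:C * a k.
Proof.
move=> a0; apply/funext => k; rewrite /sigma /ces; case: ifPn => kn; last first.
  by rewrite (_ : (n.+1 - k = 0)%N) ?mu0 ?mul0r//; lia.
congr (_%:C * _); have g0 := gbinom_gt0 a0 kn.
have m0 := mu_gt0 n a0.
apply/eqP; rewrite eqr_div ?(gt_eqF g0) ?(gt_eqF m0)//; apply/eqP.
by rewrite subSn// !mu_dl gbinom_dl// mulrC.
Qed.

Lemma bmul_ces (alpha : R) : 0 < alpha ->
  exists2 K : R, 0 <= K & forall n, bmul (fun k => (ces alpha n k)%:C) K.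
Proof.
move=> a0; have [K K0 hK] := bmul_mu a0; exists K => // n.
have m0 := mu_gt0 n a0.
apply: (@bmul_le _ _ (normc ((mu alpha n.+1)^-1)%:C * (K * mu alpha n.+1))).
  apply: bmul_eq (bmulZ _ (hK n.+1)) _ => k.
  by rewrite /ces -rmorphM; congr (_%:C); rewrite mulrC.
by rewrite normc_real ger0_norm ?invr_ge0 ?(ltW m0)// mulrC mulfK ?gt_eqF.
Qed.

(** Consecutive multipliers have ratio mu(n - k)/mu(n + 1 - k) = 1 - alpha/(n - k + alpha) by
    [dl_mu], which tends to 1 for fixed k. *)
Lemma ces_cvg (alpha : R) k : 0 < alpha -> ces alpha n k @[n --> \oo] --> (1 : R).
Proof.
move=> a0; elim: k => [|k IH].
  by apply: cvg_near_cst; apply: nearW => n; rewrite /ces subn0 divff ?gt_eqF ?mu_gt0.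
have -> : (1 : R) = 1 * (1 - alpha * 0) by rewrite mulr0 subr0 mulr1.
apply: (@cvg_trans _ ((ces alpha n k * (1 - alpha * ((n - k)%:R + alpha)^-1)) @[n --> \oo])).
  apply: near_eq_cvg; exists k.+1 => // n /= kn.
  have e : (n.+1 - k = (n - k).+1)%N by lia.
  have -> : ces alpha n k.+1 = ces alpha n k * (mu alpha (n - k) / mu alpha (n.+1 - k)).
    have E (x y z : R) : y != 0 -> z != 0 -> x / z = y / z * (x / y).
      by move=> y0 z0; field; rewrite y0 z0.
    by rewrite /ces subSS (E _ (mu alpha (n.+1 - k))) ?e ?gt_eqF ?mu_gt0.
  congr (_ * _); rewrite e muS; set m := (n - k)%N.
  have d0 := dl_gt0 m a0; have m0 := mu_gt0 m a0; rewrite muS in m0.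
  have ma : 0 < m%:R + alpha by rewrite ltr_wpDl.
  apply: (mulIf (_ : mu alpha m + dl alpha m != 0)); first by rewrite gt_eqF.
  have ma0 : m%:R + alpha != 0 by rewrite gt_eqF.
  have -> : 1 - alpha * (m%:R + alpha)^-1 = m%:R / (m%:R + alpha) by field.
  rewrite divfK ?gt_eqF//; apply: (mulIf ma0).
  by rewrite [LHS]mulrAC divfK// [LHS]mulrDr dl_mu; ring.
apply: cvgM => //; apply: cvgB; first exact: cvg_cst.
apply: cvgMr.
have H : (m%:R + alpha)^-1 @[m --> \oo] --> (0 : R).
  have P : \forall m \near \oo, 0 < m%:R + alpha by apply: nearW => m; rewrite ltr_wpDl.
  have L : m%:R + alpha @[m --> \oo] --> +oo.
    exact: (cvg_comp _ _ (@cvgr_idn R) (@cvg_addrr R alpha)).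
  apply: cvg_trans ((gtr0_cvgV0 P).2 L); apply: near_eq_cvg; exact: nearW.
rewrite -(cvg_shiftn k (fun n => ((n - k)%:R + alpha)^-1)) /=.
by under eq_fun do rewrite addnK.
Qed.
End SigmaMultipliers.

(** * Pointwise estimates for multipliers *)

Section MultiplierEstimates.
Set Implicit Arguments.
Unset Strict Implicit.
Import ComplexField.Normc.
Local Open Scope complex_scope.
Local Open Scope ring_scope.
Context {R : realType}.
Notation C := (Cx R).
Notation RR := (measurableTypeR R).
Notation leb := (@lebesgue_measure R).
Implicit Types (a b : nat -> C) (z w u : C).

(** The Taylor polynomial of degree below N is exactly the average of rotated Taylor polynomials.
    The error e / (K + 1) is spent at most K times, weighted by the mass, to return to [hol a], and
    once on the tail of the multiplied series. *)
Lemma mult_approx (l : nat -> C) K a r e : bmul l K -> rad1 a -> 0 <= r < 1 -> 0 < e ->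
  exists s : seq (C * C), [/\ forall p, p \in s -> normc p.2 = 1,
      \sum_(p <- s) normc p.1 <= K &
      forall z, normc z <= r -> normc (hol (fun k => l k * a k) z) <=
        e + \sum_(p <- s) normc p.1 * normc (hol a (p.2 * z))].
Proof.
move=> lK ra r01 e0.
have K0 : 0 <= K by rewrite (le_trans _ (bmul_norm 0 lK))// normc_ge0.
have e1 : 0 < e / (K + 1) by rewrite divr_gt0// ltr_wpDl.
have rla : rad1 (fun k => l k * a k) by apply: rad1_mul ra _ => k; exact: bmul_norm lK.
have [N1 h1] := hol_psum rla r01 e1; have [N2 h2] := hol_psum ra r01 e1.
pose N := maxn N1 N2.
have [s [s1 s2 s3]] := lK N; exists s; split => // z zr.
have P : psum (fun k => l k * a k) N z = \sum_(p <- s) p.1 * psum a N (p.2 * z).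
  rewrite /psum; under [RHS]eq_bigr do rewrite mulr_sumr; rewrite exchange_big /=.
  apply: eq_bigr => k _; rewrite s3// !mulr_suml; apply: eq_bigr => p _.
  by rewrite exprMn; ring.
have H1 : normc (psum (fun k => l k * a k) N z) <=
    \sum_(p <- s) normc p.1 * (normc (hol a (p.2 * z)) + e / (K + 1)).
  rewrite P (le_trans (normc_sum _ _ _))// big_seq [leRHS]big_seq; apply: ler_sum => p ps.
  rewrite normcM ler_wpM2l ?normc_ge0//.
  have nz : normc (p.2 * z) <= r by rewrite normcM s1// mul1r.
  have -> : psum a N (p.2 * z) = hol a (p.2 * z) - (hol a (p.2 * z) - psum a N (p.2 * z)).
    by rewrite opprB addrC subrK.
  by rewrite (le_trans (le_normcD _ _))// normcN lerD2l ltW// h2// leq_maxr.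
have -> : hol (fun k => l k * a k) z = psum (fun k => l k * a k) N z +
    (hol (fun k => l k * a k) z - psum (fun k => l k * a k) N z) by rewrite addrC subrK.
rewrite (le_trans (le_normcD _ _))//.
apply: le_trans (lerD H1 (ltW (h1 N z (leq_maxl _ _) zr))) _.
under eq_bigr do rewrite mulrDr.
rewrite big_split /= -addrA addrC lerD2r -mulr_suml.
apply: (@le_trans _ _ (K * (e / (K + 1)) + e / (K + 1))).
  by rewrite lerD2r ler_wpM2r// ltW.
have K1 : K + 1 != 0 by rewrite gt_eqF// ltr_wpDl.
by apply: eq_lerR; field.
Qed.

Lemma mult_sup (l : nat -> C) K a z S : bmul l K -> rad1 a -> normc z < 1 ->
  (forall w, normc w = normc z -> normc (hol a w) <= S) ->
  normc (hol (fun k => l k * a k) z) <= K * S.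
Proof.
move=> lK ra z1 hS; apply/ler_addgt0Pl => e e0.
have S0 : 0 <= S by rewrite (le_trans (normc_ge0 _) (hS z _)).
have [|s [s1 s2 s3]] := mult_approx (r := normc z) lK ra _ e0.
  by rewrite normc_ge0.
apply: le_trans (s3 z (lexx _)) _; rewrite lerD2l.
apply: (@le_trans _ _ ((\sum_(p <- s) normc p.1) * S)); last by rewrite ler_wpM2r.
rewrite mulr_suml big_seq [leRHS]big_seq; apply: ler_sum => p ps.
by rewrite ler_wpM2l ?normc_ge0// hS// normcM s1// mul1r.
Qed.

(** The tail past N is small uniformly in t because the multipliers are bounded by K; the finitely
    many coefficients before N tend to 0 along F. *)
Lemma mult_unif {T} (F : set_system T) {FF : ProperFilter F} (L : T -> nat -> C) K a r e :
  (forall k, L t k @[t --> F] --> (0 : C)) -> (\forall t \near F, forall k, normc (L t k) <= K) ->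
  rad1 a -> 0 <= r < 1 -> 0 < e ->
  \forall t \near F, forall z, normc z <= r -> normc (hol (fun k => L t k * a k) z) <= e.
Proof.
move=> L0 LK ra r01 e0; have [M [q [M0 q01 h]]] := rad1_geo ra r01.
have K0 : 0 <= K.
  by have [t ht] := filter_ex LK; rewrite (le_trans _ (ht 0%N))// normc_ge0.
have e2 : 0 < e / 2 by rewrite divr_gt0.
have [N hN] := geo_to0 (mulr_ge0 K0 M0) q01 e2.
have /andP[q0 q1] := q01.
have Fin : \forall t \near F, \sum_(k < N) normc (L t k) * M <= e / 2.
  have d0 : 0 < e / 2 / (N.+1%:R * (M + 1)) by rewrite divr_gt0// mulr_gt0// ltr_wpDl.
  have : \forall t \near F, forall k : 'I_N, normc (L t k) <= e / 2 / (N.+1%:R * (M + 1)).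
    apply: filter_forall => k; have /cvgcP /(_ _ d0) := L0 k.
    by apply: filterS => t; rewrite subr0; exact: ltW.
  apply: filterS => t ht.
  apply: (@le_trans _ _ (\sum_(k < N) (e / 2 / (N.+1%:R * (M + 1))) * M)).
    by apply: ler_sum => k _; rewrite ler_wpM2r.
  rewrite sumr_const card_ord -[leLHS]mulr_natl.
  have M1 : 0 < M + 1 by rewrite ltr_wpDl.
  have -> : N%:R * (e / 2 / (N.+1%:R * (M + 1)) * M) = (e / 2) * (N%:R / N.+1%:R * (M / (M + 1))).
    by rewrite invfM; ring.
  rewrite ler_piMr ?(ltW e2)// mulr_ile1 ?divr_ge0 ?(ltW M1)//.
    by rewrite ler_pdivrMr// mul1r ler_nat.
  by rewrite ler_pdivrMr// mul1r lerDl.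
near=> t => z zr.
have Lt : forall k, normc (L t k) <= K by near: t.
have z1 : normc z < 1 by case/andP: r01 => _; exact: le_lt_trans.
have rl : rad1 (fun k => L t k * a k) by exact: rad1_mul ra Lt.
rewrite -[X in normc X]subr0; apply: (@cvgc_le _ _ \oo _ (fun m => psum (fun k => L t k * a k) m z)).
  exact: hol_cvg.
apply: nearW => m; rewrite subr0.
have Tk k : normc (L t k * a k * z ^+ k) <= normc (L t k) * (M * q ^+ k).
  rewrite !normcM -mulrA ler_wpM2l ?normc_ge0//; apply: le_trans (h k).
  by rewrite normcX ler_wpM2l ?normc_ge0// lerXn2r ?nnegrE ?normc_ge0// (le_trans _ zr) ?normc_ge0.
rewrite /psum (le_trans (normc_sum _ _ _))//.
apply: (@le_trans _ _ (\sum_(k < m) normc (L t k) * (M * q ^+ k))); first by apply: ler_sum => k _.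
apply: (@le_trans _ _ (\sum_(k < N + m) normc (L t k) * (M * q ^+ k))).
  rewrite addnC big_split_ord /= lerDl; apply: sumr_ge0 => k _.
  by rewrite mulr_ge0 ?normc_ge0// mulr_ge0// exprn_ge0.
rewrite big_split_ord /= [leRHS]splitr; apply: lerD.
  apply: (@le_trans _ _ (\sum_(k < N) normc (L t k) * M)); last by near: t.
  by apply: ler_sum => k _; rewrite ler_wpM2l ?normc_ge0// ler_piMr// exprn_ile1// ltW.
apply: le_trans (ltW (hN N (leqnn N))).
apply: (@le_trans _ _ (\sum_(k < m) K * M * q ^+ (N + k))).
  apply: ler_sum => k _; rewrite -mulrA ler_wpM2r// mulr_ge0// exprn_ge0//.
rewrite -mulr_sumr ler_wpM2l ?mulr_ge0//.
have := @sum_geo_le R q N (N + m) q01 (leq_addr _ _).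
rewrite (_ : \sum_(N <= k < N + m) q ^+ k = \sum_(i < m) q ^+ (N + i))//.
rewrite -{1}[N]addn0 addnC [(N + m)%N]addnC big_addn addnK big_mkord.
by apply: eq_bigr => i _; rewrite addnC.
Unshelve. all: by end_near. Qed.
End MultiplierEstimates.

(** * Integrals over disks and annuli *)

Section ComplexMeasurability.
Set Implicit Arguments.
Unset Strict Implicit.
Import ComplexField.Normc.
Local Open Scope complex_scope.
Local Open Scope ring_scope.
Context {R : realType}.
Notation C := (Cx R).
Notation RR := (measurableTypeR R).
Notation leb := (@lebesgue_measure R).
Notation R2 := (RR * RR)%type.
Implicit Types (a b : nat -> C) (z w u : C) (F G : R2 -> C) (D A : set R2).

Definition cmeas D F : Prop :=
  @measurable_fun _ _ R2 R D (fun p => complex.Re (F p)) /\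
  @measurable_fun _ _ R2 R D (fun p => complex.Im (F p)).

Lemma cmeas_cst D (c : C) : cmeas D (fun=> c).
Proof. by split; exact: measurable_cst. Qed.

Lemma cmeasD D F G : cmeas D F -> cmeas D G -> cmeas D (fun p => F p + G p).
Proof.
move=> [F1 F2] [G1 G2]; split.
  rewrite (_ : (fun p => _) = fun p => complex.Re (F p) + complex.Re (G p)).
    exact: measurable_funD.
  by apply/funext => p; rewrite raddfD.
rewrite (_ : (fun p => _) = fun p => complex.Im (F p) + complex.Im (G p)).
  exact: measurable_funD.
by apply/funext => p; rewrite raddfD.
Qed.

Lemma cmeasM D F G : cmeas D F -> cmeas D G -> cmeas D (fun p => F p * G p).
Proof.
move=> [F1 F2] [G1 G2]; split.
  rewrite (_ : (fun p => _) = fun p => complex.Re (F p) * complex.Re (G p) - complex.Im (F p) * complex.Im (G p)).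
    by apply: measurable_funB; exact: measurable_funM.
  by apply/funext => p; case: (F p) => x y; case: (G p).
rewrite (_ : (fun p => _) = fun p => complex.Re (F p) * complex.Im (G p) + complex.Im (F p) * complex.Re (G p)).
  by apply: measurable_funD; exact: measurable_funM.
by apply/funext => p; case: (F p) => x y; case: (G p).
Qed.

Lemma cmeasX D F n : cmeas D F -> cmeas D (fun p => F p ^+ n).
Proof.
move=> mF; elim: n => [|n IH]; first exact: cmeas_cst.
by under eq_fun do rewrite exprS; exact: cmeasM.
Qed.

Lemma cmeas_sum D n (F : nat -> R2 -> C) : (forall i, cmeas D (F i)) ->
  cmeas D (fun p => \sum_(i < n) F i p).
Proof.
move=> mF; elim: n => [|n IH].
  by under eq_fun do rewrite big_ord0; exact: cmeas_cst.
by under eq_fun do rewrite big_ord_recr /=; exact: cmeasD.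
Qed.

Lemma cmeas_cpt D : cmeas D (@cpt R).
Proof.
split; apply: measurable_funTS; [exact: measurable_fst|exact: measurable_snd].
Qed.

Lemma cmeas_conj D F : cmeas D F -> cmeas D (fun p => conjc (F p)).
Proof.
move=> [F1 F2]; split.
  rewrite (_ : (fun p => _) = fun p => complex.Re (F p))//.
  by apply/funext => p; case: (F p).
rewrite (_ : (fun p => _) = fun p => 0 - complex.Im (F p)).
  by apply: measurable_funB => //; exact: measurable_cst.
by apply/funext => p; rewrite sub0r; case: (F p).
Qed.

Lemma cvgc_Re {T} (Fi : set_system T) {FF : Filter Fi} (f : T -> C) (l : C) :
  f x @[x --> Fi] --> l -> complex.Re (f x) @[x --> Fi] --> complex.Re l.
Proof.
move=> /cvgcP h; apply/cvgrPdist_lt => e /h; apply: filterS => x; apply: le_lt_trans.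
by rewrite distrC -raddfB normc_Re.
Qed.

Lemma cvgc_Im {T} (Fi : set_system T) {FF : Filter Fi} (f : T -> C) (l : C) :
  f x @[x --> Fi] --> l -> complex.Im (f x) @[x --> Fi] --> complex.Im l.
Proof.
move=> /cvgcP h; apply/cvgrPdist_lt => e /h; apply: filterS => x; apply: le_lt_trans.
by rewrite distrC -raddfB normc_Im.
Qed.

Lemma cmeas_lim D (f : nat -> R2 -> C) F : (forall n, cmeas D (f n)) ->
  (forall p, D p -> f n p @[n --> \oo] --> F p) -> cmeas D F.
Proof.
move=> mf h; split.
  apply: (@measurable_fun_cvg _ R2 R D (fun n p => complex.Re (f n p))) => [n|p /h].
    by have [] := mf n.
  exact: cvgc_Re.
apply: (@measurable_fun_cvg _ R2 R D (fun n p => complex.Im (f n p))) => [n|p /h].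
  by have [] := mf n.
exact: cvgc_Im.
Qed.

Lemma cmeas_normc D F : cmeas D F -> @measurable_fun _ _ R2 R D (fun p => normc (F p)).
Proof.
move=> [F1 F2].
have m : measurable_fun setT (@Num.sqrt R).
  by apply: continuous_measurable_fun; exact: sqrt_continuous.
have := measurableT_comp m (measurable_funD (measurable_funM F1 F1) (measurable_funM F2 F2)).
rewrite (_ : _ \o _ = fun p => normc (F p))//.
by apply/funext => p /=; case: (F p) => x y /=; rewrite -!expr2.
Qed.

Lemma diskE (s : R) (p : R * R) : 0 <= s -> disk s p <-> normc (cpt p) < s.
Proof.
move=> s0; rewrite /disk /= -{1}[_ + _]sqr_sqrtr ?addr_ge0 ?sqr_ge0//.
by rewrite ltr_sqr ?nnegrE// sqrtr_ge0.
Qed.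

Lemma measurable_disk (s : R) : @measurable _ R2 (disk s).
Proof.
have h : @measurable_fun _ _ R2 R setT (fun p => p.1 ^+ 2 + p.2 ^+ 2).
  by apply: measurable_funD; apply: measurable_funX; [exact: measurable_fst|exact: measurable_snd].
have := h measurableT _ (measurable_itv `]-oo, s ^+ 2[).
rewrite setTI (_ : _ @^-1` _ = disk s)//.
Qed.

Lemma cmeas_hol_comp a D F : rad1 a -> cmeas D F -> (forall p, D p -> normc (F p) < 1) ->
  cmeas D (fun p => hol a (F p)).
Proof.
move=> ra mF F1; apply: (@cmeas_lim _ (fun n p => psum a n (F p))) => [n|p Dp].
  apply: (@cmeas_sum _ n (fun k p => a k * F p ^+ k)) => k; apply: cmeasM; first exact: cmeas_cst.
  exact: cmeasX.
exact: hol_cvg ra (F1 _ Dp).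
Qed.

Lemma cmeas_hol a D : rad1 a -> D `<=` disk 1 -> cmeas D (fun p => hol a (cpt p)).
Proof.
move=> ra D1; apply: cmeas_hol_comp => //; first exact: cmeas_cpt.
by move=> p /D1 /(diskE p ler01).
Qed.

Definition ann (s r : R) : set R2 := disk r `\` disk s.

Lemma measurable_ann s r : @measurable _ R2 (ann s r).
Proof. by apply: measurableD; exact: measurable_disk. Qed.

Lemma annE (s r : R) (p : R * R) : 0 <= s -> 0 <= r -> ann s r p <-> s <= normc (cpt p) < r.
Proof.
move=> s0 r0; rewrite /ann /= /setD /=; split.
  by move=> [/(diskE p r0) ->] /(diskE p s0)/negP; rewrite -leNgt andbT.
move=> /andP[h1 h2]; split; first by apply/(diskE p r0).
by move/(diskE p s0); apply/negP; rewrite -leNgt.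
Qed.

Lemma area_disk_fin : (@area R (disk 1) < +oo)%E.
Proof.
have m : @measurable _ RR `[-1, 1] by exact: measurable_itv.
apply: (@le_lt_trans _ _ (@area R (`[-1, 1] `*` `[-1, 1])%classic)).
  apply: le_measure; rewrite ?inE; [exact: measurable_disk|exact: measurableX|].
  move=> [x y] /=; rewrite /disk /= expr1n !in_itv /= => h.
  by split; apply/andP; split; nra.
have Lf : (leb `[(-1)%R, 1%R]%classic < +oo)%E.
  by rewrite lebesgue_measure_itv /= lte_fin -EFinB; case: ifP => _; rewrite ltry.
rewrite /area [ltLHS](@product_measure1E _ _ RR RR R leb leb _ _ m m).
by rewrite lte_mul_pinfty// ge0_fin_numE.
Qed.
End ComplexMeasurability.

(** * Multipliers and integrals over annuli *)

Section AnnulusIntegrals.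
Set Implicit Arguments.
Unset Strict Implicit.
Import ComplexField.Normc.
Local Open Scope complex_scope.
Local Open Scope ring_scope.
Context {R : realType}.
Notation C := (Cx R).
Notation RR := (measurableTypeR R).
Notation leb := (@lebesgue_measure R).
Notation R2 := (RR * RR)%type.
Implicit Types (a b : nat -> C) (z w u : C) (F G : R2 -> C) (D A : set R2).

Definition integ A (f : R2 -> R) : \bar R := (\int[@area R]_(p in A) (f p)%:E)%E.
Notation normI A F := (integ A (fun p => normc (F p))).
Notation mfun A f := (@measurable_fun _ _ R2 R A f).
Implicit Types f g : R2 -> R.

Lemma integ_ge0 A f : (forall p, A p -> 0 <= f p) -> (0 <= integ A f)%E.
Proof. by move=> f0; apply: integral_ge0 => p Ap; rewrite lee_fin f0. Qed.

Lemma integ_le A f g : measurable A -> mfun A f -> mfun A g ->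
  (forall p, A p -> 0 <= f p) -> (forall p, A p -> f p <= g p) ->
  (integ A f <= integ A g)%E.
Proof.
move=> mA mf mg f0 fg; apply: (ge0_le_integral _ mA).
- by move=> p Ap; rewrite lee_fin f0.
- exact/measurable_EFinP.
- exact/measurable_EFinP.
- by move=> p Ap; rewrite lee_fin fg.
Qed.

Lemma integD A f g : measurable A -> mfun A f -> mfun A g ->
  (forall p, A p -> 0 <= f p) -> (forall p, A p -> 0 <= g p) ->
  (integ A (fun p => f p + g p)%R = integ A f + integ A g)%E.
Proof.
move=> mA mf mg f0 g0; rewrite /integ; under eq_integral do rewrite EFinD.
apply: (ge0_integralD _ mA).
- by move=> p Ap; rewrite lee_fin f0.
- exact/measurable_EFinP.
- by move=> p Ap; rewrite lee_fin g0.
- exact/measurable_EFinP.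
Qed.

Lemma integZ A f (k : R) : measurable A -> mfun A f ->
  (forall p, A p -> 0 <= f p) -> 0 <= k ->
  (integ A (fun p => k * f p)%R = k%:E * integ A f)%E.
Proof.
move=> mA mf f0 k0; rewrite /integ; under eq_integral do rewrite EFinM.
apply: (ge0_integralZl_EFin _ mA) => //.
- exact/measurable_EFinP.
Qed.

Lemma integ_cst A (k : R) : measurable A -> (integ A (fun=> k) = k%:E * @area R A)%E.
Proof. by move=> mA; rewrite /integ (integral_cst _ mA k%:E). Qed.

Lemma integ_eq A f g : (forall p, A p -> f p = g p) -> integ A f = integ A g.
Proof. by move=> fg; apply: eq_integral => p /[!inE] Ap; rewrite fg. Qed.

Lemma integ_setU A D f : measurable A -> measurable D -> mfun (A `|` D) f ->
  (forall p, (A `|` D) p -> 0 <= f p) -> A `&` D = set0 ->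
  (integ (A `|` D) f = integ A f + integ D f)%E.
Proof.
move=> mA mD mf f0 AD; apply: (ge0_integral_setU _ mA mD).
- exact/measurable_EFinP.
- by move=> p Ap; rewrite lee_fin f0.
- by rewrite disj_set2E AD.
Qed.

Lemma cpt_rot (u : C) (p : R * R) : cpt (rot (complex.Re u) (complex.Im u) p) = u * cpt p.
Proof.
case: u => x y; apply/eqP; rewrite eq_complex /=.
by rewrite [y * _ + _]addrC !eqxx.
Qed.

Lemma unit_sq (u : C) : normc u = 1 -> complex.Re u ^+ 2 + complex.Im u ^+ 2 = 1.
Proof.
case: u => x y /= /(congr1 (fun t => t ^+ 2)).
by rewrite sqr_sqrtr ?addr_ge0 ?sqr_ge0// expr1n.
Qed.

Lemma integ_rot A f u : measurable A -> mfun A f ->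
  normc u = 1 -> (forall p, A (rot (complex.Re u) (complex.Im u) p) <-> A p) ->
  integ A (fun p => f (rot (complex.Re u) (complex.Im u) p)) = integ A f.
Proof.
move=> mA mf u1 hA; rewrite /integ integral_mkcond [RHS]integral_mkcond.
have m : @measurable_fun _ _ R2 _ setT ((fun p => (f p)%:E) \_ A).
  by apply/(measurable_restrictT _ mA)/measurable_EFinP.
rewrite -(integral_area_rot (unit_sq u1) m).
apply: eq_integral => p _; rewrite /patch /=.
have E : (rot (complex.Re u) (complex.Im u) p \in A) = (p \in A).
  by apply/idP/idP; rewrite !inE => /hA.
by rewrite E.
Qed.

Lemma ann_rot s r u p : 0 <= s -> 0 <= r -> normc u = 1 ->
  ann s r (rot (complex.Re u) (complex.Im u) p) <-> ann s r p.
Proof. by move=> s0 r0 u1; rewrite !annE// cpt_rot normcM u1 mul1r. Qed.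

Lemma ann_sub s r : 0 <= s -> 0 <= r <= 1 -> ann s r `<=` (@disk R 1).
Proof.
move=> s0 /andP[r0 r1] p /annE -/(_ s0 r0) /andP[_ h].
by apply/(diskE p ler01); exact: lt_le_trans r1.
Qed.

Lemma measurable_normc_hol a s r : rad1 a -> 0 <= s -> 0 <= r <= 1 ->
  mfun (ann s r) (fun p => normc (hol a (cpt p))).
Proof.
move=> ra s0 r01; apply: cmeas_normc; apply: cmeas_hol => //.
exact: ann_sub.
Qed.

Lemma area_ann_fin s r : 0 <= s -> 0 <= r <= 1 -> (@area R (ann s r) < +oo)%E.
Proof.
move=> s0 r01; apply: le_lt_trans area_disk_fin.
by apply: le_measure; rewrite ?inE; [exact: measurable_ann|exact: measurable_disk|exact: ann_sub].
Qed.

(** Every summand is a rotated copy of one function on a rotation invariant set. Measurability is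
    carried through the induction because additivity of the integral asks for it. *)
Lemma int_rot_sum a s r (t : seq (C * C)) : rad1 a -> 0 <= s -> 0 <= r <= 1 ->
  (forall p, p \in t -> normc p.2 = 1) ->
  mfun (ann s r) (fun p => \sum_(q <- t) normc q.1 * normc (hol a (q.2 * cpt p))) /\
  (integ (ann s r) (fun p => \sum_(q <- t) normc q.1 * normc (hol a (q.2 * cpt p)))%R =
  (\sum_(q <- t) normc q.1)%R%:E * normI (ann s r) (fun p => hol a (cpt p)))%E.
Proof.
move=> ra s0 r01; have /andP[r0 r1] := r01.
have mA := measurable_ann s r.
elim: t => [|[w u] t IH] ht.
  split; first by under eq_fun do rewrite big_nil; exact: measurable_cst.
  rewrite big_nil mul0e (integ_eq (g := fun=> 0)) => [|p _]; last by rewrite big_nil.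
  by rewrite integ_cst// mul0e.
have [|mt it] := IH _; first by move=> p pt; apply: ht; rewrite inE pt orbT.
have u1 : normc u = 1 by apply: (ht (w, u)); rewrite inE eqxx.
have m1 : mfun (ann s r) (fun p => normc (hol a (u * cpt p))).
  apply: cmeas_normc; apply: cmeas_hol_comp => //.
    by apply: cmeasM; [exact: cmeas_cst|exact: cmeas_cpt].
  move=> p /(annE p s0 r0) /andP[_ pr]; rewrite normcM u1 mul1r.
  exact: lt_le_trans r1.
have m2 : mfun (ann s r) (fun p => normc w * normc (hol a (u * cpt p))).
  by apply: measurable_funM => //; exact: measurable_cst.
have E : (fun p => \sum_(q <- (w, u) :: t) normc q.1 * normc (hol a (q.2 * cpt p))) =
  fun p => normc w * normc (hol a (u * cpt p)) +
    \sum_(q <- t) normc q.1 * normc (hol a (q.2 * cpt p)).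
  by apply/funext => p; rewrite big_cons.
rewrite E; split; first exact: measurable_funD.
rewrite integD//; last 2 first.
- by move=> p _; rewrite mulr_ge0 ?normc_ge0.
- by move=> p _; rewrite sumr_ge0// => q _; rewrite mulr_ge0 ?normc_ge0.
have S0 : 0 <= \sum_(q <- t) normc q.1 by apply: sumr_ge0 => q _; exact: normc_ge0.
rewrite it big_cons /= EFinD ge0_muleDl ?lee_fin ?normc_ge0//.
congr (_ + _)%E.
rewrite (@integZ (ann s r) (fun p => normc (hol a (u * cpt p))) (normc w) mA m1
  (fun p _ => normc_ge0 _) (normc_ge0 _)).
apply: (congr1 (fun x => (normc w)%:E * x)%E).
apply: (etrans _ (integ_rot mA (measurable_normc_hol ra s0 r01) u1 (fun p => ann_rot p s0 r0 u1))).
by apply: integ_eq => p _; apply: (congr1 (fun v => normc (hol a v))); rewrite cpt_rot.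
Qed.

(** [mult_approx] is uniform only on disks of radius below 1, hence r < 1 here; the error e is
    spread over the finite area of the annulus. *)
Lemma mult_int_lt (l : nat -> C) K a s r : bmul l K -> rad1 a -> 0 <= s -> 0 <= r < 1 ->
  (normI (ann s r) (fun p => hol (fun k => l k * a k)%R (cpt p)) <=
   K%:E * normI (ann s r) (fun p => hol a (cpt p)))%E.
Proof.
move=> lK ra s0 r01; have /andP[r0 r1] := r01.
have r01' : 0 <= r <= 1 by rewrite r0 ltW.
have K0 : 0 <= K by rewrite (le_trans _ (bmul_norm 0 lK))// normc_ge0.
have mA := measurable_ann s r.
have I0 : (0 <= normI (ann s r) (fun p => hol a (cpt p)))%E.
  by apply: integ_ge0 => p _; exact: normc_ge0.
have rla : rad1 (fun k => l k * a k) by apply: rad1_mul ra _ => k; exact: bmul_norm lK.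
have aA := area_ann_fin s0 r01'.
have aA0 : (0 <= @area R (ann s r))%E by exact: measure_ge0.
apply/lee_addgt0Pr => e e0.
pose d := e / (fine (@area R (ann s r)) + 1).
have fA0 : 0 <= fine (@area R (ann s r)) by exact: fine_ge0.
have A1 : 0 < fine (@area R (ann s r)) + 1 by rewrite ltr_wpDl.
have d0 : 0 < d by rewrite divr_gt0.
have [t [t1 t2 t3]] := mult_approx lK ra r01 d0.
have [mt it] := int_rot_sum ra s0 r01' t1.
have S0 p : 0 <= \sum_(q <- t) normc q.1 * normc (hol a (q.2 * cpt p)).
  by apply: sumr_ge0 => q _; rewrite mulr_ge0 ?normc_ge0.
apply: (@le_trans _ _ (integ (ann s r) (fun p =>
    d + \sum_(q <- t) normc q.1 * normc (hol a (q.2 * cpt p))))).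
  apply: integ_le => //.
  - exact: measurable_normc_hol.
  - by apply: measurable_funD => //; exact: measurable_cst.
  - by move=> p _; exact: normc_ge0.
  - by move=> p /(annE p s0 r0) /andP[_ pr]; apply: t3; exact: ltW.
rewrite (@integD _ (fun=> d) _ mA (measurable_cst _) mt (fun _ _ => ltW d0) (fun p _ => S0 p)).
rewrite it integ_cst// addeC leeD//.
  by rewrite lee_wpmul2r// lee_fin.
rewrite -[X in (_ * X)%E]fineK ?ge0_fin_numE// -EFinM lee_fin /d mulrAC ler_pdivrMr//.
by rewrite ler_wpM2l ?(ltW e0)// lerDl.
Qed.

(** Monotone convergence along the outer radii 1 - 1/(n + 1), which exhaust the annulus. *)
Lemma ann_lim_le s f (x : \bar R) : 0 <= s -> mfun (ann s 1) f ->
  (forall p, ann s 1 p -> 0 <= f p) ->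
  (forall r, 0 <= r < 1 -> (integ (ann s r) f <= x)%E) -> (integ (ann s 1) f <= x)%E.
Proof.
move=> s0 mf f0 h; pose r (n : nat) : R := 1 - n.+1%:R^-1.
have r01 n : 0 <= r n < 1.
  by rewrite /r subr_ge0 invf_le1// ler1n ltrBlDr ltrDl invr_gt0 ltr0n.
have sub n : ann s (r n) `<=` ann s 1.
  have /andP[a b] := r01 n.
  by move=> p /(annE p s0 a) /andP[h1 h2]; apply/(annE p s0 ler01); rewrite h1 (lt_trans h2).
have H := @ge0_nondecreasing_set_cvg_integral _ R2 R (fun n => ann s (r n)) (fun p => (f p)%:E) (@area R).
have U : \bigcup_n ann s (r n) = ann s 1.
  apply/seteqP; split => [p [n _ /sub]//|p /(annE p s0 ler01)/andP[h1 h2]].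
  have [N hN] : exists N : nat, (1 - normc (cpt p))^-1 < N.+1%:R.
    exists (Num.bound (1 - normc (cpt p))^-1); apply: (lt_le_trans (archi_boundP _)).
      by rewrite invr_ge0 subr_ge0 ltW.
    by rewrite ler_nat.
  exists N => //; have /andP[a _] := r01 N; apply/(annE p s0 a); rewrite h1 /= /r.
  by rewrite ltrBrDl -ltrBrDr invf_plt ?posrE ?subr_gt0.
have {}H : integ (ann s (r n)) f @[n --> \oo] --> integ (ann s 1) f.
  rewrite -U; apply: H => [m n mn|n|n|n p /sub /f0]; rewrite ?lee_fin//.
  - apply/subsetPset => p; have /andP[a b] := r01 m; have /andP[c d] := r01 n.
    move=> /(annE p s0 a) /andP[h1 h2]; apply/(annE p s0 c); rewrite h1 (lt_le_trans h2)//.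
    by rewrite /r lerD2l lerN2 lef_pV2 ?posrE ?ltr0n// ler_nat.
  - exact: measurable_ann.
  - by apply/measurable_EFinP; apply: measurable_funS mf => //; exact: measurable_ann.
rewrite -(cvg_lim (@ereal_hausdorff _) H); apply: lime_le; first by apply/cvg_ex; eexists; exact: H.
by apply: nearW => n; exact: h.
Qed.

Lemma integ_subset A D f : measurable A -> measurable D -> A `<=` D -> mfun D f ->
  (forall p, D p -> 0 <= f p) -> (integ A f <= integ D f)%E.
Proof.
move=> mA mD AD mf f0; apply: ge0_subset_integral => //; first exact/measurable_EFinP.
Qed.

Lemma mult_int (l : nat -> C) K a s : bmul l K -> rad1 a -> 0 <= s ->
  (normI (ann s 1) (fun p => hol (fun k => l k * a k)%R (cpt p)) <=
   K%:E * normI (ann s 1) (fun p => hol a (cpt p)))%E.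
Proof.
move=> lK ra s0; have le11 : ((0 : R) <= 1) && ((1 : R) <= 1) by rewrite ler01 le_refl.
have K0 : 0 <= K by rewrite (le_trans _ (bmul_norm 0 lK))// normc_ge0.
have rla : rad1 (fun k => l k * a k) by apply: rad1_mul ra _ => k; exact: bmul_norm lK.
apply: ann_lim_le => //; first exact: measurable_normc_hol.
  by move=> p _; exact: normc_ge0.
move=> r r01; apply: le_trans (mult_int_lt lK ra s0 r01) _.
rewrite lee_wpmul2l ?lee_fin//; apply: integ_subset.
- exact: measurable_ann.
- exact: measurable_ann.
- have /andP[r0 r1] := r01.
  move=> p /(annE p s0 r0)/andP[h1 h2]; apply/(annE p s0 ler01).
  by rewrite h1 (lt_trans h2).
- exact: measurable_normc_hol.
- by move=> p _; exact: normc_ge0.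
Qed.

Lemma disk_split s : 0 <= s < 1 -> disk 1 = disk s `|` ann s 1 :> set R2 /\ disk s `&` ann s 1 = set0 :> set R2.
Proof.
move=> /andP[s0 s1]; split; apply/seteqP; split => p /=.
- by move=> h; have [hs|hs] := pselect (disk s p); [left|right].
- move=> [/(diskE p s0) h|[]//]; apply/(diskE p ler01); exact: lt_trans s1.
- by move=> [h [_]].
- by [].
Qed.

Lemma integ_disk_split f s : 0 <= s < 1 -> mfun (disk 1) f -> (forall p, disk 1 p -> 0 <= f p) ->
  (integ (disk 1) f = integ (disk s) f + integ (ann s 1) f)%E.
Proof.
move=> s01 mf f0; have [U I] := disk_split s01; rewrite U; apply: integ_setU => //.
- exact: measurable_disk.
- exact: measurable_ann.
- by rewrite -U.
- by rewrite -U.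
Qed.

Lemma disk0 : disk 0 = set0 :> set R2.
Proof.
apply/seteqP; split => // p; rewrite /disk /= expr0n /= => h.
by have := addr_ge0 (sqr_ge0 p.1) (sqr_ge0 p.2); rewrite leNgt h.
Qed.

(** If no annulus worked, every inner disk would carry at most the full integral minus e, and by
    exhaustion so would the unit disk, which is absurd for a finite integral. *)
Lemma ann_tail f e : mfun (disk 1) f -> (forall p, disk 1 p -> 0 <= f p) ->
  (integ (disk 1) f < +oo)%E -> 0 < e ->
  exists s, 0 <= s < 1 /\ (integ (ann s 1) f <= e%:E)%E.
Proof.
move=> mf f0 fin e0; apply: contrapT => hN.
have A01 : ann 0 1 = disk 1 :> set R2 by rewrite /ann disk0 setD0.
have I0 : (0 <= integ (disk 1) f)%E by exact: integ_ge0.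
have : (integ (disk 1) f <= (fine (integ (disk 1) f) - e)%:E)%E.
  rewrite -{1}A01; apply: ann_lim_le; rewrite ?A01// => r r01.
  rewrite /ann disk0 setD0 EFinB fineK ?ge0_fin_numE//.
  rewrite leeBrDr//; apply: contrapT => /negP; rewrite -ltNge.
  rewrite (integ_disk_split r01 mf f0) => h.
  apply: hN; exists r; split => //; rewrite ltW//.
  have d1 : disk r `<=` (@disk R 1).
    by have [-> _] := disk_split r01; left.
  have fr : integ (disk r) f \is a fin_num.
    rewrite ge0_fin_numE; last by apply: integ_ge0 => p /d1 /f0.
    by apply: le_lt_trans fin; apply: integ_subset => //; exact: measurable_disk.
  by rewrite lteD2lE in h.
rewrite -{1}[integ _ _]fineK ?ge0_fin_numE// lee_fin lerBrDr gerDl.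
by rewrite leNgt e0.
Qed.

End AnnulusIntegrals.

(** * Norm convergence in the Bergman and little Bloch spaces *)

Section NormConvergence.
Set Implicit Arguments.
Unset Strict Implicit.
Import ComplexField.Normc.
Local Open Scope complex_scope.
Local Open Scope ring_scope.
Context {R : realType}.
Notation C := (Cx R).
Notation RR := (measurableTypeR R).
Notation R2 := (RR * RR)%type.
Notation normI A F := (integ A (fun p => normc (F p))).
Notation mfun A f := (@measurable_fun _ _ R2 R A f).
Implicit Types (a b f g h : nat -> C) (z w u : C).

Lemma cvge0_le {T} (F : set_system T) {FF : Filter F} (u : T -> \bar R) :
  (forall x, (0 <= u x)%E) ->
  (forall e : R, 0 < e -> \forall x \near F, (u x <= e%:E)%E) -> u x @[x --> F] --> 0%E.
Proof.
move=> u0 h; apply/fine_cvgP; split.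
  apply: filterS (h 1 ltr01) => x ux.
  by rewrite ge0_fin_numE// (le_lt_trans ux)// ltry.
apply/cvgrPdist_lt => e e0; have e2 : 0 < e / 2 by rewrite divr_gt0.
apply: filterS (h _ e2) => x ux /=.
rewrite sub0r normrN ger0_norm ?fine_ge0//.
have ufin : u x \is a fin_num by rewrite ge0_fin_numE// (le_lt_trans ux)// ltry.
move: ux; rewrite -{1}(fineK ufin) lee_fin => ux.
by rewrite (le_lt_trans ux)// ltr_pdivrMr// ltr_pMr// ltr1n.
Qed.

Lemma ces_sub1_cvg (alpha : R) k : 0 < alpha ->
  (ces alpha n k)%:C - 1 @[n --> \oo] --> (0 : C).
Proof.
move=> a0; apply/cvgcP => e e0.
have /cvgrPdist_lt /(_ e e0) := ces_cvg k a0; apply: filterS => n.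
by rewrite subr0 -(rmorph1 (real_complex R)) -rmorphB normc_real distrC.
Qed.

Lemma ces_sub1_bd (alpha K : R) n k : bmul (fun k => (ces alpha n k)%:C) K ->
  normc ((ces alpha n k)%:C - 1 : C) <= K + 1.
Proof.
move=> hK; rewrite (le_trans (le_normcD _ _))// normcN normc1 lerD2r.
exact: bmul_norm hK.
Qed.

Lemma sigma_subE (alpha : R) n a : 0 < alpha ->
  (fun k => sigma alpha n a k - a k) = fun k => ((ces alpha n k)%:C - 1) * a k.
Proof. by move=> a0; rewrite sigmaE//; apply/funext => k; rewrite mulrBl mul1r. Qed.

Lemma rad1_sigma (alpha : R) n a : 0 < alpha -> rad1 a -> rad1 (sigma alpha n a).
Proof.
move=> a0 ra; have [K K0 hK] := bmul_ces a0; rewrite sigmaE//.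
by apply: rad1_mul ra _ => k; exact: bmul_norm (hK n).
Qed.

Lemma hol_sigma_sub (alpha : R) n a z : 0 < alpha -> rad1 a -> normc z < 1 ->
  normc (hol (fun k => sigma alpha n a k - a k) z) <=
  normc (hol (fun k => (ces alpha n k)%:C * a k) z) + normc (hol a z).
Proof.
move=> a0 ra z1; rewrite holB//; last exact: rad1_sigma.
by rewrite sigmaE// (le_trans (le_normcD _ _))// normcN.
Qed.

Lemma mfun_normc_hol a : rad1 a -> mfun (disk 1) (fun p => normc (hol a (cpt p))).
Proof. by move=> ra; apply: cmeas_normc; exact: cmeas_hol. Qed.

Lemma A1norm_sigma_cvg (alpha : R) g : 0 < alpha -> inA1 g ->
  A1norm (fun k => sigma alpha n g k - g k) @[n --> \oo] --> 0%E.
Proof.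
move=> a0 [hg gfin]; have rg := holo_rad1 hg.
have [K K0 hK] := bmul_ces a0.
have pi0 : 0 < pi^-1 :> R by rewrite invr_gt0 pi_gt0.
have mg := mfun_normc_hol rg.
have Ifin : (normI (disk 1) (fun p => hol g (cpt p)) < +oo)%E.
  rewrite ltNge leye_eq; apply/negP => /eqP E.
  have : (pi^-1%:E * normI (disk 1) (fun p => hol g (cpt p)) < +oo)%E := gfin.
  by rewrite E mulry gtr0_sg// mul1e ltxx.
apply: cvge0_le => [n|e e0].
  by rewrite mule_ge0 ?lee_fin ?(ltW pi0)//; apply: integ_ge0 => p _; exact: normc_ge0.
pose A := fine (@area R (disk 1)).
have A0 : 0 <= A by apply: fine_ge0; exact: measure_ge0.
have AE : @area R (disk 1) = A%:E by rewrite fineK// ge0_fin_numE ?area_disk_fin.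
(* The factor pi undoes the normalisation of the norm and each region gets one half. On the annulus
   [sigma n g - g] costs K + 1 times the integral of |g|. *)
have e1 : 0 < e * pi / 2 / (K + 1).
  by rewrite divr_gt0 ?divr_gt0 ?mulr_gt0 ?pi_gt0// ltr_wpDl.
have [s [s01 hs]] := ann_tail mg (fun p _ => normc_ge0 _) Ifin e1.
have /andP[s0 s1] := s01.
have e2 : 0 < e * pi / 2 / (A + 1).
  by rewrite divr_gt0 ?divr_gt0 ?mulr_gt0 ?pi_gt0// ltr_wpDl.
have U := @mult_unif R nat \oo _ (fun n k => (ces alpha n k)%:C - 1) (K + 1) g s
  (e * pi / 2 / (A + 1)) (fun k => ces_sub1_cvg k a0)
  (nearW _ (fun n k => ces_sub1_bd k (hK n))) rg s01 e2.
case: U => N _ U; exists N => // n /U {}U.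
have rd : rad1 (fun k => sigma alpha n g k - g k) by apply: rad1B => //; exact: rad1_sigma.
have rc : rad1 (fun k => (ces alpha n k)%:C * g k).
  by apply: rad1_mul rg _ => k; exact: bmul_norm (hK n).
have md := mfun_normc_hol rd.
have H1 : (normI (disk s) (fun p => hol (fun k => sigma alpha n g k - g k)%R (cpt p)) <= (e * pi / 2)%:E)%E.
  have sd : disk s `<=` (@disk R 1) by have [-> _] := @disk_split R s s01; left.
  apply: (@le_trans _ _ (integ (disk s) (fun=> e * pi / 2 / (A + 1)))).
    apply: integ_le.
    - exact: measurable_disk.
    - by apply: measurable_funS md => //; exact: measurable_disk.
    - exact: measurable_cst.
    - by move=> p _; exact: normc_ge0.
    - move=> p /(diskE p s0) ps; rewrite sigma_subE//; apply: U; exact: ltW.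
  rewrite integ_cst; last exact: measurable_disk.
  apply: (@le_trans _ _ ((e * pi / 2 / (A + 1))%:E * A%:E)%E).
    rewrite lee_wpmul2l ?lee_fin ?(ltW e2)// -AE.
    by apply: le_measure; rewrite ?inE//; exact: measurable_disk.
  rewrite -EFinM lee_fin mulrAC ler_pdivrMr ?ltr_wpDl// ler_wpM2l ?lerDl//.
  by rewrite ltW// divr_gt0// mulr_gt0// pi_gt0.
have H2 : (normI (ann s 1) (fun p => hol (fun k => sigma alpha n g k - g k)%R (cpt p)) <= (e * pi / 2)%:E)%E.
  have le11 : ((0 : R) <= 1) && ((1 : R) <= 1) by rewrite ler01 le_refl.
  have mA := @measurable_ann R s 1.
  have mn b : rad1 b -> mfun (ann s 1) (fun p => normc (hol b (cpt p))).
    by move=> rb; exact: measurable_normc_hol.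
  apply: (@le_trans _ _ (integ (ann s 1) (fun p =>
      normc (hol (fun k => (ces alpha n k)%:C * g k) (cpt p)) + normc (hol g (cpt p))))).
    apply: (integ_le mA (mn _ rd)).
    - exact: measurable_funD (mn _ rc) (mn _ rg).
    - by move=> p _; exact: normc_ge0.
    - move=> p /(annE p s0 ler01)/andP[_ p1]; exact: hol_sigma_sub.
  rewrite (integD mA (mn _ rc) (mn _ rg) (fun p _ => normc_ge0 _) (fun p _ => normc_ge0 _)).
  apply: le_trans (leeD (mult_int (hK n) rg s0) (lexx _)) _.
  apply: (@le_trans _ _ (K%:E * (e * pi / 2 / (K + 1))%:E + (e * pi / 2 / (K + 1))%:E)%E).
    by apply: leeD => //; rewrite lee_wpmul2l ?lee_fin.
  rewrite -EFinM -EFinD lee_fin.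
  have K1 : K + 1 != 0 by rewrite gt_eqF// ltr_wpDl.
  by apply: eq_lerR; field.
rewrite /A1norm -/(integ _ _) (integ_disk_split s01 md (fun p _ => normc_ge0 _)).
apply: (@le_trans _ _ (pi^-1%:E * ((e * pi / 2)%:E + (e * pi / 2)%:E))%E).
  by rewrite lee_wpmul2l ?lee_fin ?(ltW pi0)//; exact: leeD.
rewrite -EFinD -EFinM lee_fin; apply: eq_lerR.
have pin : (pi : R) != 0 by rewrite (gt_eqF (pi_gt0 R)).
by rewrite -splitr mulrCA mulVf ?mulr1.
Qed.

Lemma dv_mult (l : nat -> C) a : dv (fun k => l k * a k) = fun k => l k.+1 * dv a k.
Proof. by apply/funext => k; rewrite /dv mulrCA. Qed.

Lemma hol_dvX a z : rad1 a -> normc z < 1 ->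
  hol (fun k => k%:R * a k) z = z * hol (dv a) z.
Proof. by move=> ra z1; rewrite holXM ?mul0r ?add0r//; exact: rad1_nat. Qed.

(** Differentiation shifts the multiplier by one index, but z f'(z) has coefficients k a_k and sees
    l unshifted. The bound is proved for z f' and divided by |z|, hence z <> 0. *)
Lemma dv_mult_sup (l : nat -> C) K a z S : bmul l K -> rad1 a -> 0 < normc z < 1 ->
  (forall w, normc w = normc z -> normc (hol (dv a) w) <= S) ->
  normc (hol (dv (fun k => l k * a k)) z) <= K * S.
Proof.
move=> lK ra /andP[z0 z1] hS.
have rla : rad1 (fun k => l k * a k) by apply: rad1_mul ra _ => k; exact: bmul_norm lK.
rewrite -(ler_pM2l z0) -normcM -hol_dvX// mulrCA.
have -> : (fun k => k%:R * (l k * a k)) = fun k => l k * (k%:R * a k).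
  by apply/funext => k; rewrite mulrCA.
apply: (mult_sup lK (rad1_nat ra) z1) => w wz.
have w1 : normc w < 1 by rewrite wz.
rewrite (hol_dvX ra w1).
by rewrite [leLHS]normcM wz ler_wpM2l ?hS// ltW.
Qed.

Lemma Bnorm_sigma_cvg (alpha : R) f : 0 < alpha -> inB0 f ->
  Bnorm (fun k => sigma alpha n f k - f k) @[n --> \oo] --> 0%E.
Proof.
move=> a0 [[hf _] f0]; have rf := holo_rad1 hf.
have [K K0 hK] := bmul_ces a0.
have rd n : rad1 (fun k => sigma alpha n f k - f k) by apply: rad1B => //; exact: rad1_sigma.
(* The multiplier is 1 at k = 0, so the norm of the difference reduces to its seminorm. *)
have H0 n : hol (fun k => sigma alpha n f k - f k) 0 = 0.
  by rewrite hol0 sigmaE// /ces subn0 divff ?gt_eqF ?mu_gt0// mul1r subrr.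
have K1 : 0 < K + 1 by rewrite ltr_wpDl.
have E n : Bnorm (fun k => sigma alpha n f k - f k) = bloch_semi (fun k => sigma alpha n f k - f k).
  by rewrite /Bnorm H0 normc0 add0e.
rewrite (_ : (fun n => _) = fun n => bloch_semi (fun k => sigma alpha n f k - f k)); last exact/funext.
apply: cvge0_le => [n|e e0].
  apply: (@le_trans _ _ ((1 - normc (0 : C) ^+ 2) * normc (hol' (fun k => sigma alpha n f k - f k) 0))%:E).
    by rewrite lee_fin mulr_ge0 ?normc_ge0// normc0 expr0n subr0 ler01.
  by apply: ereal_sup_ubound; exists (0 : C) => //; rewrite /mkset normc0 ltr01.
have e1 : 0 < e / (K + 1) by rewrite divr_gt0.
have [r0 [r01 hr0]] := f0 _ e1.
(* The radius provided by the little Bloch condition may be negative. *)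
pose r := Num.max r0 0.
have r01' : 0 <= r < 1 by rewrite le_max lexx orbT /= gt_max r01 ltr01.
have U := @mult_unif R nat \oo _ (fun n k => (ces alpha n k.+1)%:C - 1) (K + 1) (dv f) r
  e (fun k => ces_sub1_cvg k.+1 a0)
  (nearW _ (fun n k => ces_sub1_bd k.+1 (hK n))) (rad1_dv rf) r01' e0.
case: U => N _ U; exists N => // n /U {}U.
apply: ge_ereal_sup => _ [z /= z1 <-]; rewrite lee_fin.
have z0 := normc_ge0 z.
have q0 : 0 <= 1 - normc z ^+ 2 by rewrite subr_ge0 expr_le1// ltW.
rewrite hol'E//.
have [zr|zr] := lerP (normc z) r.
  rewrite sigma_subE// dv_mult; apply: (@le_trans _ _ (1 * e)); last by rewrite mul1r.
  by apply: ler_pM => //; [exact: normc_ge0|rewrite gerBl exprn_ge0|exact: U].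
have zp : 0 < normc z by apply: le_lt_trans zr; rewrite le_max lexx orbT.
have q1 : 0 < 1 - normc z ^+ 2 by rewrite subr_gt0 exprn_ilt1.
(* The weight 1 - |z|^2 is constant on the circle through z, so there the Bloch condition is a
   uniform bound on f'. *)
have hS w : normc w = normc z -> normc (hol (dv f) w) <= e / (K + 1) / (1 - normc z ^+ 2).
  move=> wz; rewrite ler_pdivlMr// mulrC -wz -hol'E ?wz//.
  rewrite -wz; apply/ltW/hr0; rewrite wz//; apply: le_lt_trans zr.
  by rewrite le_max lexx.
have zz : 0 < normc z < 1 by rewrite zp.
have -> : hol (dv (fun k => sigma alpha n f k - f k)) z =
    hol (dv (fun k => (ces alpha n k)%:C * f k)) z - hol (dv f) z.
  rewrite -holB//; last 2 first.
  - apply: rad1_dv; apply: rad1_mul rf _ => k; exact: bmul_norm (hK n).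
  - exact: rad1_dv.
  by congr hol; apply/funext => k; rewrite /dv sigmaE// mulrBr.
have T := lerD (dv_mult_sup (hK n) rf zz hS) (hS z erefl).
apply: le_trans (ler_wpM2l q0 (le_trans (le_normcD _ _) _)) _; first by rewrite normcN; exact: T.
have q1' : 1 - normc z ^+ 2 != 0 by rewrite gt_eqF.
have K1' : K + 1 != 0 by rewrite gt_eqF.
by apply: eq_lerR; field; rewrite K1' q1'.
Qed.

End NormConvergence.

(** * The Bloch duality *)

Section ComplexIntegral.
Set Implicit Arguments.
Unset Strict Implicit.
Import ComplexField.Normc.
Local Open Scope complex_scope.
Local Open Scope ring_scope.
Context {R : realType}.
Notation C := (Cx R).
Notation RR := (measurableTypeR R).
Notation R2 := (RR * RR)%type.
Notation normI A F := (integ A (fun p => normc (F p))).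
Notation mfun A f := (@measurable_fun _ _ R2 R A f).
Implicit Types (a b g h : nat -> C) (z w u : C) (F G : R2 -> C) (A : set R2).

Definition rint A (f : R2 -> R) : R := fine (integ A f).

Lemma rintE A f : Rintegral (@area R) A f = rint A f.
Proof. by []. Qed.

Lemma integrable_bound A (f g : R2 -> R) : measurable A -> mfun A f -> mfun A g ->
  (forall p, A p -> `|f p| <= g p) -> (integ A g < +oo)%E ->
  (@area R).-integrable A (fun p => (f p)%:E).
Proof.
move=> mA mf mg fg gfin; apply/integrableP; split; first exact/measurable_EFinP.
apply: le_lt_trans gfin; apply: (ge0_le_integral _ mA).
- by move=> p _; exact: abse_ge0.
- by apply/measurable_EFinP; apply: measurableT_comp mf; exact: normr_measurable.
- exact/measurable_EFinP.
- by move=> p Ap; rewrite /= lee_fin fg.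
Qed.

Lemma rint_dct A (f_ : nat -> R2 -> R) (f g : R2 -> R) : measurable A ->
  (forall n, mfun A (f_ n)) -> mfun A f -> mfun A g -> (integ A g < +oo)%E ->
  (forall p, A p -> f_ n p @[n --> \oo] --> f p) ->
  (forall n p, A p -> `|f_ n p| <= g p) ->
  rint A (f_ n) @[n --> \oo] --> rint A f.
Proof.
move=> mA mf_ mf mg gfin cf bf.
have ig : (@area R).-integrable A (fun p => (g p)%:E).
  apply: (integrable_bound mA mg mg) => // p Ap.
  by rewrite ger0_norm// (le_trans _ (bf 0%N p Ap)).
have [||||i _ H] := @dominated_convergence _ R2 R (@area R) A mA (fun n p => (f_ n p)%:E)
  (fun p => (f p)%:E) (fun p => (g p)%:E) _ _ _ ig _.
- by move=> n; exact/measurable_EFinP.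
- exact/measurable_EFinP.
- by apply: aeW => p Ap; apply: cvg_EFin; [exact: nearW|exact: cf].
- by apply: aeW => p n Ap; rewrite lee_fin bf.
apply: fine_cvg; rewrite /rint fineK; first exact: H.
exact: integrable_fin_num i.
Qed.

Definition cint A F : C :=
  Complex (rint A (fun p => complex.Re (F p))) (rint A (fun p => complex.Im (F p))).

Lemma cint_dct A (f_ : nat -> R2 -> C) F (g : R2 -> R) : measurable A ->
  (forall n, cmeas A (f_ n)) -> cmeas A F -> mfun A g -> (integ A g < +oo)%E ->
  (forall p, A p -> f_ n p @[n --> \oo] --> F p) ->
  (forall n p, A p -> normc (f_ n p) <= g p) ->
  cint A (f_ n) @[n --> \oo] --> cint A F.
Proof.
move=> mA mf [F1 F2] mg gfin cf bf; apply: cvgc_ReIm => /=.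
  apply: (rint_dct mA _ F1 mg gfin) => [n|p Ap|n p Ap].
  - by have [] := mf n.
  - by apply: cvgc_Re; exact: cf.
  - by rewrite (le_trans (normc_Re _)) ?bf.
apply: (rint_dct mA _ F2 mg gfin) => [n|p Ap|n p Ap].
- by have [] := mf n.
- by apply: cvgc_Im; exact: cf.
- by rewrite (le_trans (normc_Im _)) ?bf.
Qed.

(** Boundedness instead of integrability: it is stable under products and implies integrability on
    sets of finite area. *)
Definition bdm A F := cmeas A F /\ exists B : R, forall p, A p -> normc (F p) <= B.

Lemma integ_cst_fin A (B : R) : measurable A -> (@area R A < +oo)%E ->
  (integ A (fun=> B) < +oo)%E.
Proof.
move=> mA fA; rewrite integ_cst// -[@area R A]fineK; first by rewrite -EFinM ltry.
by rewrite ge0_fin_numE.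
Qed.

Lemma bdm_integrable A F : measurable A -> (@area R A < +oo)%E -> bdm A F ->
  (@area R).-integrable A (fun p => (complex.Re (F p))%:E) /\
  (@area R).-integrable A (fun p => (complex.Im (F p))%:E).
Proof.
move=> mA fA [[F1 F2] [B hB]].
split; apply: (@integrable_bound A _ (fun=> B)) => //; try exact: measurable_cst;
  try exact: integ_cst_fin.
- by move=> p Ap; rewrite (le_trans (normc_Re _)) ?hB.
- by move=> p Ap; rewrite (le_trans (normc_Im _)) ?hB.
Qed.

Lemma bdmD A F G : bdm A F -> bdm A G -> bdm A (fun p => F p + G p).
Proof.
move=> [mF [B hB]] [mG [B' hB']]; split; first exact: cmeasD.
by exists (B + B') => p Ap; rewrite (le_trans (le_normcD _ _))// lerD ?hB ?hB'.
Qed.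

Lemma bdmM A F G : bdm A F -> bdm A G -> bdm A (fun p => F p * G p).
Proof.
move=> [mF [B hB]] [mG [B' hB']]; split; first exact: cmeasM.
by exists (B * B') => p Ap; rewrite normcM ler_pM ?normc_ge0 ?hB ?hB'.
Qed.

Lemma bdm_cst A c : bdm A (fun=> c).
Proof. by split; [exact: cmeas_cst|exists (normc c)]. Qed.

Lemma bdmX A F n : bdm A F -> bdm A (fun p => F p ^+ n).
Proof.
move=> bF; elim: n => [|n IH]; first exact: bdm_cst.
by under eq_fun do rewrite exprS; exact: bdmM.
Qed.

Lemma bdm_sum A n (F : nat -> R2 -> C) : (forall i, bdm A (F i)) ->
  bdm A (fun p => \sum_(i < n) F i p).
Proof.
move=> bF; elim: n => [|n IH].
  by under eq_fun do rewrite big_ord0; exact: bdm_cst.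
by under eq_fun do rewrite big_ord_recr /=; exact: bdmD.
Qed.

Lemma cintD A F G : measurable A -> (@area R A < +oo)%E -> bdm A F -> bdm A G ->
  cint A (fun p => F p + G p) = cint A F + cint A G.
Proof.
move=> mA fA bF bG; have [f1 f2] := bdm_integrable mA fA bF.
have [g1 g2] := bdm_integrable mA fA bG.
apply/eqP; rewrite eq_complex /=; apply/andP; split; apply/eqP.
  have := RintegralD mA f1 g1; rewrite !rintE => <-; rewrite /rint; congr fine.
  by apply: integ_eq => p _; rewrite raddfD.
have := RintegralD mA f2 g2; rewrite !rintE => <-; rewrite /rint; congr fine.
by apply: integ_eq => p _; rewrite raddfD.
Qed.

Lemma rintZ A (f : R2 -> R) k : measurable A ->
  (@area R).-integrable A (fun p => (f p)%:E) ->
  rint A (fun p => k * f p) = k * rint A f.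
Proof. by move=> mA i; have := RintegralZl k mA i; rewrite !rintE. Qed.

Lemma cintZ A F c : measurable A -> (@area R A < +oo)%E -> bdm A F ->
  cint A (fun p => c * F p) = c * cint A F.
Proof.
move=> mA fA bF; have [f1 f2] := bdm_integrable mA fA bF.
have i1 k := integrableZl mA k f1; have i2 k := integrableZl mA k f2.
case: c => x y; apply/eqP; rewrite eq_complex /=; apply/andP; split; apply/eqP.
  rewrite -!rintZ// -rintE -[in RHS]rintE -[X in _ = _ - X]rintE.
  rewrite -(RintegralB mA); last 2 first.
  - exact: i1 x.
  - exact: i2 y.
  by rewrite !rintE /rint; congr fine; apply: integ_eq => p _; case: (F p).
rewrite -!rintZ// -rintE -[X in _ = X + _]rintE -[X in _ = _ + X]rintE.
rewrite -(RintegralD mA); last 2 first.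
- exact: i2 x.
- exact: i1 y.
by rewrite !rintE /rint; congr fine; apply: integ_eq => p _; case: (F p).
Qed.

Lemma cint_eq A F G : (forall p, A p -> F p = G p) -> cint A F = cint A G.
Proof.
by move=> FG; rewrite /cint /rint; congr Complex; congr fine; apply: integ_eq => p /FG ->.
Qed.

Lemma cint_sum A n (F : nat -> R2 -> C) : measurable A -> (@area R A < +oo)%E ->
  (forall i, bdm A (F i)) -> cint A (fun p => \sum_(i < n) F i p) = \sum_(i < n) cint A (F i).
Proof.
move=> mA fA bF; elim: n => [|n IH].
  rewrite big_ord0 -[RHS](mul0r (cint A (F 0%N))) -(cintZ 0 mA fA (bF 0%N)).
  by apply: cint_eq => p _; rewrite big_ord0 mul0r.
rewrite big_ord_recr /= -IH -cintD//; last exact: bdm_sum.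
by congr cint; apply/funext => p; rewrite big_ord_recr.
Qed.

Lemma cint_rot A F u : measurable A -> cmeas A F ->
  normc u = 1 -> (forall p, A (rot (complex.Re u) (complex.Im u) p) <-> A p) ->
  cint A (fun p => F (rot (complex.Re u) (complex.Im u) p)) = cint A F.
Proof.
move=> mA [F1 F2] u1 hA; rewrite /cint /rint; congr Complex; congr fine.
  exact: (integ_rot mA F1 u1 hA).
exact: (integ_rot mA F2 u1 hA).
Qed.

Lemma disk_rot r u p : 0 <= r -> normc u = 1 ->
  disk r (rot (complex.Re u) (complex.Im u) p) <-> disk r p.
Proof. by move=> r0 u1; rewrite !diskE// cpt_rot normcM u1 mul1r. Qed.

Lemma disk_sub r : 0 <= r < 1 -> disk r `<=` (@disk R 1).
Proof. by move=> r01; have [-> _] := disk_split r01; left. Qed.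

Lemma area_disk_lty r : 0 <= r < 1 -> (@area R (disk r) < +oo)%E.
Proof.
move=> r01; apply: le_lt_trans area_disk_fin; apply: le_measure; rewrite ?inE.
- exact: measurable_disk.
- exact: measurable_disk.
- exact: disk_sub.
Qed.

Lemma bdm_cpt r : 0 <= r -> bdm (disk r) (@cpt R).
Proof.
move=> r0; split; first exact: cmeas_cpt.
by exists r => p /(diskE p r0) /ltW.
Qed.

Lemma bdm_conj A F : bdm A F -> bdm A (fun p => conjc (F p)).
Proof.
move=> [mF [B hB]]; split; first exact: cmeas_conj.
by exists B => p /hB; rewrite normcJ.
Qed.

(** Rotation by u multiplies the integral by u^j conj(u)^k = u^(j-k). This factor is not 1 for u
    primitive of order j + k + 1, since j and k are distinct residues below that order. *)
Lemma cint_orth r (j k : nat) : 0 <= r < 1 -> j != k ->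
  cint (disk r) (fun p => cpt p ^+ j * conjc (cpt p) ^+ k) = 0.
Proof.
move=> r01 jk; have /andP[r0 r1] := r01.
have [u pu] := @prim_root_exists R (j + k).+1 (ltn0Sn _).
have u1 : normc u = 1 by apply: (@normc_unity R (j + k).+1) => //; exact: prim_expr_order pu.
have mA := @measurable_disk R r; have fA := area_disk_lty r01.
have bF : bdm (disk r) (fun p => cpt p ^+ j * conjc (cpt p) ^+ k).
  by apply: bdmM; apply: bdmX; [exact: bdm_cpt|apply: bdm_conj; exact: bdm_cpt].
set I := cint _ _.
have E : I = (u ^+ j * conjc u ^+ k) * I.
  rewrite -{2}/I -cintZ// -[LHS](cint_rot mA (proj1 bF) u1 (fun p => disk_rot p r0 u1)).
  apply: cint_eq => p _; rewrite cpt_rot rmorphM !exprMn; ring.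
have cu : conjc u * u = 1 by rewrite mulrC -sqr_normc normc_norm u1 expr1n.
have N : u ^+ j * conjc u ^+ k != 1.
  apply: contra_neq jk => /(congr1 (fun t => t * u ^+ k)).
  rewrite -mulrA -exprMn cu expr1n mulr1 mul1r => /eqP.
  by rewrite (eq_prim_root_expr pu) !modn_small ?ltnS ?leq_addl ?leq_addr// => /eqP.
apply/eqP; move/eqP: E; rewrite -subr_eq0 -{1}[I]mul1r -mulrBl mulf_eq0.
by rewrite subr_eq0 eq_sym (negbTE N).
Qed.

End ComplexIntegral.

(** * Moments of the disk and the pairing of power series *)

Section Moments.
Set Implicit Arguments.
Unset Strict Implicit.
Import ComplexField.Normc.
Local Open Scope complex_scope.
Local Open Scope ring_scope.
Context {R : realType}.
Notation C := (Cx R).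
Notation RR := (measurableTypeR R).
Notation R2 := (RR * RR)%type.
Notation normI A F := (integ A (fun p => normc (F p))).
Notation mfun A f := (@measurable_fun _ _ R2 R A f).
Implicit Types (a b g h : nat -> C) (z w u : C) (F G : R2 -> C) (A : set R2).

Definition sq (p : R * R) : R := p.1 ^+ 2 + p.2 ^+ 2.

Lemma sq_ge0 p : 0 <= sq p.
Proof. by rewrite addr_ge0 ?sqr_ge0. Qed.

Lemma sq_normc (p : R * R) : sq p = normc (cpt p) ^+ 2.
Proof. by rewrite sqr_sqrtr// sq_ge0. Qed.

Lemma cptMJ (p : R * R) : cpt p * conjc (cpt p) = (sq p)%:C.
Proof.
case: p => x y; apply/eqP; rewrite eq_complex /= /sq /=; apply/andP; split; apply/eqP; ring.
Qed.

Lemma mfun_sq A : mfun A sq.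
Proof.
apply: measurable_funTS; apply: measurable_funD; apply: measurable_funX;
  [exact: measurable_fst|exact: measurable_snd].
Qed.

Lemma mfun_sqX A k : mfun A (fun p => sq p ^+ k).
Proof. by apply: measurable_funX; exact: mfun_sq. Qed.

Lemma cint_real A (f : R2 -> R) : measurable A -> cint A (fun p => (f p)%:C) = (rint A f)%:C.
Proof. by move=> mA; rewrite /cint /rint /= integ_cst// mul0e. Qed.

Lemma integ_scale (f : R2 -> R) r : 0 < r -> mfun setT f -> (forall p, 0 <= f p) ->
  (integ (disk r) f = (r ^+ 2)%:E * integ (disk 1) (fun p => f (dil r p)))%E.
Proof.
move=> r0 mf f0; rewrite /integ integral_mkcond.
have mfE : @measurable_fun _ _ R2 _ setT (fun p => (f p)%:E) by exact/measurable_EFinP.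
have m : @measurable_fun _ _ R2 _ setT ((fun p => (f p)%:E) \_ (disk r)).
  apply/(measurable_restrictT _ (measurable_disk r)).
  by apply: measurable_funTS.
rewrite -(integral_area_scale r0 m); last first.
  by move=> p; rewrite /patch; case: ifP => // _; rewrite lee_fin.
congr (_ * _)%E; rewrite [RHS]integral_mkcond; apply: eq_integral => p _.
rewrite /patch /=.
have E : ((r * p.1) ^+ 2 + (r * p.2) ^+ 2 < r ^+ 2) = (p.1 ^+ 2 + p.2 ^+ 2 < 1 ^+ 2).
  by rewrite !exprMn expr1n -mulrDr -[X in _ < X]mulr1 ltr_pM2l ?exprn_gt0.
have -> // : (dil r p \in disk r) = (p \in disk 1).
by apply/idP/idP; rewrite !inE /disk /dil /= E.
Qed.

Definition mom k r := rint (disk r) (fun p => sq p ^+ k).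

Lemma sqX_le1 k r p : 0 <= r <= 1 -> disk r p -> sq p ^+ k <= 1.
Proof.
move=> /andP[r0 r1] dp; rewrite exprn_ile1 ?sq_ge0//.
by rewrite (le_trans (ltW dp))// expr_le1.
Qed.

Lemma area_disk_le1_lty r : 0 <= r <= 1 -> (@area R (disk r) < +oo)%E.
Proof.
move=> /andP[r0]; rewrite le_eqVlt => /predU1P[->|r1]; first exact: area_disk_fin.
by apply: area_disk_lty; rewrite r0.
Qed.

Lemma mom_fin k r : 0 <= r <= 1 -> integ (disk r) (fun p => sq p ^+ k) \is a fin_num.
Proof.
move=> r01; have mD := @measurable_disk R r.
have h0 p : 0 <= sq p ^+ k by rewrite exprn_ge0 ?sq_ge0.
rewrite ge0_fin_numE; last by apply: integ_ge0.
apply: (@le_lt_trans _ _ (integ (disk r) (fun=> 1))).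
  apply: integ_le; [by []|exact: mfun_sqX|exact: measurable_cst|by move=> p _|].
  by move=> p; exact: sqX_le1.
by apply: integ_cst_fin => //; exact: area_disk_le1_lty.
Qed.

Lemma mom_scale k r : 0 < r -> mom k r = (r ^+ 2) ^+ k.+1 * mom k 1.
Proof.
move=> r0; have r20 : 0 <= r ^+ 2 by rewrite exprn_ge0 ?ltW.
have h0 p : 0 <= sq p ^+ k by rewrite exprn_ge0 ?sq_ge0.
have f1 : integ (disk 1) (fun p => sq p ^+ k) \is a fin_num.
  by apply: mom_fin; rewrite ler01 lexx.
rewrite /mom /rint integ_scale//; last exact: mfun_sqX.
rewrite (integ_eq (g := fun p => (r ^+ 2) ^+ k * sq p ^+ k)); last first.
  move=> p _; have -> : sq (dil r p) = r ^+ 2 * sq p by rewrite /sq /dil /=; ring.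
  by rewrite exprMn.
rewrite (integZ (measurable_disk 1) (@mfun_sqX (disk 1) k) (fun p _ => h0 p) (exprn_ge0 k r20)).
by rewrite muleA -EFinM fineM//= [(r ^+ 2) ^+ k.+1]exprS.
Qed.

Lemma bernoulli (d : R) k : 0 <= d <= 1 -> 1 - k%:R * d <= (1 - d) ^+ k.
Proof.
move=> /andP[d0 d1]; elim: k => [|k IH]; first by rewrite mul0r subr0 expr0.
have e0 : 0 <= 1 - d by lra.
rewrite exprS (le_trans _ (ler_wpM2l e0 IH))// -natr1.
have : 0 <= k%:R * d * d by rewrite !mulr_ge0.
lra.
Qed.

(** The passage d -> 0 in an inequality made linear in d by Bernoulli's bound: d is taken so small
    that x k d <= e. *)
Lemma le_lim_bernoulli (x y : R) k : 0 <= x ->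
  (forall d, 0 < d < 1 -> x * (1 - k%:R * d) <= y) -> x <= y.
Proof.
move=> x0 h; apply/ler_addgt0Pl => e e0.
have K1 : 0 < x * k%:R + 1 by rewrite ltr_wpDl// mulr_ge0.
pose d := Num.min 2^-1 (e / (x * k%:R + 1)).
have d0 : 0 < d by rewrite lt_min invr_gt0 ltr0n divr_gt0.
have d1 : d < 1 by rewrite gt_min invf_lt1 ?ltr0n// ltr1n.
have dd : 0 < d < 1 by rewrite d0.
have := h d dd; have : x * k%:R * d <= e.
  have de : d <= e / (x * k%:R + 1) by rewrite ge_min lexx orbT.
  move: de; rewrite ler_pdivlMr// => de.
  have : 0 <= x * k%:R by rewrite mulr_ge0.
  by move: d0 de; lra.
lra.
Qed.

(* On the annulus s <= |z| < 1 the function |z|^(2k) lies between s^(2k) and 1;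
   comparing areas as s -> 1 yields the moment without polar coordinates. *)
Lemma mom1 k : k.+1%:R * mom k 1 = mom 0 1.
Proof.
set M := mom k 1; set c := mom 0 1.
have le11 : ((0 : R) <= 1) && ((1 : R) <= 1) by rewrite ler01 le_refl.
have M0 : 0 <= M by apply: fine_ge0; apply: integ_ge0 => p _; rewrite exprn_ge0 ?sq_ge0.
have c0 : 0 <= c by apply: fine_ge0; apply: integ_ge0 => p _; rewrite exprn_ge0 ?sq_ge0.
have Z (x y f : R) : x = y * x + f -> f = x * (1 - y).
  by move=> xE; rewrite mulrBr mulr1 {1}xE; ring.
have S s : 0 < s < 1 -> (s ^+ 2) ^+ k * (c * (1 - s ^+ 2)) <= M * (1 - (s ^+ 2) ^+ k.+1) /\
    M * (1 - (s ^+ 2) ^+ k.+1) <= c * (1 - s ^+ 2).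
  move=> /andP[s0 s1]; have s01 : 0 <= s < 1 by rewrite ltW.
  have s01' : 0 <= s <= 1 by rewrite !ltW.
  have mA := @measurable_ann R s 1.
  have X j : mom j 1 = mom j s + fine (integ (ann s 1) (fun p => sq p ^+ j)) /\
      integ (ann s 1) (fun p => sq p ^+ j) \is a fin_num.
    have h0 p : 0 <= sq p ^+ j by rewrite exprn_ge0 ?sq_ge0.
    have E := @integ_disk_split R (fun p => sq p ^+ j) s s01 (@mfun_sqX (disk 1) j) (fun p _ => h0 p).
    have F1 := mom_fin j le11; have F2 := mom_fin j s01'.
    have F3 : integ (ann s 1) (fun p => sq p ^+ j) \is a fin_num.
      by move: F1; rewrite E fin_numD => /andP[].
    by split => //; rewrite /mom /rint E fineD.
  have [X1 Y1] := X k; have [X2 Y2] := X 0%N.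
  have e1 : fine (integ (ann s 1) (fun p => sq p ^+ k)) = M * (1 - (s ^+ 2) ^+ k.+1).
    by apply: Z; rewrite -(mom_scale k s0).
  have e2 : fine (integ (ann s 1) (fun p => sq p ^+ 0)) = c * (1 - s ^+ 2).
    by apply: Z; rewrite -[X in X * c]expr1 -(mom_scale 0 s0).
  rewrite -e1 -e2; split.
    have -> : (s ^+ 2) ^+ k * fine (integ (ann s 1) (fun p => sq p ^+ 0)) =
        fine (integ (ann s 1) (fun p => (s ^+ 2) ^+ k * sq p ^+ 0)).
      by rewrite integZ ?fineM// ?exprn_ge0 ?(ltW s0).
    apply: fine_le => //.
      by rewrite integZ ?fin_numM// ?exprn_ge0 ?(ltW s0).
    apply: integ_le => //.
    - by apply: measurable_funM; [exact: measurable_cst|exact: mfun_sqX].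
    - exact: mfun_sqX.
    - by move=> p _; rewrite expr0 mulr1 !exprn_ge0 ?(ltW s0).
    - move=> p /(annE p (ltW s0) ler01)/andP[sp _]; rewrite expr0 mulr1 lerXn2r ?nnegrE ?sq_ge0 ?exprn_ge0 ?(ltW s0)//.
      by rewrite sq_normc lerXn2r ?nnegrE ?normc_ge0 ?(ltW s0).
  apply: fine_le => //; apply: integ_le => //; try exact: mfun_sqX.
  - by move=> p _; rewrite exprn_ge0 ?sq_ge0.
  - move=> p [p1 _]; rewrite expr0; exact: sqX_le1 le11 p1.
(* With x = s^2, division by 1 - x turns 1 - x^(k+1) into a geometric sum, which tends to k + 1 as x
   tends to 1. *)
have T (x : R) : 0 < x < 1 -> x ^+ k * c <= M * (\sum_(i < k.+1) x ^+ i) /\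
    M * (\sum_(i < k.+1) x ^+ i) <= c.
  move=> /andP[x0 x1]; have q0 : 0 < 1 - x by lra.
  have ss : 0 < Num.sqrt x < 1 by rewrite sqrtr_gt0 x0 -sqrtr1 ltr_sqrt.
  have x0' := ltW x0; have [] := S _ ss; rewrite sqr_sqrtr//.
  have -> : 1 - x ^+ k.+1 = (1 - x) * \sum_(i < k.+1) x ^+ i.
    by rewrite -[1 - x]opprB mulNr -subrX1 opprB.
  move=> h1 h2; split; rewrite -(ler_pM2r q0).
    by rewrite -mulrA (le_trans h1)//; apply: eq_lerR; ring.
  by rewrite (le_trans _ h2)//; apply: eq_lerR; ring.
have U (x : R) : 0 < x < 1 -> \sum_(i < k.+1) x ^+ i <= k.+1%:R.
  move=> /andP[x0 x1]; rewrite -[k.+1 in leRHS]card_ord -sumr_const ler_sum// => i _.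
  by rewrite exprn_ile1 ?ltW.
have L (d : R) : 0 < d < 1 -> k.+1%:R * (1 - k%:R * d) <= \sum_(i < k.+1) (1 - d) ^+ i.
  move=> /andP[d0 d1]; rewrite mulr_natl -[k.+1 in leLHS]card_ord -sumr_const ler_sum// => i _.
  have dd : (0 <= d) && (d <= 1) by rewrite !ltW.
  rewrite (le_trans _ (@bernoulli d i dd))// lerD2l lerN2 ler_wpM2r ?(ltW d0)// ler_nat.
  by rewrite -ltnS.
have D (d : R) : 0 < d < 1 -> 0 < 1 - d < 1 by lra.
apply/eqP; rewrite eq_le; apply/andP; split.
  apply: (@le_lim_bernoulli _ _ k) => [|d dd]; first by rewrite mulr_ge0.
  have [_ h] := T _ (D d dd); apply: le_trans h.
  by rewrite mulrAC mulrC; apply: ler_wpM2l => //; exact: L.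
apply: (@le_lim_bernoulli _ _ k) => // d dd.
have [h _] := T _ (D d dd).
have ddw : (0 <= d) && (d <= 1) by case/andP: dd => d0 d1; rewrite !ltW.
apply: le_trans (ler_wpM2l c0 (@bernoulli d k ddw)) _; rewrite mulrC (le_trans h)// mulrC.
by rewrite ler_wpM2r// U// D.
Qed.

(** The integrand is |z|^0, so this is the area of the unit disk, kept symbolic. *)
Definition cA : R := mom 0 1.

Lemma momE k r : 0 < r -> mom k r = (r ^+ 2) ^+ k.+1 * (cA / k.+1%:R).
Proof. by move=> r0; rewrite mom_scale// /cA -(mom1 k) mulrAC mulfV ?mul1r// pnatr_eq0. Qed.

Lemma psum_bd a r : rad1 a -> 0 <= r < 1 -> exists K, forall n z, normc z <= r ->
  normc (psum a n z) <= K /\ normc (hol a z) <= K.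
Proof.
move=> ra r01; have [K hK] := psum_bound ra r01; exists K => n z zr.
have H m : normc (psum a m z) <= K.
  apply: le_trans (hK m); rewrite /psum (le_trans (normc_sum _ _ _))//.
  apply: ler_sum => k _; rewrite normcM normcX ler_wpM2l ?normc_ge0//.
  by rewrite lerXn2r ?nnegrE ?normc_ge0 ?(le_trans _ zr) ?normc_ge0.
split=> //; rewrite -[X in normc X]subr0; apply: (@cvgc_le _ _ \oo _ (fun m => psum a m z)).
  by apply: hol_cvg => //; case/andP: r01 => _; exact: le_lt_trans.
by apply: nearW => m; rewrite subr0.
Qed.

Lemma bdm_hol a r : rad1 a -> 0 <= r < 1 -> bdm (disk r) (fun p => hol a (cpt p)).
Proof.
move=> ra r01; split; first by apply: cmeas_hol => //; exact: disk_sub.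
have [K hK] := psum_bd ra r01; exists K => p; case/andP: (r01) => r0 _.
by move=> /(diskE p r0) /ltW pr; have [] := hK 0%N _ pr.
Qed.

Lemma cmeas_holJ a A : rad1 a -> A `<=` disk 1 -> cmeas A (fun p => hol a (conjc (cpt p))).
Proof.
move=> ra A1; apply: cmeas_hol_comp => //; first by apply: cmeas_conj; exact: cmeas_cpt.
by move=> p /A1 /(diskE p ler01); rewrite normcJ.
Qed.

Lemma bdm_holJ a r : rad1 a -> 0 <= r < 1 -> bdm (disk r) (fun p => hol a (conjc (cpt p))).
Proof.
move=> ra r01; split; first by apply: cmeas_holJ => //; exact: disk_sub.
have [K hK] := psum_bd ra r01; exists K => p; case/andP: (r01) => r0 _.
by move=> /(diskE p r0) /ltW pr; have [] := hK 0%N (conjc (cpt p)); rewrite ?normcJ.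
Qed.

Lemma bdm_psum a n r F : bdm (disk r) F -> bdm (disk r) (fun p => psum a n (F p)).
Proof.
move=> bF; apply: (@bdm_sum _ _ n (fun k p => a k * F p ^+ k)) => k.
by apply: bdmM; [exact: bdm_cst|exact: bdmX].
Qed.

Lemma cint_psum a b n r : 0 < r < 1 ->
  cint (disk r) (fun p => psum a n (cpt p) * psum b n (conjc (cpt p))) =
  \sum_(k < n) a k * b k * (mom k r)%:C.
Proof.
move=> /andP[r0 r1]; have r01 : 0 <= r < 1 by rewrite ltW.
have mD := @measurable_disk R r; have fD := area_disk_lty r01.
have bz : bdm (disk r) (@cpt R) by apply: bdm_cpt; exact: ltW.
have bj := bdm_conj bz.
have bjk j k : bdm (disk r) (fun p => cpt p ^+ j * conjc (cpt p) ^+ k).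
  by apply: bdmM; exact: bdmX.
have bc j k : bdm (disk r) (fun p => a j * b k * (cpt p ^+ j * conjc (cpt p) ^+ k)).
  by apply: bdmM => //; exact: bdm_cst.
rewrite (cint_eq (G := fun p => \sum_(j < n) \sum_(k < n)
    a j * b k * (cpt p ^+ j * conjc (cpt p) ^+ k))); last first.
  move=> p _; rewrite /psum mulr_suml; apply: eq_bigr => j _.
  by rewrite mulr_sumr; apply: eq_bigr => k _; ring.
rewrite (cint_sum n (F := fun j p => \sum_(k < n) a j * b k * (cpt p ^+ j * conjc (cpt p) ^+ k)) mD fD); last first.
  by move=> j; apply: (@bdm_sum _ _ n (fun k p => a j * b k * (cpt p ^+ j * conjc (cpt p) ^+ k))).
apply: eq_bigr => j _.
rewrite (cint_sum n (F := fun k p => a j * b k * (cpt p ^+ j * conjc (cpt p) ^+ k)) mD fD)//.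
rewrite (bigD1 j)//= big1 ?addr0 => [|k kj]; last first.
  by rewrite cintZ// cint_orth ?mulr0// eq_sym.
rewrite cintZ//; congr (_ * _); rewrite -cint_real//.
by apply: cint_eq => p _; rewrite -exprMn cptMJ rmorphXn.
Qed.

(** 1/(k + 1) is the normalised moment of |z|^(2k), so that the pairing over a disk of radius r
    becomes the value of this series at r^2, up to a factor. *)
Definition avg a b : nat -> C := fun k => (k.+1%:R^-1)%:C * (a k * b k).

Lemma rad1_avg a b : rad1 a -> rad1 b -> rad1 (avg a b).
Proof.
move=> ra rb; apply: (@rad1_mul _ _ _ 1) (rad1M ra rb) _ => k.
by rewrite normc_real ger0_norm ?invr_ge0// invf_le1 ?ltr0n// ler1n.
Qed.

Lemma cint_pair a b r : rad1 a -> rad1 b -> 0 < r < 1 ->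
  cint (disk r) (fun p => hol a (cpt p) * hol b (conjc (cpt p))) =
  (r ^+ 2 * cA)%:C * hol (avg a b) ((r ^+ 2)%:C).
Proof.
move=> ra rb rr; have /andP[r0 r1] := rr; have r01 : 0 <= r < 1 by rewrite ltW.
have mD := @measurable_disk R r; have fD := area_disk_lty r01.
have bz : bdm (disk r) (@cpt R) by apply: bdm_cpt; exact: ltW.
have [Ka hKa] := psum_bd ra r01; have [Kb hKb] := psum_bd rb r01.
have L1 : cint (disk r) (fun p => psum a n (cpt p) * psum b n (conjc (cpt p))) @[n --> \oo] -->
    cint (disk r) (fun p => hol a (cpt p) * hol b (conjc (cpt p))).
  apply: (cint_dct mD _ _ (measurable_cst (Ka * Kb))).
  - by move=> n; apply: (proj1 (bdmM (bdm_psum a n bz) (bdm_psum b n (bdm_conj bz)))).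
  - exact: (proj1 (bdmM (bdm_hol ra r01) (bdm_holJ rb r01))).
  - exact: integ_cst_fin.
  - move=> p /(diskE p (ltW r0)) pr; apply: cvgM; apply: hol_cvg => //.
      exact: lt_trans r1.
    by rewrite normcJ; exact: lt_trans r1.
  - move=> n p /(diskE p (ltW r0)) /ltW pr; rewrite normcM.
    have prJ : normc (conjc (cpt p)) <= r by rewrite normcJ.
    by rewrite ler_pM ?normc_ge0 ?(proj1 (hKa n _ pr)) ?(proj1 (hKb n _ prJ)).
have r21 : normc ((r ^+ 2)%:C : C) < 1.
  by rewrite normc_real ger0_norm ?exprn_ge0 ?(ltW r0)// exprn_ilt1// ltW.
have L2 : ((r ^+ 2 * cA)%:C * psum (avg a b) n ((r ^+ 2)%:C) : C) @[n --> \oo] -->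
    ((r ^+ 2 * cA)%:C * hol (avg a b) ((r ^+ 2)%:C) : C).
  by apply: cvgMr; apply: hol_cvg => //; exact: rad1_avg.
apply: (cvg_unique _ L1); first exact: norm_hausdorff.
rewrite (_ : (fun n => cint _ _) = fun n => (r ^+ 2 * cA)%:C * psum (avg a b) n ((r ^+ 2)%:C))//.
apply/funext => n; rewrite cint_psum// /psum mulr_sumr; apply: eq_bigr => k _.
rewrite momE// /avg exprS -rmorphXn.
have -> : r ^+ 2 * (r ^+ 2) ^+ k * (cA / k.+1%:R) = r ^+ 2 * cA * k.+1%:R^-1 * (r ^+ 2) ^+ k by ring.
by rewrite !rmorphM; ring.
Qed.

End Moments.

(** * Absolutely convergent form of the pairing and weak-star convergence *)

Section Duality.
Set Implicit Arguments.
Unset Strict Implicit.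
Import ComplexField.Normc.
Local Open Scope complex_scope.
Local Open Scope ring_scope.
Context {R : realType}.
Notation C := (Cx R).
Notation RR := (measurableTypeR R).
Notation R2 := (RR * RR)%type.
Notation normI A F := (integ A (fun p => normc (F p))).
Notation mfun A f := (@measurable_fun _ _ R2 R A f).
Implicit Types (a b g h : nat -> C) (z w u : C) (F G : R2 -> C) (A : set R2).

(** Coefficients of z f(z); a factor |z|^2 in an integrand is split as z conj z between the two
    series. *)
Definition up a : nat -> C := fun k => if k is k'.+1 then a k' else 0.

Lemma rad1_up a : rad1 a -> rad1 (up a).
Proof.
move=> ra r r01; have [M hM] := ra r r01; have /andP[r0 r1] := r01.
have M0 : 0 <= M by rewrite (le_trans _ (hM 0%N))// expr0 mulr1 normc_ge0.
exists M => -[|k]; first by change (normc (0 : C) * r ^+ 0 <= M); rewrite normc0 mul0r.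
change (normc (a k) * r ^+ k.+1 <= M); rewrite exprS mulrCA (le_trans _ (hM k))// ler_piMl ?mulr_ge0 ?normc_ge0 ?exprn_ge0//.
exact: ltW.
Qed.

Lemma hol_up a z : rad1 a -> normc z < 1 -> hol (up a) z = z * hol a z.
Proof. by move=> ra z1; rewrite holXM ?add0r//; exact: rad1_up. Qed.

Definition shift a : nat -> C := fun k => a k.+1.

(** The weight is a parameter because it is 1 - |z|^2 / r^2 on the disk of radius r and 1 - |z|^2 in
    the limit. *)
Definition Qint A (w : R2 -> R) g b : C :=
  cint A (fun p => (w p)%:C * (hol (shift g) (cpt p) * hol b (conjc (cpt p)))).

Lemma normc_sqr_lt1 (x : R) : 0 <= x < 1 -> normc ((x ^+ 2)%:C : C) < 1.
Proof. by move=> /andP[x0 x1]; rewrite normc_real ger0_norm ?exprn_ge0// exprn_ilt1. Qed.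

(* The weight 1 - |z|^2 / r^2 turns the coefficient 1 / (k + 1) of the moments
   into 1 / ((k + 1) (k + 2)), which pays for the derivative falling on h. *)
Lemma cint_disk_Qint g h r : rad1 g -> rad1 h -> 0 < r < 1 ->
  cint (disk r) (fun p => hol g (cpt p) * hol h (conjc (cpt p))) =
  (r ^+ 2)%:C * (cA%:C * (g 0%N * h 0%N) +
    Qint (disk r) (fun p => 1 - sq p / r ^+ 2) g (dv h)).
Proof.
move=> rg rh rr; have /andP[r0 r1] := rr.
have r01 : (0 <= r) && (r < 1) by rewrite ltW.
have mD := @measurable_disk R r; have fD := area_disk_lty r01.
have rs : rad1 (shift g) := rad1S rg; have rd := rad1_dv rh.
have x1 := normc_sqr_lt1 r01.
have r2 : r ^+ 2 != 0 by rewrite expf_neq0// gt_eqF.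
have nd p : disk r p -> normc (cpt p) < 1.
  by move=> /(diskE p (ltW r0)) pr; exact: lt_trans r1.
have ndJ p : disk r p -> normc (conjc (cpt p)) < 1 by rewrite normcJ; exact: nd.
pose q k : C := (k.+2%:R^-1)%:C * (g k.+1 * h k.+1).
have rq : rad1 q.
  apply: (@rad1_mul _ _ _ 1) (rad1M rs (rad1S rh)) _ => k.
  by rewrite normc_real ger0_norm ?invr_ge0// invf_le1 ?ltr0n// ler1n.
have HQ : Qint (disk r) (fun p => 1 - sq p / r ^+ 2) g (dv h) =
    (r ^+ 2 * cA)%:C * hol q ((r ^+ 2)%:C).
  have bF := bdmM (bdm_hol rs r01) (bdm_holJ rd r01).
  have bG := bdmM (bdm_hol (rad1_up rs) r01) (bdm_holJ (rad1_up rd) r01).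
  have bcG := bdmM (bdm_cst (disk r) (- (r ^- 2)%:C)) bG.
  have -> : Qint (disk r) (fun p => 1 - sq p / r ^+ 2) g (dv h) =
    cint (disk r) (fun p => hol (shift g) (cpt p) * hol (dv h) (conjc (cpt p)) +
      (- (r ^- 2)%:C) * (hol (up (shift g)) (cpt p) * hol (up (dv h)) (conjc (cpt p)))).
    apply: cint_eq => p Dp; rewrite !hol_up ?nd ?ndJ//.
    have -> : (1 - sq p / r ^+ 2)%:C = 1 - cpt p * conjc (cpt p) * (r ^- 2)%:C :> C.
      by rewrite cptMJ rmorphB rmorph1 rmorphM.
    move: ((r ^- 2)%:C) (cpt p) (conjc _) (hol (dv h) _) (hol (shift g) _) => t z zc Y X.
    ring.
  rewrite (cintD mD fD bF bcG) (cintZ _ mD fD bG) !cint_pair//; last 2 first.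
  - exact: rad1_up.
  - exact: rad1_up.
  have ru := rad1_avg (rad1_up rs) (rad1_up rd).
  have a0 : avg (up (shift g)) (up (dv h)) 0%N = 0.
    by change (((1%:R : R)^-1)%:C * ((0 : C) * 0) = 0); rewrite mul0r mulr0.
  rewrite (holXM ru x1) a0 add0r.
  (* (k + 1)/(k + 2) = 1 - 1/(k + 2), while in [avg (shift g) (dv h)] the moment factor 1/(k + 1)
     cancels the k + 1 of the derivative. After subtraction of the weighted term only [q]
     remains. *)
  have -> : (fun k => avg (up (shift g)) (up (dv h)) k.+1) =
      fun k => avg (shift g) (dv h) k - q k.
    apply/funext => k; rewrite /avg /q /up /shift /dv.
    have E : (k.+1%:R : C) = (k.+1%:R : R)%:C by rewrite rmorph_nat.
    have P (x y u v : C) : x * (u * (y * v)) = (x * y) * (u * v) by ring.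
    rewrite E !P -!rmorphM -mulrBl -rmorphB; congr (_%:C * _).
    rewrite mulVf ?pnatr_eq0//; apply: (mulfI (_ : k.+2%:R != 0 :> R)); first by rewrite pnatr_eq0.
    rewrite mulrA mulrBr !mulfV ?pnatr_eq0// mul1r mulr1.
    by rewrite -[k.+2%:R]natr1 addrK.
  rewrite (holB (rad1_avg rs rd) rq x1).
  have hr : (r ^- 2)%:C * (r ^+ 2)%:C = 1 :> C by rewrite -rmorphM mulVf// rmorph1.
  move: hr; move: ((r ^+ 2)%:C) ((r ^- 2)%:C) ((r ^+ 2 * cA)%:C) (hol q _) (hol (avg _ _) _).
  move=> s ri t Xq X1 hr.
  have -> : - ri * (t * (s * (X1 - Xq))) = - ((ri * s) * (t * (X1 - Xq))) by ring.
  by rewrite hr; ring.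
rewrite HQ cint_pair// (holXM (rad1_avg rg rh) x1).
have -> : (fun k => avg g h k.+1) = q by [].
have -> : avg g h 0 = g 0%N * h 0%N by rewrite /avg invr1 rmorph1 mul1r.
have -> : (r ^+ 2 * cA)%:C = (r ^+ 2)%:C * cA%:C :> C by rewrite rmorphM.
move: (cA%:C) ((r ^+ 2)%:C) (h 0%N) (g 0%N) (hol q _) => c t y x X.
ring.
Qed.

Lemma pair_rE g h r : rad1 g -> rad1 h -> 0 < r < 1 ->
  pair_r g h r = (pi^-1 * r ^+ 2)%:C * (cA%:C * (g 0%N * h 0%N) +
    Qint (disk r) (fun p => 1 - sq p / r ^+ 2) g (dv h)).
Proof.
move=> rg rh rr; rewrite (rmorphM (real_complex R) pi^-1 (r ^+ 2)) -[RHS]mulrA -(cint_disk_Qint rg rh rr).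
by apply/eqP; rewrite eq_complex /= /rint !mul0r subr0 addr0 !eqxx.
Qed.

Lemma integ_lty_hol g : inA1 g -> (normI (disk 1) (fun p => hol g (cpt p)) < +oo)%E.
Proof.
move=> [hg gfin]; rewrite ltNge leye_eq; apply/negP => /eqP E.
have : (pi^-1%:E * normI (disk 1) (fun p => hol g (cpt p)) < +oo)%E := gfin.
by rewrite E mulry gtr0_sg ?invr_gt0 ?pi_gt0// mul1e ltxx.
Qed.

(** For |z| > 1/2 division of g(z) - g(0) by z costs a factor 2; on |z| <= 1/2 the function is
    bounded by a constant. *)
Lemma shift_bound g : rad1 g -> exists M : R, forall z, normc z < 1 ->
  normc (hol (shift g) z) <= 2 * normc (hol g z) + M.
Proof.
move=> rg; have rs : rad1 (shift g) := rad1S rg.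
have h01 : ((0 : R) <= 2^-1) && ((2^-1 : R) < 1) by rewrite invr_ge0 ler0n invf_lt1 ?ltr0n ?ltr1n.
have [K hK] := psum_bd rs h01.
have K0 : 0 <= K.
  by have [_] := hK 0%N 0 (ltac:(rewrite normc0 invr_ge0 ler0n//)); apply: le_trans; exact: normc_ge0.
exists (K + 2 * normc (g 0%N)) => z z1.
have g0 := normc_ge0 (g 0%N); have gz := normc_ge0 (hol g z).
have [zh|zh] := lerP (normc z) 2^-1.
  have [_ h] := hK 0%N z zh; apply: le_trans h _.
  by rewrite addrA -addrA addrCA lerDl addr_ge0 ?mulr_ge0.
have E : normc z * normc (hol (shift g) z) <= normc (hol g z) + normc (g 0%N).
  rewrite -normcM; have := holXM rg z1; rewrite -/(shift g) => e.
  have -> : z * hol (shift g) z = hol g z - g 0%N by rewrite e addrC addKr.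
  by rewrite (le_trans (le_normcD _ _))// normcN.
have s0 := normc_ge0 (hol (shift g) z).
have : 2^-1 * normc (hol (shift g) z) <= normc (hol g z) + normc (g 0%N).
  by apply: le_trans E; rewrite ler_wpM2r// ltW.
rewrite mulrC ler_pdivrMr ?ltr0n// => T.
by apply: le_trans T _; lra.
Qed.

Lemma shift_integ g (B : R) : inA1 g -> 0 <= B ->
  (integ (disk 1) (fun p => B * normc (hol (shift g) (cpt p)))%R < +oo)%E.
Proof.
move=> hg B0; have rg := holo_rad1 hg.1; have rs : rad1 (shift g) := rad1S rg.
have mD := @measurable_disk R 1.
have [M hM] := shift_bound rg.
have M0 : 0 <= 2 * normc (hol g 0) + M.
  by apply: le_trans (hM 0 _); rewrite ?normc0 ?normc_ge0.
have mg := mfun_normc_hol rg; have ms := mfun_normc_hol rs.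
rewrite (integZ mD ms (fun p _ => normc_ge0 _) B0).
suff : (integ (disk 1) (fun p => normc (hol (shift g) (cpt p))) < +oo)%E.
  have i0 : (0 <= integ (disk 1) (fun p => normc (hol (shift g) (cpt p))))%E.
    by apply: integ_ge0 => p _; exact: normc_ge0.
  by move=> f; rewrite -[integ _ _]fineK ?ge0_fin_numE// -EFinM ltry.
have m2 : mfun (disk 1) (fun p => 2 * normc (hol g (cpt p))).
  by apply: measurable_funM => //; exact: measurable_cst.
have mM : mfun (disk 1) (fun=> `|M|) by exact: measurable_cst.
have p2 p : 0 <= 2 * normc (hol g (cpt p)) by rewrite mulr_ge0 ?normc_ge0.
apply: (@le_lt_trans _ _ (integ (disk 1) (fun p => 2 * normc (hol g (cpt p)) + `|M|))).
  apply: integ_le => //.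
  - exact: measurable_funD.
  - by move=> p _; exact: normc_ge0.
  - move=> p /(diskE p ler01) p1; apply: le_trans (hM _ p1) _.
    by rewrite lerD2l ler_norm.
rewrite (integD mD m2 mM (fun p _ => p2 p) (fun p _ => normr_ge0 M)).
rewrite (integZ mD mg (fun p _ => normc_ge0 _) (ler0n R 2)).
have i0 : (0 <= integ (disk 1) (fun p => normc (hol g (cpt p))))%E.
  by apply: integ_ge0 => p _; exact: normc_ge0.
apply: lte_add_pinfty; last by apply: integ_cst_fin => //; exact: area_disk_fin.
by rewrite -[integ _ _]fineK ?ge0_fin_numE// ?integ_lty_hol// -EFinM ltry.
Qed.

Lemma cmeas_Q A (w : R2 -> R) g b : mfun A w -> rad1 g -> rad1 b -> A `<=` disk 1 ->
  cmeas A (fun p => (w p)%:C * (hol (shift g) (cpt p) * hol b (conjc (cpt p)))).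
Proof.
move=> mw rg rb A1; apply: cmeasM.
  by split => //=; exact: measurable_cst.
apply: cmeasM; [apply: cmeas_hol => //; exact: rad1S|exact: cmeas_holJ].
Qed.

Lemma mfun_weight A (k : R) : mfun A (fun p => 1 - k * sq p).
Proof.
apply: measurable_funB; first exact: measurable_cst.
by apply: measurable_funM; [exact: measurable_cst|exact: mfun_sq].
Qed.

Lemma mfun_weight1 A : mfun A (fun p => 1 - sq p).
Proof. by apply: measurable_funB; [exact: measurable_cst|exact: mfun_sq]. Qed.

(** Extension by zero puts integrals over varying disks on one domain, as dominated convergence
    requires. *)
Definition cut r F : R2 -> C := fun p => if p \in disk r then F p else 0.

Lemma cmeas_cut r F : (0 <= r) && (r < 1) -> cmeas (disk r) F -> cmeas (disk 1) (cut r F).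
Proof.
move=> r01 [F1 F2].
have mr := @measurable_disk R r; have m1 := @measurable_disk R 1.
have I : disk 1 `&` disk r = disk r :> set R2 by apply/setIidr/disk_sub.
split.
  rewrite (_ : (fun p => _) = (fun p => complex.Re (F p)) \_ (disk r)).
    by apply/(measurable_restrict _ mr m1); rewrite I.
  by apply/funext => p; rewrite /cut /patch; case: ifP.
rewrite (_ : (fun p => _) = (fun p => complex.Im (F p)) \_ (disk r)).
  by apply/(measurable_restrict _ mr m1); rewrite I.
by apply/funext => p; rewrite /cut /patch; case: ifP.
Qed.

Lemma cint_cut r F : (0 <= r) && (r < 1) -> cint (disk 1) (cut r F) = cint (disk r) F.
Proof.
move=> r01.
have I : disk 1 `&` disk r = disk r :> set R2 by apply/setIidr/disk_sub.
rewrite /cint /rint; congr Complex; congr fine.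
  rewrite /integ -[in RHS]I [RHS]integral_mkcondr; apply: eq_integral => p _.
  by rewrite /cut /patch; case: ifP.
rewrite /integ -[in RHS]I [RHS]integral_mkcondr; apply: eq_integral => p _.
by rewrite /cut /patch; case: ifP.
Qed.

(** A weight dominated by 1 - |z|^2 absorbs the growth of b, whose bound applies at conj z because
    it depends on the modulus alone. *)
Lemma Qint_bound (x B : R) g b p : (forall z, normc z < 1 -> (1 - normc z ^+ 2) * normc (hol b z) <= B) ->
  disk 1 p -> `|x| <= 1 - sq p ->
  normc (x%:C * (hol (shift g) (cpt p) * hol b (conjc (cpt p)))) <=
  B * normc (hol (shift g) (cpt p)).
Proof.
move=> hB /(diskE p ler01) p1 xp; rewrite normcM normcM normc_real.
have := hB (conjc (cpt p)); rewrite normcJ => /(_ p1); rewrite -sq_normc => {}hB.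
rewrite mulrCA mulrC; apply: ler_wpM2r; first exact: normc_ge0.
by apply: le_trans hB; apply: ler_wpM2r; first exact: normc_ge0.
Qed.

Lemma Qint_cvg_seq g b (B : R) (v : nat -> R) : inA1 g -> rad1 b ->
  (forall z, normc z < 1 -> (1 - normc z ^+ 2) * normc (hol b z) <= B) ->
  (forall n, 0 < v n < 1) -> v n @[n --> \oo] --> (1 : R) ->
  Qint (disk (v n)) (fun p => 1 - sq p / v n ^+ 2) g b @[n --> \oo] -->
  Qint (disk 1) (fun p => 1 - sq p) g b.
Proof.
move=> hg rb hB v01 v1; have rg := holo_rad1 hg.1.
have v01' n : (0 <= v n) && (v n < 1) by have /andP[a ->] := v01 n; rewrite ltW.
have B0 : 0 <= B.
  apply: le_trans (hB 0 _); last by rewrite normc0.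
  by rewrite normc0 expr0n subr0 mul1r normc_ge0.
pose w n p : R := 1 - sq p / v n ^+ 2.
have mw n : mfun (disk (v n)) (w n).
  rewrite (_ : w n = fun p => 1 - v n ^- 2 * sq p); first exact: mfun_weight.
  by apply/funext => p; rewrite /w mulrC.
rewrite (_ : (fun n => _) = fun n => cint (disk 1) (cut (v n)
   (fun p => (w n p)%:C * (hol (shift g) (cpt p) * hol b (conjc (cpt p)))))); last first.
  by apply/funext => n; rewrite cint_cut.
apply: (@cint_dct _ _ _ _ (fun p => B * normc (hol (shift g) (cpt p)))).
- exact: measurable_disk.
- by move=> n; apply: cmeas_cut => //; apply: cmeas_Q => //; exact: disk_sub.
- by apply: cmeas_Q => //; exact: mfun_weight1.
- apply: measurable_funM; first exact: measurable_cst.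
  by apply: mfun_normc_hol; exact: rad1S.
- exact: shift_integ.
- move=> p p1; have np : normc (cpt p) < 1 by apply/(diskE p ler01).
  have L : (w n p)%:C * (hol (shift g) (cpt p) * hol b (conjc (cpt p))) @[n --> \oo] -->
      ((1 - sq p)%:C * (hol (shift g) (cpt p) * hol b (conjc (cpt p))) : C).
    have W : w n p @[n --> \oo] --> 1 - sq p.
      have -> : 1 - sq p = 1 - sq p * (1 ^+ 2)^-1 by rewrite expr1n invr1 mulr1.
      apply: cvgB; first exact: cvg_cst.
      apply: cvgM; first exact: cvg_cst.
      apply: cvgV; first by rewrite expr1n oner_neq0.
      exact: (cvgM v1 v1).
    apply: (@cvgM _ _ _ _ (fun n => (w n p)%:C) (fun=> _)); last exact: cvg_cst.
    by apply: cvgc_ReIm => //=; exact: cvg_cst.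
  (* A fixed point of the unit disk lies in the disk of radius [v n] for all large n, where the cut
     changes nothing. *)
  apply: cvg_trans L; apply: near_eq_cvg.
  have np' : 0 < 1 - normc (cpt p) by rewrite subr_gt0.
  have /cvgrPdist_lt /(_ _ np') := v1; apply: filterS => n vn.
  rewrite /cut ifT// inE; apply/diskE; first by case/andP: (v01' n).
  move: vn; have /andP[_ vn1] := v01' n.
  by rewrite ger0_norm ?subr_ge0 ?ltW// ltrBlDr -ltrBlDl opprB addrCA subrr addr0.
- move=> n p p1; rewrite /cut; case: ifPn => [|_]; last first.
    by rewrite normc0 mulr_ge0 ?normc_ge0.
  rewrite inE => pv; apply: Qint_bound => //.
  have /andP[v0 vn1] := v01 n; have vv : 0 < v n ^+ 2 by rewrite exprn_gt0.
  have w0 : 0 <= w n p by rewrite /w subr_ge0 ler_pdivrMr// mul1r ltW.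
  (* As [v n < 1], the weight 1 - |z|^2 / (v n)^2 is at most 1 - |z|^2, so one majorant serves all
     radii. *)
  rewrite ger0_norm// lerD2l lerN2 ler_pdivlMr// ler_piMr ?sq_ge0//.
  by rewrite expr_le1 ?ltW.
Qed.

Definition Lpair g h : C :=
  (pi^-1)%:C * (cA%:C * (g 0%N * h 0%N) + Qint (disk 1) (fun p => 1 - sq p) g (dv h)).

Lemma pair_cvg_seq g h (B : R) (v : nat -> R) : inA1 g -> rad1 h ->
  (forall z, normc z < 1 -> (1 - normc z ^+ 2) * normc (hol (dv h) z) <= B) ->
  (forall n, v n < 1) -> v n @[n --> \oo] --> (1 : R) ->
  pair_r g h (v n) @[n --> \oo] --> Lpair g h.
Proof.
move=> hg rh hB vlt v1; have rg := holo_rad1 hg.1.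
(* Only finitely many [v n] are affected; the new radii are positive, as [pair_rE] requires. *)
pose v' n := Num.max (v n) 2^-1.
have h1 : (2^-1 : R) < 1 by rewrite invf_lt1 ?ltr0n ?ltr1n.
have h0 : 0 < (2^-1 : R) by rewrite invr_gt0 ltr0n.
have v01 n : 0 < v' n < 1 by rewrite /v' lt_max h0 orbT gt_max vlt h1.
have E : \forall n \near \oo, v n = v' n.
  have d0 : 0 < 1 - 2^-1 :> R by rewrite subr_gt0.
  have /cvgrPdist_lt /(_ _ d0) := v1; apply: filterS => n.
  rewrite ger0_norm ?subr_ge0 ?ltW// ltrD2l ltrN2 => hv.
  by rewrite /v' max_l// ltW.
have v1' : v' n @[n --> \oo] --> (1 : R).
  by apply: cvg_trans v1; apply: near_eq_cvg.
have H := Qint_cvg_seq hg (rad1_dv rh) hB v01 v1'.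
apply: (@cvg_trans _ ((pi^-1 * v' n ^+ 2)%:C * (cA%:C * (g 0%N * h 0%N) +
    Qint (disk (v' n)) (fun p => 1 - sq p / v' n ^+ 2) g (dv h)) @[n --> \oo])).
  apply: near_eq_cvg; move: E; apply: filterS => n ->.
  by rewrite pair_rE.
rewrite /Lpair; apply: (@cvgM _ _ _ _ (fun n => (pi^-1 * v' n ^+ 2)%:C)).
  apply: cvgc_ReIm => /=; last exact: cvg_cst.
  have T : pi^-1 * v' n ^+ 2 @[n --> \oo] --> (pi^-1 * 1 ^+ 2 : R).
    by apply: cvgM; [exact: cvg_cst|exact: (cvgM v1' v1')].
  by move: T; rewrite expr1n mulr1.
by apply: cvgD; [exact: cvg_cst|exact: H].
Qed.

(** Dominated convergence concerns sequences, so the left limit is tested along sequences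
    approaching 1 from below, for the real and imaginary parts separately. *)
Lemma pair_cvg g h (B : R) : inA1 g -> rad1 h ->
  (forall z, normc z < 1 -> (1 - normc z ^+ 2) * normc (hol (dv h) z) <= B) ->
  pair_r g h r @[r --> (1 : R)^'-] --> Lpair g h.
Proof.
move=> hg rh hB; apply: cvgc_ReIm; apply/cvg_at_leftP => v [v1 vc].
  by apply: cvgc_Re; exact: pair_cvg_seq hB v1 vc.
by apply: cvgc_Im; exact: pair_cvg_seq hB v1 vc.
Qed.

Lemma pairingE g h (B : R) : inA1 g -> rad1 h ->
  (forall z, normc z < 1 -> (1 - normc z ^+ 2) * normc (hol (dv h) z) <= B) ->
  pairable g h /\ pairing g h = Lpair g h.
Proof.
move=> hg rh hB; have H := pair_cvg hg rh hB; split.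
  by apply/cvg_ex; exists (Lpair g h).
by apply: cvg_lim H; exact: norm_hausdorff.
Qed.

Lemma bloch_bound h : inB h -> exists B : R, forall z, normc z < 1 ->
  (1 - normc z ^+ 2) * normc (hol (dv h) z) <= B.
Proof.
move=> [hh fin]; have rh := holo_rad1 hh; exists (fine (bloch_semi h)) => z z1.
have U : (((1 - normc z ^+ 2) * normc (hol (dv h) z))%:E <= bloch_semi h)%E.
  by apply: ereal_sup_ubound; exists z => //; rewrite hol'E.
rewrite -lee_fin fineK// fin_numElt fin andbT.
by apply: lt_le_trans U; rewrite ltNyr.
Qed.

(** Off the origin this is [dv_mult_sup] on the circle through z. At the origin the derivative is
    the coefficient of index 1, and |l 1| <= K. *)
Lemma bloch_bound_mult (l : nat -> C) K h (B : R) : bmul l K -> rad1 h ->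
  (forall z, normc z < 1 -> (1 - normc z ^+ 2) * normc (hol (dv h) z) <= B) ->
  forall z, normc z < 1 -> (1 - normc z ^+ 2) * normc (hol (dv (fun k => l k * h k)) z) <= K * B.
Proof.
move=> lK rh hB z z1.
have q0 : 0 < 1 - normc z ^+ 2 by rewrite subr_gt0 exprn_ilt1// normc_ge0.
have [zz|z0] := eqVneq (normc z) 0.
  have {}zz : z = 0 by exact: eq0_normc.
  have h0 : normc (0 : C) < 1 by rewrite normc0.
  have e0 : normc (hol (dv (fun k => l k * h k)) 0) = normc (l 1%N) * normc (dv h 0%N).
    by rewrite hol0 dv_mult -normcM.
  have b0 : normc (dv h 0%N) <= B.
    by have := hB 0 h0; rewrite hol0 normc0 expr0n subr0 mul1r.
  rewrite zz e0 normc0 expr0n subr0 mul1r.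
  exact: (ler_pM (normc_ge0 _) (normc_ge0 _) (bmul_norm 1 lK) b0).
have zp : (0 < normc z) && (normc z < 1) by rewrite lt_def z0 normc_ge0.
have hS w : normc w = normc z -> normc (hol (dv h) w) <= B / (1 - normc z ^+ 2).
  move=> wz; rewrite ler_pdivlMr// mulrC; have := hB w; rewrite wz => hw; exact: hw.
have := dv_mult_sup lK rh zp hS; rewrite mulrA ler_pdivlMr// mulrC; exact.
Qed.

Lemma pairing_sigma_cvg (alpha : R) h g : 0 < alpha -> inB h -> inA1 g ->
  [/\ pairable g h, (forall n, pairable g (sigma alpha n h)) &
      pairing g (sigma alpha n h) @[n --> \oo] --> pairing g h].
Proof.
move=> a0 hh hg; have rh := holo_rad1 hh.1; have rg := holo_rad1 hg.1.
have [B hB] := bloch_bound hh; have [K K0 hK] := bmul_ces a0.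
have B0 : 0 <= B.
  apply: le_trans (hB 0 _); last by rewrite normc0.
  by rewrite normc0 expr0n subr0 mul1r normc_ge0.
have rs n := rad1_sigma n a0 rh.
have hBn n z : normc z < 1 -> (1 - normc z ^+ 2) * normc (hol (dv (sigma alpha n h)) z) <= K * B.
  by rewrite sigmaE//; exact: (bloch_bound_mult (hK n) rh hB).
have [P1 E1] := pairingE hg rh hB.
split; [exact: P1|by move=> n; exact: (pairingE hg (rs n) (hBn n)).1|].
(* The constant term is unchanged, so only the integral in [Lpair] depends on n. *)
have s0 n : sigma alpha n h 0%N = h 0%N.
  by rewrite sigmaE// /ces subn0 divff ?gt_eqF ?mu_gt0// mul1r.
have E2 n : pairing g (sigma alpha n h) = (pi^-1)%:C * (cA%:C * (g 0%N * h 0%N) +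
    Qint (disk 1) (fun p => 1 - sq p) g (dv (sigma alpha n h))).
  by rewrite (pairingE hg (rs n) (hBn n)).2 /Lpair s0.
rewrite E1; apply: (@cvg_trans _ ((pi^-1)%:C * (cA%:C * (g 0%N * h 0%N) +
    Qint (disk 1) (fun p => 1 - sq p) g (dv (sigma alpha n h))) @[n --> \oo])).
  by apply: near_eq_cvg; apply: nearW => n; rewrite E2.
apply: cvgMr; apply: cvgD; first exact: cvg_cst.
have m1 := @mfun_weight1 (disk 1).
(* K B bounds (1 - |z|^2) |(sigma n h)'(z)| for every n, which yields one majorant. *)
apply: (@cint_dct _ _ _ _ (fun p => K * B * normc (hol (shift g) (cpt p)))).
- exact: measurable_disk.
- by move=> n; apply: cmeas_Q => //; exact: rad1_dv.
- by apply: cmeas_Q => //; exact: rad1_dv.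
- apply: measurable_funM; first exact: measurable_cst.
  by apply: mfun_normc_hol; exact: rad1S.
- by apply: shift_integ => //; rewrite mulr_ge0.
- move=> p p1; have np : normc (conjc (cpt p)) < 1 by rewrite normcJ; apply/(diskE p ler01).
  (* Pointwise convergence of the derivatives comes from [mult_unif] on the closed disk through the
     point conj z. *)
  apply: cvgMr; apply: cvgMr; apply/cvgcP => e e0.
  have r01 : (0 <= normc (conjc (cpt p))) && (normc (conjc (cpt p)) < 1) by rewrite normc_ge0.
  have e2 : 0 < e / 2 by rewrite divr_gt0.
  have := @mult_unif R nat \oo _ (fun n k => (ces alpha n k.+1)%:C - 1) (K + 1) (dv h) _
    (e / 2) (fun k => ces_sub1_cvg k.+1 a0)
    (nearW _ (fun n k => ces_sub1_bd k.+1 (hK n))) (rad1_dv rh) r01 e2.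
  case=> N _ U; exists N => // n /U {}U; rewrite -holB//; last 2 first.
  + exact: rad1_dv.
  + exact: rad1_dv.
  have -> : (fun k => dv (sigma alpha n h) k - dv h k) = fun k => ((ces alpha n k.+1)%:C - 1) * dv h k.
    by apply/funext => k; rewrite sigmaE// dv_mult mulrBl mul1r.
  by apply: le_lt_trans (U _ (lexx _)) _; rewrite ltr_pdivrMr// ltr_pMr// ltr1n.
- move=> n p p1; apply: Qint_bound => //; first exact: hBn.
  have le11 : ((0 : R) <= 1) && ((1 : R) <= 1) by rewrite ler01 le_refl.
  by rewrite ger0_norm// subr_ge0; exact: (sqX_le1 1 le11 p1).
Qed.

End Duality.

Theorem theorem5p8 (R : realType) (alpha : R) (halpha : 0 < alpha) :
  (* (1) norm convergence in A^1 *)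
  (forall g : nat -> Cx R, inA1 g ->
     A1norm (fun k => sigma alpha n g k - g k) @[n --> \oo] --> 0%E) /\
  (* (2) weak-star convergence in B = (A^1)^* *)
  (forall h : nat -> Cx R, inB h ->
     forall g : nat -> Cx R, inA1 g ->
       [/\ pairable g h,
           (forall n, pairable g (sigma alpha n h)) &
           pairing g (sigma alpha n h) @[n --> \oo] --> pairing g h]) /\
  (* (3) norm convergence in B for f in B_0 *)
  (forall f : nat -> Cx R, inB0 f ->
     Bnorm (fun k => sigma alpha n f k - f k) @[n --> \oo] --> 0%E).
Proof.
split; [|split].
- by move=> g; exact: A1norm_sigma_cvg.
- by move=> h hh g hg; exact: pairing_sigma_cvg.
- by move=> f; exact: Bnorm_sigma_cvg.
Qed.
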